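(* For every integer $n\ge0$, the reproducing kernel of the quaternionic true polyanalytic Fock space $\mathcal F_T^n(\mathbb H)$ is $$K_{n+1}(q,r)=2e_*(2\pi q\bar r)*\left(\sum_{k=0}^{n}(-1)^k\binom{n}{n-k}\frac1{k!}\bigl(2\pi(\bar qq-q\bar r-\bar qr+\bar rr)\bigr)^{k*}\right),\qquad q,r\in\mathbb H,$$ i.e. for each $r\in\mathbb H$ the function $K_{n+1}(\cdot,r)$ belongs to $\mathcal F_T^n(\mathbb H)$ and $f(r)=\langle f,K_{n+1}(\cdot,r)\rangle_{\mathcal F_T^n(\mathbb H)}$ for all $f\in\mathcal F_T^n(\mathbb H)$.
   Context: $\mathbb H$ is the skew field of quaternions, $\mathbb S=\{q\in\mathbb H: q^2=-1\}$, and for $I\in\mathbb S$, $\mathbb C_I=\mathbb R+\mathbb R I$ with Lebesgue measure $d\lambda_I$; $f_I$ denotes the restriction of $f$ to $\mathbb C_I$. A function $f:\mathbb H\to\mathbb H$ is a (left) slice function if $f(x+Iy)=\alpha(x,y)+I\beta(x,y)$ for all $x,y\in\mathbb R$, $I\in\mathbb S$, with $\alpha$ even and $\beta$ odd in $y$ ($\mathbb H$-valued). It is slice regular if moreover $\alpha,\beta$ are $C^1$ and $\frac12(\partial_x+I\partial_y)f_I(x+Iy)=0$ for all $I\in\mathbb S$. The slice derivative acts on (smooth) slice functions on each slice by $\partial_s f(x+Iy)=\frac12(\partial_x-I\partial_y)f_I(x+Iy)$. The $*$-product of slice functions $f=\alpha+I\beta$ and $g=\alpha'+I\beta'$ is $(f*g)(x+Iy)=(\alpha\alpha'-\beta\beta')+I(\alpha\beta'+\beta\alpha')$;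 $f^{k*}$ denotes the $k$-th $*$-power. All $*$-products and $*$-powers are taken with respect to the variable $q$, with $r$ fixed, and $e_*(2\pi q\bar r):=\sum_{m=0}^\infty\frac{(2\pi)^mq^m\bar r^m}{m!}$. $\mathcal F_T^{n}(\mathbb H)$ is the set of functions $f:\mathbb H\to\mathbb H$ such that (i) $\int_{\mathbb C_I}|f_I(q)|^2e^{-2\pi|q|^2}d\lambda_I(q)<\infty$ for a given $I\in\mathbb S$ (the choice is irrelevant), and (ii) there is a slice regular $H:\mathbb H\to\mathbb H$ with $f(q)=(-1)^n\sqrt{\frac{1}{(2\pi)^n n!}}\,e^{2\pi|q|^2}\partial_s^n\left(e^{-2\pi|q|^2}H(q)\right)$. Its inner product is $\langle f,g\rangle_{\mathcal F_T^n(\mathbb H)}=\int_{\mathbb C_I}\overline{g_I(q)}f_I(q)e^{-2\pi|q|^2}d\lambda_I(q)$, which does not depend on the choice of $I$ for the purpose of the reproducing property (for $r\in\mathbb H$ one may take $I$ with $r\in\mathbb C_I$). *)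

(* Defs.v *)
From HB Require Import structures.
From mathcomp Require Import all_boot all_order all_algebra.
From mathcomp Require Import all_classical all_reals all_analysis.
From mathcomp Require Import ring lra.

Set Implicit Arguments.
Unset Strict Implicit.
Unset Printing Implicit Defensive.

Import Order.TTheory GRing.Theory Num.Theory.
Import numFieldNormedType.Exports.

Local Open Scope classical_set_scope.
Local Open Scope ring_scope.

Record quat (R : Type) := Quat { q0 : R; q1 : R; q2 : R; q3 : R }.

Definition quat_to_prod (R : Type) (q : quat R) := (q0 q, q1 q, q2 q, q3 q).
Definition prod_to_quat (R : Type) (p : R * R * R * R) :=
  let: (a, b, c, d) := p in Quat a b c d.

Lemma quat_to_prodK (R : Type) : cancel (@quat_to_prod R) (@prod_to_quat R).
Proof. by case. Qed.

HB.instance Definition _ (R : choiceType) :=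
  Choice.copy (quat R) (can_type (@quat_to_prodK R)).

Section QuatAlgebra.
Variable R : realType.
Implicit Types p q : quat R.

Definition addq p q :=
  Quat (q0 p + q0 q) (q1 p + q1 q) (q2 p + q2 q) (q3 p + q3 q).
Definition oppq q := Quat (- q0 q) (- q1 q) (- q2 q) (- q3 q).
Definition mulq p q :=
  Quat (q0 p * q0 q - q1 p * q1 q - q2 p * q2 q - q3 p * q3 q)
       (q0 p * q1 q + q1 p * q0 q + q2 p * q3 q - q3 p * q2 q)
       (q0 p * q2 q - q1 p * q3 q + q2 p * q0 q + q3 p * q1 q)
       (q0 p * q3 q + q1 p * q2 q - q2 p * q1 q + q3 p * q0 q).
Definition scaleq (a : R) q := Quat (a * q0 q) (a * q1 q) (a * q2 q) (a * q3 q).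

Fact addqA : associative addq.
Proof. by move=> [? ? ? ?] [? ? ? ?] [? ? ? ?]; congr Quat => /=; ring. Qed.
Fact addqC : commutative addq.
Proof. by move=> [? ? ? ?] [? ? ? ?]; congr Quat => /=; ring. Qed.
Fact add0q : left_id (Quat 0 0 0 0) addq.
Proof. by move=> [? ? ? ?]; congr Quat => /=; ring. Qed.
Fact addNq : left_inverse (Quat 0 0 0 0) oppq addq.
Proof. by move=> [? ? ? ?]; congr Quat => /=; ring. Qed.

HB.instance Definition _ :=
  GRing.isZmodule.Build (quat R) addqA addqC add0q addNq.

Fact mulqA : associative mulq.
Proof. by move=> [? ? ? ?] [? ? ? ?] [? ? ? ?]; congr Quat => /=; ring. Qed.
Fact mul1q : left_id (Quat 1 0 0 0) mulq.
Proof. by move=> [? ? ? ?]; congr Quat => /=; ring. Qed.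
Fact mulq1 : right_id (Quat 1 0 0 0) mulq.
Proof. by move=> [? ? ? ?]; congr Quat => /=; ring. Qed.
Fact mulqDl : left_distributive mulq +%R.
Proof. by move=> [? ? ? ?] [? ? ? ?] [? ? ? ?]; congr Quat => /=; ring. Qed.
Fact mulqDr : right_distributive mulq +%R.
Proof. by move=> [? ? ? ?] [? ? ? ?] [? ? ? ?]; congr Quat => /=; ring. Qed.
Fact oneq_neq0 : Quat 1 0 0 0 != 0 :> quat R.
Proof. by apply/eqP => -[] /eqP; rewrite oner_eq0. Qed.

HB.instance Definition _ := GRing.Zmodule_isNzRing.Build (quat R)
  mulqA mul1q mulq1 mulqDl mulqDr oneq_neq0.

Fact scaleqA a b q : scaleq a (scaleq b q) = scaleq (a * b) q.
Proof. by case: q => *; congr Quat => /=; ring. Qed.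
Fact scale1q : left_id 1 scaleq.
Proof. by move=> [? ? ? ?]; congr Quat => /=; ring. Qed.
Fact scaleqDr : right_distributive scaleq +%R.
Proof. by move=> ? [? ? ? ?] [? ? ? ?]; congr Quat => /=; ring. Qed.
Fact scaleqDl q : {morph scaleq^~ q : a b / a + b}.
Proof. by move=> a b; case: q => *; congr Quat => /=; ring. Qed.

HB.instance Definition _ := GRing.Zmodule_isLmodule.Build R (quat R)
  scaleqA scale1q scaleqDr scaleqDl.

Fact scaleqAl (a : R) p q : a *: (p * q) = (a *: p) * q.
Proof. by case: p => *; case: q => *; congr Quat => /=; ring. Qed.
HB.instance Definition _ := GRing.Lmodule_isLalgebra.Build R (quat R) scaleqAl.

Fact scaleqAr (a : R) p q : a *: (p * q) = p * (a *: q).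
Proof. by case: p => *; case: q => *; congr Quat => /=; ring. Qed.
HB.instance Definition _ := GRing.Lalgebra_isAlgebra.Build R (quat R) scaleqAr.

Definition qconj q := Quat (q0 q) (- q1 q) (- q2 q) (- q3 q).
Definition qnorm q :=
  Num.sqrt (q0 q ^+ 2 + q1 q ^+ 2 + q2 q ^+ 2 + q3 q ^+ 2).

Definition imagunit : set (quat R) := [set I | I ^+ 2 = -1].

Definition slicept (I : quat R) (x y : R) : quat R := x%:A + y *: I.

(* Canonical decomposition q = re q + imdir q * im q, with im q >= 0. On the
   real axis the imaginary unit is not determined by q, and Quat 0 1 0 0 is
   chosen. *)
Definition re q : R := q0 q.
Definition im q : R := qnorm (Quat 0 (q1 q) (q2 q) (q3 q)).
Definition imdir q : quat R :=
  if im q == 0 then Quat 0 1 0 0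
  else (im q)^-1 *: Quat 0 (q1 q) (q2 q) (q3 q).

End QuatAlgebra.

Section QuatAnalysis.
Variable R : realType.
Implicit Types (f g h : quat R -> quat R) (a b : R -> R -> quat R).

Definition qderive1 (u : R -> quat R) (t : R) : quat R :=
  Quat (derive1 (fun s => q0 (u s)) t) (derive1 (fun s => q1 (u s)) t)
       (derive1 (fun s => q2 (u s)) t) (derive1 (fun s => q3 (u s)) t).

Definition qderivable (u : R -> quat R) (t : R) : Prop :=
  [/\ derivable (fun s => q0 (u s)) t 1, derivable (fun s => q1 (u s)) t 1,
      derivable (fun s => q2 (u s)) t 1 & derivable (fun s => q3 (u s)) t 1].

Definition qcontinuous2 a : Prop :=
  [/\ continuous (fun z : R * R => q0 (a z.1 z.2)),
      continuous (fun z : R * R => q1 (a z.1 z.2)),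
      continuous (fun z : R * R => q2 (a z.1 z.2)) &
      continuous (fun z : R * R => q3 (a z.1 z.2))].

Definition partialx a x y : quat R := qderive1 (fun t => a t y) x.
Definition partialy a x y : quat R := qderive1 (fun t => a x t) y.

Definition qC1 a : Prop :=
  [/\ forall x y, qderivable (fun t => a t y) x,
      forall x y, qderivable (fun t => a x t) y,
      qcontinuous2 (partialx a) & qcontinuous2 (partialy a)].

Definition qseries (u : nat -> quat R) : quat R :=
  Quat (limn (series (fun m => q0 (u m)))) (limn (series (fun m => q1 (u m))))
       (limn (series (fun m => q2 (u m)))) (limn (series (fun m => q3 (u m)))).

(* The Lebesgue measure of the slice C_I, in the coordinates (x, y) of x + I y. *)
Definition lambda2 :=
  (@lebesgue_measure R \x @lebesgue_measure R)%E.

Definition qintegral (F : R * R -> quat R) : quat R :=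
  Quat (Rintegral lambda2 setT (fun z => q0 (F z)))
       (Rintegral lambda2 setT (fun z => q1 (F z)))
       (Rintegral lambda2 setT (fun z => q2 (F z)))
       (Rintegral lambda2 setT (fun z => q3 (F z))).

Definition slice_stem f a b : Prop :=
  [/\ forall x y, a x (- y) = a x y,
      forall x y, b x (- y) = - b x y &
      forall I, imagunit I ->
        forall x y, f (slicept I x y) = a x y + I * b x y].

Definition slice_regular f : Prop :=
  exists a b, [/\ slice_stem f a b, qC1 a, qC1 b &
    forall I, imagunit I -> forall x y,
      let fI u v := f (slicept I u v) in
      2^-1 *: (partialx fI x y + I * partialy fI x y) = 0].

(* See slice_derivE below: on the slice functions with differentiable stem this
   is the operator (d/dx - I d/dy) / 2 on every slice C_I. *)
Definition slice_deriv f : quat R -> quat R := fun q =>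
  let I := imdir q in
  let fI u v := f (slicept I u v) in
  2^-1 *: (partialx fI (re q) (im q) - I * partialy fI (re q) (im q)).

(* The pair (stem0 f, stem1 f) is the only possible stem of f
   (see slice_stemE below), here read off the slice of Quat 0 1 0 0. *)
Definition stem0 f (x y : R) : quat R :=
  let I := Quat 0 1 0 0 in 2^-1 *: (f (slicept I x y) + f (slicept I x (- y))).
Definition stem1 f (x y : R) : quat R :=
  let I := Quat 0 1 0 0 in
  - (2^-1 *: (I * (f (slicept I x y) - f (slicept I x (- y))))).

(* On slice functions this is the product of stems on every slice: see starE. *)
Definition star f g : quat R -> quat R := fun q =>
  let x := re q in let y := im q in
  (stem0 f x y * stem0 g x y - stem1 f x y * stem1 g x y)
  + imdir q * (stem0 f x y * stem1 g x y + stem1 f x y * stem0 g x y).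

Fixpoint starpow f (k : nat) : quat R -> quat R :=
  if k is k'.+1 then star f (starpow f k') else fun=> 1.

Definition fock_weight (q : quat R) : R := expR (- (2 * pi * qnorm q ^+ 2)).

(* I is the slice on which square-integrability is tested. No measurability is
   required separately: the representation by h makes f continuous. *)
Definition true_fock (I : quat R) (n : nat) : set (quat R -> quat R) :=
  [set f |
    (\int[lambda2]_z
       (qnorm (f (slicept I z.1 z.2)) ^+ 2
        * fock_weight (slicept I z.1 z.2))%:E < +oo)%E
    /\ exists2 h, slice_regular h & forall q,
       f q = ((-1) ^+ n * Num.sqrt (1 / ((2 * pi) ^+ n * n`!%:R))
              * expR (2 * pi * qnorm q ^+ 2))
             *: iter n slice_deriv (fun p => fock_weight p *: h p) q].

Definition fock_inner (I : quat R) f g : quat R :=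
  qintegral (fun z => let q := slicept I z.1 z.2 in
    fock_weight q *: (qconj (g q) * f q)).

Definition expstar (r : quat R) : quat R -> quat R := fun q =>
  qseries (fun m => ((2 * pi) ^+ m / m`!%:R) *: (q ^+ m * qconj r ^+ m)).

Definition fock_kernel (n : nat) (q r : quat R) : quat R :=
  star (fun p => 2 *: expstar r p)
       (fun p => \sum_(0 <= k < n.+1)
          ((-1) ^+ k * 'C(n, n - k)%:R * (1 / k`!%:R))
          *: starpow (fun s => (2 * pi)
               *: (qconj s * s - s * qconj r - qconj s * r + qconj r * r)) k p)
       q.

End QuatAnalysis.

Section Sanity.
Variable R : realType.
Implicit Types (f g : quat R -> quat R) (a b : R -> R -> quat R).

Lemma quatP (p q : quat R) :
  [/\ q0 p = q0 q, q1 p = q1 q, q2 p = q2 q & q3 p = q3 q] -> p = q.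
Proof. by case: p => a b c d; case: q => a' b' c' d' [] /= -> -> -> ->. Qed.

Lemma imagunitP (I : quat R) :
  imagunit I <-> q0 I = 0 /\ q1 I ^+ 2 + q2 I ^+ 2 + q3 I ^+ 2 = 1.
Proof.
case: I => a b c d; rewrite /imagunit /= expr2; split.
  case; rewrite ?oppr0 => h0 h1 h2 h3.
  have a0 : a = 0.
    have [//|an0] := eqVneq a 0.
    have z t : a * t + t * a = 0 -> t = 0.
      move=> h; apply/eqP; have /eqP : a * t = 0 by lra.
      by rewrite mulf_eq0 (negPf an0).
    have hb : b = 0 by apply: z; rewrite -h1; ring.
    have hc : c = 0 by apply: z; rewrite -h2; ring.
    have hd : d = 0 by apply: z; rewrite -h3; ring.
    by exfalso; have := sqr_ge0 a; move: h0; rewrite hb hc hd expr2; lra.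
  by split => //; move: h0; rewrite a0; lra.
case=> -> h; apply: quatP; split => /=; lra.
Qed.

Lemma imagunitN (I : quat R) : imagunit I -> imagunit (- I).
Proof. by rewrite /imagunit /= sqrrN. Qed.

Lemma imagunit_i : imagunit (Quat 0 1 0 0 : quat R).
Proof. by apply/imagunitP; split => //=; ring. Qed.

Lemma imdirP (q : quat R) : imagunit (imdir q).
Proof.
rewrite /imdir; case: ifPn => [_|h]; first exact: imagunit_i.
apply/imagunitP; split => /=; first by rewrite mulr0.
rewrite !exprMn -!mulrDr exprVn.
have -> : q1 q ^+ 2 + q2 q ^+ 2 + q3 q ^+ 2 = im q ^+ 2.
  by rewrite /im /qnorm /= sqr_sqrtr ?expr0n ?add0r// !addr_ge0// sqr_ge0.
by rewrite mulVf// expf_neq0.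
Qed.

Lemma sliceptE (q : quat R) : slicept (imdir q) (re q) (im q) = q.
Proof.
rewrite /slicept /imdir /re; case: ifPn => [/eqP h|h].
  have h2 : q1 q ^+ 2 + q2 q ^+ 2 + q3 q ^+ 2 = 0.
    have : im q ^+ 2 = 0 by rewrite h expr0n.
    rewrite /im /qnorm /= sqr_sqrtr ?expr0n/= ?add0r//.
    by rewrite !addr_ge0// sqr_ge0.
  rewrite h scale0r addr0.
  apply: quatP; split => /=; rewrite ?mulr1 ?mulr0 //; symmetry; apply/eqP;
    rewrite -sqrf_eq0; apply/eqP;
    have := sqr_ge0 (q1 q); have := sqr_ge0 (q2 q); have := sqr_ge0 (q3 q); lra.
rewrite scalerA divff// scale1r.
by apply: quatP; split => /=; rewrite ?mulr1 ?mulr0 ?addr0 ?add0r.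
Qed.

Lemma sliceptN (I : quat R) x y : slicept (- I) x (- y) = slicept I x y.
Proof. by rewrite /slicept scalerN scaleNr opprK. Qed.

Lemma im_slicept (I : quat R) x y : imagunit I -> im (slicept I x y) = `|y|.
Proof.
move=> /imagunitP[_ h]; rewrite /im /qnorm /= -sqrtr_sqr; congr Num.sqrt.
by rewrite !mulr0 !add0r !exprMn expr0n/= add0r -!mulrDr h mulr1.
Qed.

Lemma re_slicept (I : quat R) x y : imagunit I -> re (slicept I x y) = x.
Proof. by move=> /imagunitP[h _]; rewrite /re /= h mulr0 addr0 mulr1. Qed.

Lemma imdir_slicept (I : quat R) x y : imagunit I -> y != 0 ->
  imdir (slicept I x y) = Num.sg y *: I.
Proof.
move=> hI y0; rewrite /imdir im_slicept// normr_eq0 (negPf y0).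
have /imagunitP[h _] := hI.
have s : `|y|^-1 * y = Num.sg y.
  by rewrite {2}[y]numEsg mulrCA mulVf ?mulr1// normr_eq0.
by apply: quatP; split => /=; rewrite ?mulr0 ?add0r ?h ?mulr0 ?mulrA ?s.
Qed.

Lemma slice_decomp (P : quat R -> R -> R -> Prop) :
  (forall I x y, P I x y -> P (- I) x (- y)) ->
  forall I x y, imagunit I -> y != 0 ->
  P (imdir (slicept I x y)) (re (slicept I x y)) (im (slicept I x y)) ->
  P I x y.
Proof.
move=> PN I x y hI y0; rewrite re_slicept// im_slicept// imdir_slicept//.
case: (ltrgt0P y) y0 => // yy _.
- by rewrite gtr0_sg// scale1r.
- by rewrite ltr0_sg// scaleN1r => /PN; rewrite !opprK.
Qed.

Lemma slice_stemE f a b : slice_stem f a b -> stem0 f = a /\ stem1 f = b.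
Proof.
move=> [ae bo fE]; split; apply/funext => x; apply/funext => y.
  rewrite /stem0 !fE ?ae ?bo; try exact: imagunit_i.
  rewrite mulrN addrACA subrr addr0.
  by apply: quatP; split => /=; lra.
rewrite /stem1 !fE ?ae ?bo; try exact: imagunit_i.
by apply: quatP; split => /=; lra.
Qed.

Lemma oddq0 (v : R -> quat R) : (forall y, v (- y) = - v y) -> v 0 = 0.
Proof.
move=> vo; have := vo 0; rewrite oppr0.
by case: (v 0) => ? ? ? ? [? ? ? ?]; congr Quat; lra.
Qed.

Lemma starE f g a b a' b' : slice_stem f a b -> slice_stem g a' b' ->
  forall I, imagunit I -> forall x y,
  star f g (slicept I x y) =
    (a x y * a' x y - b x y * b' x y) + I * (a x y * b' x y + b x y * a' x y).
Proof.
move=> fs gs I hI x y.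
have [fe fo] := slice_stemE fs; have [ge go] := slice_stemE gs.
case: fs gs => ae bo _ [ae' bo' _].
pose P (I : quat R) x y := star f g (slicept I x y) =
  a x y * a' x y - b x y * b' x y + I * (a x y * b' x y + b x y * a' x y).
have [->|y0] := eqVneq y 0.
  rewrite /star fe fo ge go re_slicept// im_slicept// normr0.
  by rewrite !(oddq0 (bo _)) !(oddq0 (bo' _)) !(mulr0, mul0r, addr0).
suff : P I x y by [].
apply: slice_decomp => //.
  move=> I' u v; rewrite /P sliceptN => ->.
  by rewrite ae ae' bo bo' !(mulrN, mulNr) opprK -opprD mulrN opprK.
by rewrite /P sliceptE /star fe fo ge go.
Qed.

Lemma is_derive1_lin (c : R) (u v : R -> R) (t du dv : R) :
  is_derive t 1 u du -> is_derive t 1 v dv ->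
  is_derive t 1 (fun s => u s + c * v s) (du + c * dv).
Proof. by move=> hu hv; exact: is_deriveD hu (is_deriveZ c hv). Qed.

Lemma qderive1_lin (I : quat R) (u v : R -> quat R) t :
  qderivable u t -> qderivable v t ->
  qderive1 (fun s => u s + I * v s) t = qderive1 u t + I * qderive1 v t.
Proof.
move=> [u0 u1 u2 u3] [v0 v1 v2 v3].
have D (c0 c1 c2 c3 : R) (z F : R -> R) : derivable z t 1 ->
    F = (fun s => z s + c0 * q0 (v s) + c1 * q1 (v s) + c2 * q2 (v s)
                  + c3 * q3 (v s)) ->
    derive1 F t = derive1 z t + c0 * derive1 (fun s => q0 (v s)) t
      + c1 * derive1 (fun s => q1 (v s)) t + c2 * derive1 (fun s => q2 (v s)) t
      + c3 * derive1 (fun s => q3 (v s)) t.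
  move=> dz ->; rewrite !derive1E; apply: derive_val.
  move/derivableP in dz; move/derivableP in v0; move/derivableP in v1.
  move/derivableP in v2; move/derivableP in v3.
  exact: is_derive1_lin v3.
apply: quatP; split => /=.
- rewrite (D (q0 I) (- q1 I) (- q2 I) (- q3 I) _ _ u0); first ring.
  by apply/funext => s; ring.
- rewrite (D (q1 I) (q0 I) (- q3 I) (q2 I) _ _ u1); first ring.
  by apply/funext => s; ring.
- rewrite (D (q2 I) (q3 I) (q0 I) (- q1 I) _ _ u2); first ring.
  by apply/funext => s; ring.
- rewrite (D (q3 I) (- q2 I) (q1 I) (q0 I) _ _ u3); first ring.
  by apply/funext => s; ring.
Qed.

Lemma derive1_opp (u : R -> R) t :
  derivable u (- t) 1 -> derive1 (fun s => u (- s)) t = - derive1 u (- t).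
Proof.
move=> du; rewrite derive1_comp; [|exact: derivable_opp|exact: du].
rewrite (derive1E -%R) (deriveN (@derivable_id _ _ t 1)) derive_id.
exact: mulrN1.
Qed.

Lemma qderive1_opp (u : R -> quat R) t : qderivable u (- t) ->
  qderive1 (fun s => u (- s)) t = - qderive1 u (- t).
Proof.
move=> [u0 u1 u2 u3]; apply: quatP; split.
- exact: (derive1_opp u0).
- exact: (derive1_opp u1).
- exact: (derive1_opp u2).
- exact: (derive1_opp u3).
Qed.

Lemma qderive1N (u : R -> quat R) t : qderivable u t ->
  qderive1 (fun s => - u s) t = - qderive1 u t.
Proof.
move=> [u0 u1 u2 u3]; apply: quatP; split => /=; rewrite !derive1E.
- exact: (deriveN u0).
- exact: (deriveN u1).
- exact: (deriveN u2).
- exact: (deriveN u3).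
Qed.

Lemma slice_derivE f a b : slice_stem f a b ->
  (forall x y, qderivable (fun t => a t y) x) ->
  (forall x y, qderivable (fun t => a x t) y) ->
  (forall x y, qderivable (fun t => b t y) x) ->
  (forall x y, qderivable (fun t => b x t) y) ->
  forall I, imagunit I -> forall x y,
  let fI u v := f (slicept I u v) in
  slice_deriv f (slicept I x y) =
    2^-1 *: (partialx fI x y - I * partialy fI x y).
Proof.
move=> [ae bo fE] ax ay bx by_ I hI x y /=.
pose S (I : quat R) x y := 2^-1 *: ((partialx a x y + I * partialx b x y)
  - I * (partialy a x y + I * partialy b x y)).
have SE J u v : imagunit J ->
    2^-1 *: (partialx (fun u v => f (slicept J u v)) u v
      - J * partialy (fun u v => f (slicept J u v)) u v) = S J u v.
  move=> hJ; rewrite /S /partialx /partialy.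
  have -> : (fun t => f (slicept J t v)) = (fun t => a t v + J * b t v).
    by apply/funext => t; rewrite fE.
  have -> : (fun t => f (slicept J u t)) = (fun t => a u t + J * b u t).
    by apply/funext => t; rewrite fE.
  by rewrite (qderive1_lin _ (ax _ _) (bx _ _))
             (qderive1_lin _ (ay _ _) (by_ _ _)).
have ayo u v : partialy a u (- v) = - partialy a u v.
  rewrite /partialy -[in RHS](opprK v) -qderive1_opp ?opprK//.
  by congr qderive1; apply/funext => s; rewrite ae.
have bye u v : partialy b u (- v) = partialy b u v.
  rewrite /partialy -[LHS]opprK -qderive1_opp//.
  under [X in qderive1 X]funext => s do rewrite bo.
  by rewrite qderive1N// opprK.
have axe u v : partialx a u (- v) = partialx a u v.
  by congr qderive1; apply/funext => s; rewrite ae.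
have bxo u v : partialx b u (- v) = - partialx b u v.
  rewrite /partialx -qderive1N//.
  by congr qderive1; apply/funext => s; rewrite bo.
rewrite SE//.
have [->|y0] := eqVneq y 0.
  rewrite /slice_deriv SE; last exact: imdirP.
  rewrite (re_slicept _ _ hI) (im_slicept _ _ hI) normr0 /S.
  rewrite (oddq0 (ayo x)) (oddq0 (bxo x)) !(mulr0, addr0, add0r) !mulrA -!expr2.
  by rewrite hI (imdirP _).
pose P I x y := slice_deriv f (slicept I x y) = S I x y.
suff : P I x y by [].
apply: (slice_decomp (P := P) _ hI y0).
  move=> I' u v; rewrite /P sliceptN => ->; rewrite /S axe bxo ayo bye.
  by rewrite mulrNN (mulNr _ (partialy b u v)) -opprD mulrNN.
by rewrite /P sliceptE /slice_deriv SE//; exact: imdirP.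
Qed.

End Sanity.

(* Main.v *)
(* On a slice, e^(2 pi |z|^2) d_z^n (e^(-2 pi |z|^2) H) = (d_z - 2 pi z^* )^n H,
   and for r = w in C_L the kernel K_(n+1)(., r) is the slice function extending
   2 e^(2 pi z w^* ) L_n(2 pi |z - w|^2), with L_n the Laguerre polynomial. The
   operator (d_z - 2 pi z^* )^n commutes with the translation by w up to the
   factor e^(- 2 pi w^* z), which is exactly what the kernel produces, so the
   reproducing property at w reduces to the one at 0. There the kernel is radial,
   and by Cauchy's formula the mean over the circle |z| = rho of a function f in
   the image of the operator is L_n(2 pi rho^2) f(0); hence everything boils down
   to the integral of 2 L_n(2 pi |z|^2)^2 e^(-2 pi |z|^2) being 1. An integral over
   another slice C_J is brought back to C_L by averaging over the conjugation
   of C_J. *)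

Require Import Defs.
From HB Require Import structures.
From mathcomp Require Import all_boot all_order all_algebra.
From mathcomp Require Import all_classical all_reals all_analysis.
From mathcomp Require Import measurable_realfun complex.
From mathcomp Require Import ring lra.
Set Implicit Arguments.
Unset Strict Implicit.
Unset Printing Implicit Defensive.
Import Order.TTheory GRing.Theory Num.Theory.
Import numFieldNormedType.Exports.
Local Open Scope classical_set_scope.
Local Open Scope ring_scope.
Local Open Scope complex_scope.
Local Notation Re := complex.Re.
Local Notation Im := complex.Im.
Local Notation "z ^*" := (conjc z) : ring_scope.
Local Notation imu := (Complex 0 1).

(** * Differentiation along curves in the complex plane *)

(** Integrability is available only for f and for the kernel, while nothing is known about the
    growth of H and of its derivatives. Integration by parts over the plane would leave boundary
    terms without control; circle means are exact on every single circle and ask for no estimate.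
    Polar coordinates are replaced by an average over rotations, which are built from shears, and
    the radial integrals by Gaussian moments. The stem of H is only C^1, so that the derivatives of
    order up to n have to be produced by Cauchy's formula first. Two facts tame non-commutativity.
    The coordinates of a slice regular function in the basis 1, i, j, k, written as right
    coefficients, are holomorphic functions that commute with conjugation. And for L the direction
    of r, the stems of all factors of the kernel take values in the commutative field C_L, where
    *-products become ordinary products. That the kernel belongs to the space is seen from an
    explicit H, a multiple of e^(2 pi z w^* ) (z - w)^n. *)

Section ComplexCalculus.
Variable R : realType.
Local Notation C := R[i].
Implicit Types (u v : R -> C) (F G : C -> C) (t : R) (d e : C).

Lemma complexP (z w : C) : Re z = Re w -> Im z = Im w -> z = w.
Proof. by case: z w => [a b] [c d] /= -> ->. Qed.

Lemma ReM (z w : C) : Re (z * w) = Re z * Re w - Im z * Im w.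
Proof. by case: z w => [a b] [c d]. Qed.

Lemma ImM (z w : C) : Im (z * w) = Re z * Im w + Im z * Re w.
Proof. by case: z w => [a b] [c d]. Qed.

Lemma ReD (z w : C) : Re (z + w) = Re z + Re w.
Proof. by case: z w => [a b] [c d]. Qed.

Lemma ImD (z w : C) : Im (z + w) = Im z + Im w.
Proof. by case: z w => [a b] [c d]. Qed.

Lemma ReN (z : C) : Re (- z) = - Re z.
Proof. by case: z => [a b]. Qed.

Lemma ImN (z : C) : Im (- z) = - Im z.
Proof. by case: z => [a b]. Qed.

Definition cpartsE := (ReM, ImM, ReD, ImD, ReN, ImN).

Lemma eta_complex (z : C) : Re z +i* Im z = z.
Proof. by case: z. Qed.

Lemma Re_natr n : Re (n%:R : C) = n%:R.
Proof. by elim: n => // n IH; rewrite !mulrS ReD IH. Qed.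

Lemma Im_natr n : Im (n%:R : C) = 0.
Proof. by elim: n => // n IH; rewrite !mulrS ImD IH addr0. Qed.

Definition cderiv u (t : R) (d : C) : Prop :=
  is_derive t 1 (fun s => Re (u s)) (Re d) /\
  is_derive t 1 (fun s => Im (u s)) (Im d).

Lemma cderiv_cst (c : C) t : cderiv (fun=> c) t 0.
Proof. by split; exact: is_derive_cst. Qed.

Lemma cderiv_real (f : R -> R) (t d : R) : is_derive t 1 f d ->
  cderiv (fun s => (f s)%:C) t d%:C.
Proof. by move=> h; split => //; exact: is_derive_cst. Qed.

Lemma cderiv_id t : cderiv (fun s => s%:C) t 1.
Proof. exact: (cderiv_real (is_derive_id t 1)). Qed.

Lemma cderivD u v t d e : cderiv u t d -> cderiv v t e ->
  cderiv (fun s => u s + v s) t (d + e).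
Proof.
move=> [u0 u1] [v0 v1]; split; rewrite ?cpartsE.
- rewrite [X in is_derive _ _ X](_ : _ = (fun s => Re (u s)) + (fun s => Re (v s))).
    exact: is_deriveD.
  by apply/funext => s; rewrite cpartsE.
- rewrite [X in is_derive _ _ X](_ : _ = (fun s => Im (u s)) + (fun s => Im (v s))).
    exact: is_deriveD.
  by apply/funext => s; rewrite cpartsE.
Qed.

Lemma cderivM u v t d e : cderiv u t d -> cderiv v t e ->
  cderiv (fun s => u s * v s) t (u t * e + d * v t).
Proof.
move=> [u0 u1] [v0 v1]; split.
- rewrite [X in is_derive _ _ X](_ : _ = (fun s => Re (u s)) * (fun s => Re (v s))
     - (fun s => Im (u s)) * (fun s => Im (v s))); last first.
    by apply/funext => s; rewrite cpartsE.
  apply: is_derive_eq; rewrite !cpartsE /GRing.scale /=; ring.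
- rewrite [X in is_derive _ _ X](_ : _ = (fun s => Re (u s)) * (fun s => Im (v s))
     + (fun s => Im (u s)) * (fun s => Re (v s))); last first.
    by apply/funext => s; rewrite cpartsE.
  apply: is_derive_eq; rewrite !cpartsE /GRing.scale /=; ring.
Qed.

Lemma cderiv_eq u t d e : cderiv u t d -> d = e -> cderiv u t e.
Proof. by move=> ? <-. Qed.

Lemma cderivZ (c : C) u t d : cderiv u t d -> cderiv (fun s => c * u s) t (c * d).
Proof.
by move=> h; apply: (cderiv_eq (cderivM (cderiv_cst c t) h)); rewrite mul0r addr0.
Qed.

Lemma cderivN u t d : cderiv u t d -> cderiv (fun s => - u s) t (- d).
Proof.
move=> /(cderivZ (-1)); rewrite mulN1r; congr cderiv; apply/funext => s.
by rewrite mulN1r.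
Qed.

Lemma cderiv_conj u t d : cderiv u t d -> cderiv (fun s => (u s)^*) t d^*.
Proof.
move=> [h0 h1]; split.
- rewrite [X in is_derive _ _ X](_ : _ = (fun s => Re (u s))).
    by case: d h0 {h1}.
  by apply/funext => s; case: (u s).
- rewrite [X in is_derive _ _ X](_ : _ = - (fun s => Im (u s))); last first.
    by apply/funext => s; rewrite [RHS]/(- Im (u s)); case: (u s).
  by case: d h1 {h0} => a b h1; exact: (@is_deriveN R R^o R^o).
Qed.

Definition cexp (z : C) : C :=
  (expR (Re z) * cos (Im z)) +i* (expR (Re z) * sin (Im z)).

Lemma cexp0 : cexp 0 = 1.
Proof. by apply: complexP; rewrite /= expR0 ?cos0 ?sin0 ?mulr1 ?mulr0. Qed.

Lemma cexpD (z w : C) : cexp (z + w) = cexp z * cexp w.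
Proof.
case: z w => [a b] [c d]; apply: complexP; rewrite /= expRD ?cosD ?sinD; ring.
Qed.

Lemma cexp_real (x : R) : cexp x%:C = (expR x)%:C.
Proof. by apply: complexP; rewrite /= ?cos0 ?sin0 ?mulr1 ?mulr0. Qed.

Lemma cexp_conj (z : C) : (cexp z)^* = cexp z^*.
Proof. by case: z => a b; apply: complexP; rewrite /= ?cosN// sinN mulrN. Qed.

Lemma cderiv_cexp u t d : cderiv u t d ->
  cderiv (fun s => cexp (u s)) t (cexp (u t) * d).
Proof.
move=> [h0 h1].
have e0 := is_derive1_comp (is_derive_expR (Re (u t))) h0.
have c1 := is_derive1_comp (is_derive_cos (Im (u t))) h1.
have s1 := is_derive1_comp (is_derive_sin (Im (u t))) h1.
split; rewrite ?cpartsE.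
- rewrite (_ : (fun s => _) = ((expR \o (fun s => Re (u s))) * (cos \o (fun s => Im (u s)))))//.
  apply: is_derive_eq => /=; rewrite /GRing.scale /=; ring.
- rewrite (_ : (fun s => _) = ((expR \o (fun s => Re (u s))) * (sin \o (fun s => Im (u s)))))//.
  apply: is_derive_eq => /=; rewrite /GRing.scale /=; ring.
Qed.

Lemma cvg_pair_nbhs (T : Type) (U V : topologicalType) (F : set_system T)
    {FF : Filter F} (f : T -> U) (g : T -> V) (a : U) (b : V) :
  f x @[x --> F] --> a -> g x @[x --> F] --> b ->
  (f x, g x) @[x --> F] --> (a, b).
Proof. by move=> fa gb; apply: cvg_pair; [exact: fa|exact: gb]. Qed.

Definition tcont (T : topologicalType) (U : T -> C) : Prop :=
  continuous (fun s => Re (U s)) /\ continuous (fun s => Im (U s)).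

Definition ccont F : Prop := tcont (fun z : R * R => F (z.1 +i* z.2)).

Section Continuity.
Variable T : topologicalType.
Implicit Types U V : T -> C.

Lemma tcont_cst (c : C) : tcont (fun _ : T => c).
Proof. by split => /= s; exact: cst_continuous. Qed.

Lemma tcont_comp F U : ccont F -> tcont U -> tcont (F \o U).
Proof.
move=> [F0 F1] [U0 U1].
have cU : continuous (fun s => (Re (U s), Im (U s)) : R * R).
  by move=> s; apply: cvg_pair_nbhs; [exact: U0|exact: U1].
split=> s.
- rewrite (_ : (fun=> _) = (fun z : R * R => Re (F (z.1 +i* z.2)))
     \o (fun s => (Re (U s), Im (U s)))).
    exact: (continuous_comp (cU s) (F0 _)).
  by apply/funext => ? /=; rewrite eta_complex.
- rewrite (_ : (fun=> _) = (fun z : R * R => Im (F (z.1 +i* z.2)))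
     \o (fun s => (Re (U s), Im (U s)))).
    exact: (continuous_comp (cU s) (F1 _)).
  by apply/funext => ? /=; rewrite eta_complex.
Qed.

Lemma tcontD U V : tcont U -> tcont V -> tcont (fun s => U s + V s).
Proof.
move=> [U0 U1] [V0 V1]; split=> s.
- rewrite (_ : (fun=> _) = (fun s => Re (U s) + Re (V s))).
    by apply: cvgD; [exact: U0|exact: V0].
  by apply/funext => ?; rewrite cpartsE.
- rewrite (_ : (fun=> _) = (fun s => Im (U s) + Im (V s))).
    by apply: cvgD; [exact: U1|exact: V1].
  by apply/funext => ?; rewrite cpartsE.
Qed.

Lemma tcontM U V : tcont U -> tcont V -> tcont (fun s => U s * V s).
Proof.
move=> [U0 U1] [V0 V1]; split=> s.
- rewrite (_ : (fun=> _) = (fun s => Re (U s) * Re (V s) - Im (U s) * Im (V s))).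
    by apply: cvgB; apply: cvgM; [exact: U0|exact: V0|exact: U1|exact: V1].
  by apply/funext => ?; rewrite cpartsE.
- rewrite (_ : (fun=> _) = (fun s => Re (U s) * Im (V s) + Im (U s) * Re (V s))).
    by apply: cvgD; apply: cvgM; [exact: U0|exact: V1|exact: U1|exact: V0].
  by apply/funext => ?; rewrite cpartsE.
Qed.

Lemma tcontX U n : tcont U -> tcont (fun s => U s ^+ n).
Proof.
move=> cU; elim: n => [|n IH].
  by rewrite [X in tcont X](_ : _ = (fun=> 1))//; exact: tcont_cst.
rewrite [X in tcont X](_ : _ = (fun s => U s * U s ^+ n)); first exact: tcontM.
by apply/funext => s; rewrite exprS.
Qed.

Lemma tcont_sum (I : Type) (r : seq I) (P : pred I) (U : I -> T -> C) :
  (forall i, P i -> tcont (U i)) -> tcont (fun s => \sum_(i <- r | P i) U i s).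
Proof.
move=> h; elim: r => [|i r IH].
  rewrite [X in tcont X](_ : _ = (fun=> 0)); first exact: tcont_cst.
  by apply/funext => s; rewrite big_nil.
rewrite [X in tcont X](_ : _ = (fun s => if P i then U i s + \sum_(j <- r | P j) U j s
            else \sum_(j <- r | P j) U j s)); last first.
  by apply/funext => s; rewrite big_cons.
by case: (P i) (h i) => [hi|_] /=; [apply: tcontD => //; exact: hi|exact: IH].
Qed.

End Continuity.

Lemma ccont_id : ccont id.
Proof. by split=> z /=; [exact: cvg_fst|exact: cvg_snd]. Qed.

Lemma ccont_conj : ccont (fun z => z^*).
Proof.
split=> z /=; first exact: cvg_fst.
by apply: (@cvgN R R^o); exact: cvg_snd.
Qed.

Lemma ccont_cexp : ccont cexp.
Proof.
have e : continuous (fun z : R * R => expR z.1).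
  by move=> z; apply: continuous_comp; [exact: cvg_fst|exact: continuous_expR].
split=> z /=; apply: cvgM; try exact: e; apply: continuous_comp; try exact: cvg_snd.
- exact: continuous_cos.
- exact: continuous_sin.
Qed.

(* Holomorphy is encoded by the chain rule along all differentiable curves, with
   the continuity of the derivative built in. *)
Definition holo F F' : Prop := [/\ ccont F, ccont F' &
  forall u t d, cderiv u t d -> cderiv (F \o u) t (F' (u t) * d)].

End ComplexCalculus.

(** * The chain rule from continuous partial derivatives *)

Section Chain.
Variable R : realType.
Local Notation C := R[i].

(** The intermediate point is located only by its distance to [a]. This treats [b < a] and [b = a]
    along with [a < b], and it is what forces the point to tend to [a] together with [b]. *)
Lemma mean_value_between (f df : R -> R) (a b : R) :
  (forall x : R, is_derive x 1 f (df x)) ->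
  exists c, `|c - a| <= `|b - a| /\ f b - f a = df c * (b - a).
Proof.
move=> h.
have cf : continuous f.
  by move=> x; apply: differentiable_continuous; apply/derivable1_diffP.
case: (ltgtP a b) => [ab|ba|->].
- have [|c cab E] := MVT ab (fun x _ => h x).
    exact: continuous_subspaceT.
  exists c; split => //; move: cab; rewrite in_itv /= => /andP[ac cb].
  by rewrite !ger0_norm ?subr_ge0 ?lerB ?(ltW ab) ?(ltW ac) ?(ltW cb).
- have [|c cab E] := MVT ba (fun x _ => h x).
    exact: continuous_subspaceT.
  exists c; split; last by apply: oppr_inj; rewrite opprB E; ring.
  move: cab; rewrite in_itv /= => /andP[ac cb].
  by rewrite !ler0_norm ?subr_le0 ?(ltW ba) ?(ltW ac) ?(ltW cb) // lerN2 lerB // ltW.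
- by exists b; rewrite !subrr mulr0.
Qed.

Lemma cvg_between (T : topologicalType) (t : T) (f g : T -> R) :
  {for t, continuous f} -> (forall z, `|g z - f t| <= `|f z - f t|) ->
  g z @[z --> t] --> f t.
Proof.
move=> cf h; apply/cvgrPdistC_lt => e e0.
move/cvgrPdistC_lt: cf => /(_ e e0); apply: filterS => z.
by exact: le_lt_trans.
Qed.

Section C1.
Variables P Px Py : R * R -> R.
Hypothesis dPx : forall x y : R, is_derive x 1 (fun s => P (s, y)) (Px (x, y)).
Hypothesis dPy : forall x y : R, is_derive y 1 (fun s => P (x, s)) (Py (x, y)).
Hypothesis cPx : continuous Px.
Hypothesis cPy : continuous Py.

(** The increment is cut at the corner [(u t, v z)], and the mean value theorem is applied on each
    of the two legs. The parameter space is left general: the plane gives continuity of [P], the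
    line gives the chain rule. *)
Lemma C1_increment (T : topologicalType) (t : T) (u v : T -> R) :
  {for t, continuous u} -> {for t, continuous v} ->
  exists gx gy : T -> R, [/\
    forall z, P (u z, v z) - P (u t, v t)
       = gx z * (u z - u t) + gy z * (v z - v t),
    gx z @[z --> t] --> Px (u t, v t) & gy z @[z --> t] --> Py (u t, v t)].
Proof.
move=> cu cv.
have /choice[xi xiP] := fun z => mean_value_between (u t) (u z) (dPx^~ (v z)).
have /choice[eta etaP] := fun z => mean_value_between (v t) (v z) (dPy (u t)).
exists (fun z => Px (xi z, v z)), (fun z => Py (u t, eta z)); split.
- by move=> z; rewrite -(xiP z).2 -(etaP z).2; ring.
- have hx : xi z @[z --> t] --> u t.
    by apply: cvg_between cu _ => z; have [] := xiP z.
  have h2 : (xi z, v z) @[z --> t] --> (u t, v t).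
    by apply: cvg_pair_nbhs.
  exact: (continuous_cvg _ (@cPx (u t, v t)) h2).
- have hy : eta z @[z --> t] --> v t.
    by apply: cvg_between cv _ => z; have [] := etaP z.
  have h2 : (u t, eta z) @[z --> t] --> (u t, v t).
    by apply: cvg_pair_nbhs => //; exact: cvg_cst.
  exact: (continuous_cvg _ (@cPy (u t, v t)) h2).
Qed.

Lemma C1_continuous : continuous P.
Proof.
move=> [a b].
have t1 : z.1 @[z --> (a, b)] --> a by exact: cvg_fst.
have t2 : z.2 @[z --> (a, b)] --> b by exact: cvg_snd.
have [gx [gy [E hx hy]]] :=
  @C1_increment (R * R)%type (a, b) (fun z => z.1) (fun z => z.2) t1 t2.
have -> : P = (fun z : R * R => (gx z * (z.1 - a) + gy z * (z.2 - b)) + P (a, b)).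
  by apply/funext => -[z1 z2]; rewrite -E /= subrK.
rewrite /continuous_at /= !subrr !mulr0 !add0r.
have s1 : (z.1 - a) @[z --> (a, b)] --> (0 : R).
  by rewrite -(subrr a); apply: cvgB; [exact: t1|exact: cvg_cst].
have s2 : (z.2 - b) @[z --> (a, b)] --> (0 : R).
  by rewrite -(subrr b); apply: cvgB; [exact: t2|exact: cvg_cst].
have h := cvgD (cvgD (cvgM hx s1) (cvgM hy s2)) (cvg_cst (P (a, b))).
rewrite !mulr0 !add0r in h. exact: h.
Qed.

Lemma C1_chain (u v : R -> R) (t du dv : R) :
  is_derive t 1 u du -> is_derive t 1 v dv ->
  is_derive t 1 (fun s => P (u s, v s))
    (Px (u t, v t) * du + Py (u t, v t) * dv).
Proof.
move=> hu hv.
have cu : {for t, continuous u}.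
  by apply: differentiable_continuous; apply/derivable1_diffP.
have cv : {for t, continuous v}.
  by apply: differentiable_continuous; apply/derivable1_diffP.
have [gx [gy [E hx hy]]] := C1_increment cu cv.
move/is_derive1_caratheodory: hu => [gu [Eu cgu <-]].
move/is_derive1_caratheodory: hv => [gv [Ev cgv <-]].
(* The Carathéodory slope. Its value at [t] is imposed, since only the limits of [gx] and [gy] at
   [t] are at hand. *)
pose g z := if z == t then Px (u t, v t) * gu t + Py (u t, v t) * gv t
  else gx z * gu z + gy z * gv z.
apply/is_derive1_caratheodory; exists g; split.
- move=> z; rewrite /g; case: eqP => [->|_]; first by rewrite !subrr mulr0.
  by rewrite E Eu Ev; ring.
- have -> : g = fun z => g z by [].
  rewrite /prop_for /continuous_at {2}/g eqxx.
  have H : (gx z * gu z + gy z * gv z) @[z --> t] --> Px (u t, v t) * gu t + Py (u t, v t) * gv t.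
    by apply: cvgD; apply: cvgM.
  apply/cvgrPdistC_lt => e e0.
  move/cvgrPdistC_lt: H => /(_ e e0); apply: filterS => z hz.
  by rewrite /g; case: eqP => // _; rewrite subrr normr0.
- by rewrite /g eqxx.
Qed.

End C1.

(** The Cauchy-Riemann equations are encoded in the two derivatives: the vertical one is [imu] times
    the horizontal one. Continuity of [F'] then upgrades partial derivatives to the chain rule along
    all curves. *)
Lemma holo_C1 (F F' : C -> C) : ccont F' ->
  (forall x y, cderiv (fun s => F (s +i* y)) x (F' (x +i* y))) ->
  (forall x y, cderiv (fun s => F (x +i* s)) y (imu * F' (x +i* y))) ->
  holo F F'.
Proof.
move=> [cF0 cF1] hx hy.
have hx0 x y := (hx x y).1; have hx1 x y := (hx x y).2.
have hy0 x y := (hy x y).1; have hy1 x y := (hy x y).2.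
have cFN : continuous (fun z : R * R => - Im (F' (z.1 +i* z.2))).
  by move=> z; apply: (@cvgN R R^o); exact: cF1.
have E0 z : Re (imu * z) = - Im z :> R by rewrite ReM /=; ring.
have E1 z : Im (imu * z) = Re z :> R by rewrite ImM /=; ring.
have hy0' (x y : R) : is_derive y 1 (fun s => Re (F (x +i* s))) (- Im (F' (x +i* y))).
  by rewrite -E0.
have hy1' (x y : R) : is_derive y 1 (fun s => Im (F (x +i* s))) (Re (F' (x +i* y))).
  by rewrite -E1.
split.
- split.
  + exact: (C1_continuous (P := fun z => Re (F (z.1 +i* z.2))) hx0 hy0' cF0 cFN).
  + exact: (C1_continuous (P := fun z => Im (F (z.1 +i* z.2))) hx1 hy1' cF1 cF0).
- by [].
move=> u t d [u0 u1]; split.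
- have := C1_chain (P := fun z => Re (F (z.1 +i* z.2))) hx0 hy0' cF0 cFN u0 u1.
  rewrite /= !eta_complex mulNr -ReM; congr is_derive.
  by apply/funext => s /=; rewrite eta_complex.
- have := C1_chain (P := fun z => Im (F (z.1 +i* z.2))) hx1 hy1' cF1 cF0 u0 u1.
  rewrite /= !eta_complex addrC -ImM; congr is_derive.
  by apply/funext => s /=; rewrite eta_complex.
Qed.

End Chain.

(** * Cauchy's formula on circles *)

Section CircleIntegral.
Variable R : realType.
Local Notation C := R[i].
Local Notation mu := (@lebesgue_measure R).
Local Notation J := [set` `[0 : R, 2 * pi]].
Implicit Types (u v : R -> C) (F G : C -> C).

Definition cint u : C :=
  (\int[mu]_(t in J) Re (u t))%R +i* (\int[mu]_(t in J) Im (u t))%R.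

Let pi2_gt0 : (0 : R) < 2 * pi. Proof. by rewrite mulr_gt0// pi_gt0. Qed.

Lemma integrable_circle (f : R -> R) : continuous f -> mu.-integrable J (EFin \o f).
Proof.
move=> cf; apply: continuous_compact_integrable; first exact: segment_compact.
exact: continuous_subspaceT.
Qed.

Lemma cintD u v : tcont u -> tcont v -> cint (fun t => u t + v t) = cint u + cint v.
Proof.
move=> [u0 u1] [v0 v1]; apply: complexP; rewrite /cint /=.
- rewrite -RintegralD//; try exact: integrable_circle.
  by apply: eq_Rintegral => t _; rewrite ReD.
- rewrite -RintegralD//; try exact: integrable_circle.
  by apply: eq_Rintegral => t _; rewrite ImD.
Qed.

Lemma cintZ (c : C) u : tcont u -> cint (fun t => c * u t) = c * cint u.
Proof.
move=> [u0 u1].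
have H (a b : R) (f g : R -> R) : continuous f -> continuous g ->
    (\int[mu]_(t in J) (a * f t + b * g t) =
     a * \int[mu]_(t in J) f t + b * \int[mu]_(t in J) g t)%R.
  move=> cf cg; rewrite RintegralD//; last 2 first.
  - by apply: integrable_circle => t; apply: cvgM; [exact: cvg_cst|exact: cf].
  - by apply: integrable_circle => t; apply: cvgM; [exact: cvg_cst|exact: cg].
  by rewrite !RintegralZl//; exact: integrable_circle.
apply: complexP; rewrite cpartsE /=.
- rewrite -mulNr -H//; apply: eq_Rintegral => t _; rewrite cpartsE; ring.
- rewrite -H//; apply: eq_Rintegral => t _; rewrite cpartsE; ring.
Qed.

Lemma cint_sum (I : Type) (r : seq I) (P : pred I) (u : I -> R -> C) :
  (forall i, P i -> tcont (u i)) ->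
  cint (fun t => \sum_(i <- r | P i) u i t) = \sum_(i <- r | P i) cint (u i).
Proof.
move=> h; elim: r => [|i r IH].
  rewrite big_nil [X in cint X](_ : _ = (fun=> 0 * 0)).
    by rewrite cintZ ?mul0r//; exact: tcont_cst.
  by apply/funext => t; rewrite big_nil mul0r.
rewrite big_cons [X in cint X](_ : _ = (fun s => if P i then u i s + \sum_(j <- r | P j) u j s
            else \sum_(j <- r | P j) u j s)); last first.
  by apply/funext => s; rewrite big_cons.
case: (P i) (h i) => [hi|_] //; rewrite cintD ?IH//; first exact: hi.
exact: tcont_sum.
Qed.

Lemma Rintegral_deriv (F f : R -> R) : continuous f ->
  (forall x : R, is_derive x 1 F (f x)) ->
  (\int[mu]_(t in J) f t)%R = F (2 * pi) - F 0.
Proof.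
move=> cf dF.
have cF : continuous F.
  by move=> x; apply: differentiable_continuous; apply/derivable1_diffP.
rewrite /Rintegral (@continuous_FTC2 _ f F)//=.
- exact: continuous_subspaceT.
- split; first by [].
  + by apply: cvg_at_right_filter; exact: cF.
  + by apply: cvg_at_left_filter; exact: cF.
- by move=> x _; rewrite derive1E; apply: derive_val.
Qed.

Lemma cint_deriv U u : tcont u -> (forall t, cderiv U t (u t)) ->
  cint u = U (2 * pi) - U 0.
Proof.
move=> [u0 u1] h; apply: complexP; rewrite /= !cpartsE.
- exact: (Rintegral_deriv u0 (fun x => (h x).1)).
- exact: (Rintegral_deriv u1 (fun x => (h x).2)).
Qed.

(** The constant is the integrable bound required for differentiating under the integral sign near
    [s]; it comes from compactness of a closed rectangle. *)
Lemma rectangle_bounded (f : R * R -> R) (s : R) : continuous f ->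
  exists2 M, 0 <= M & forall x t, `]s - 1, s + 1[%classic x -> J t -> `|f (x, t)| <= M.
Proof.
move=> cf.
have K : compact (`[s - 1, s + 1]%classic `*` J).
  by apply: compact_setX; exact: segment_compact.
have := continuous_compact (continuous_subspaceT cf) K.
move/compact_bounded => [M [Mr hM]].
exists (`|M| + 1); first by rewrite addr_ge0.
move=> x t xs tJ; apply: (hM (`|M| + 1)).
  by rewrite (le_lt_trans (ler_norm M))// ltrDl.
by exists (x, t) => //; split => //; exact: subset_itv_oo_cc xs.
Qed.

Lemma is_derive_under_circle (f df : R -> R -> R) (s : R) :
  (forall x t : R, is_derive x 1 (f^~ t) (df x t)) ->
  (forall x, continuous (f x)) -> continuous (fun p : R * R => df p.1 p.2) ->
  is_derive s 1 (fun x => \int[mu]_(t in J) f x t)%R (\int[mu]_(t in J) df s t)%R.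
Proof.
move=> hf cf cdf.
have [M M0 hM] := rectangle_bounded s cdf.
have hs : `]s - 1, s + 1[%classic s.
  by rewrite /= in_itv /= ltrBlDr !ltrDl !ltr01.
have E x t : partial1of2 f x t = df x t.
  by rewrite partial1of2E; apply: derive_val.
have Hd := @derivable_under_integral R _ _ mu f J (measurable_itv _) s (s - 1) (s + 1) hs
  (fun x _ => integrable_circle (cf x)) (fun x y _ _ => @ex_derive _ _ _ _ _ _ _ (hf x y))
  (fun=> M) (fun=> M0) (integrable_circle (@cst_continuous _ _ M)) _.
have Hv := @differentiation_under_integral R _ _ mu f J (measurable_itv _) s (s - 1) (s + 1) hs
  (fun x _ => integrable_circle (cf x)) (fun x y _ _ => @ex_derive _ _ _ _ _ _ _ (hf x y))
  (fun=> M) (fun=> M0) (integrable_circle (@cst_continuous _ _ M)) _.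
have B : forall x y : R, `]s - 1, s + 1[%classic x -> J y -> `|partial1of2 f x y| <= M.
  by move=> x y xs yJ; rewrite E; exact: (hM x y xs yJ).
apply: DeriveDef; first exact: Hd.
rewrite -derive1E Hv//.
by apply: eq_Rintegral => t _; rewrite E.
Qed.

Lemma cderiv_under_circle (u du : R -> R -> C) (s : R) :
  (forall x t, cderiv (u^~ t) x (du x t)) -> (forall x, tcont (u x)) ->
  tcont (fun p : R * R => du p.1 p.2) ->
  cderiv (fun x => cint (u x)) s (cint (du s)).
Proof.
move=> hu cu [d0 d1]; split => /=.
- apply: (is_derive_under_circle (f := fun x t => Re (u x t)) (df := fun x t => Re (du x t))) => //.
  + by move=> x t; exact: (hu x t).1.
  + by move=> x; exact: (cu x).1.
- apply: (is_derive_under_circle (f := fun x t => Im (u x t)) (df := fun x t => Im (du x t))) => //.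
  + by move=> x t; exact: (hu x t).2.
  + by move=> x; exact: (cu x).2.
Qed.

(** By compactness of the range of [t], [f y] is uniformly close to [f z] for [y] near [z]. Unlike
    dominated convergence, this argument uses no sequences and so fits an arbitrary [T]. *)
Lemma continuous_under_circle (T : topologicalType) (f : T -> R -> R) :
  continuous (fun p : T * R => f p.1 p.2) ->
  continuous (fun z => \int[mu]_(t in J) f z t)%R.
Proof.
move=> cf z.
have cfz y : continuous (f y).
  move=> t; apply: (continuous_comp (f := fun t => (y, t)) (g := fun p : T * R => f p.1 p.2)).
    by apply: cvg_pair_nbhs; [exact: cvg_cst|exact: cvg_id].
  exact: cf.
apply/cvgrPdist_le => e e0.
pose e' := e / (2 * pi).
have e'0 : 0 < e' by rewrite divr_gt0.
have : \forall y \near z, J `<=` [set t | `|f z t - f y t| <= e'].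
  apply: (compact_near_coveringP J).1; first exact: segment_compact.
  move=> t _.
  have h0 : (f z q.1 - f q.2 q.1) @[q --> (t, z)] --> (0 : R).
    rewrite -(subrr (f z t)); apply: cvgB.
      apply: (continuous_cvg _ (@cfz z t)); exact: cvg_fst.
    have h2 : (q.2, q.1) @[q --> (t, z)] --> (z, t).
      by apply: cvg_pair_nbhs; [exact: cvg_snd|exact: cvg_fst].
    exact: (continuous_cvg _ (@cf (z, t)) h2).
  move/cvgr0Pnorm_le : h0 => /(_ e' e'0).
  by apply: filterS.
apply: filterS => y hy.
rewrite -RintegralB//; try exact: integrable_circle.
have ci : continuous (fun t => f z t - f y t).
  by move=> t; apply: cvgB; exact: cfz.
apply: (le_trans (le_normr_Rintegral _ _)) => //; first exact: integrable_circle.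
have -> : e = (\int[mu]_(t in J) e')%R.
  rewrite Rintegral_cst//= lebesgue_measure_itv/= lte_fin pi2_gt0 /=.
  by rewrite subr0 /e' divfK// gt_eqF.
apply: le_Rintegral => //.
- apply: (@integrable_circle (fun t => `|f z t - f y t|)) => t.
  by apply: cvg_norm; exact: ci.
- by apply: (@integrable_circle (fun t => e')); exact: cst_continuous.
Qed.

End CircleIntegral.

(** * Circle means, Cauchy's formula for derivatives and Taylor coefficients *)

Section Holomorphic.
Variable R : realType.
Local Notation C := R[i].
Local Notation mu := (@lebesgue_measure R).
Implicit Types (F G : C -> C) (z w c : C).

Lemma cderivX (u : R -> C) (t : R) d n : cderiv u t d ->
  cderiv (fun s => u s ^+ n.+1) t (n.+1%:R * u t ^+ n * d).
Proof.
move=> h; elim: n => [|n IH].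
  by apply: (cderiv_eq h); rewrite expr0 !mul1r.
rewrite (_ : (fun s => u s ^+ n.+2) = (fun s => u s * u s ^+ n.+1)).
  by apply: (cderiv_eq (cderivM h IH)); rewrite -[n.+2%:R]natr1 !exprS; ring.
by apply/funext => s; rewrite exprS.
Qed.

Lemma cderiv_comp_real (u : R -> C) (f : R -> R) (t e : R) d :
  cderiv u (f t) d -> is_derive t 1 f e -> cderiv (u \o f) t (e%:C * d).
Proof.
case: d => a b [d0 d1] df; split; rewrite /= mul0r ?subr0 ?addr0 mulrC.
- exact: (is_derive1_comp d0 df).
- exact: (is_derive1_comp d1 df).
Qed.

Lemma cderiv0_cst (u : R -> C) : (forall t, cderiv u t 0) -> forall s t, u s = u t.
Proof.
move=> h s t; apply: complexP.
- by apply: (is_derive_0_is_cst (f := fun s => Re (u s))) => x; exact: (h x).1.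
- by apply: (is_derive_0_is_cst (f := fun s => Im (u s))) => x; exact: (h x).2.
Qed.

Lemma holo_eq F G G' : holo F G -> G = G' -> holo F G'.
Proof. by move=> h <-. Qed.

Lemma holo_cst c : holo (fun=> c) (fun=> 0).
Proof.
split; [exact: tcont_cst|exact: tcont_cst|].
by move=> u t d _; rewrite mul0r; exact: cderiv_cst.
Qed.

Lemma holo_id : holo (fun z : C => z) (fun=> 1).
Proof.
split; [exact: ccont_id|exact: tcont_cst|].
by move=> u t d h; rewrite mul1r.
Qed.

Lemma holoD F F' G G' : holo F F' -> holo G G' ->
  holo (fun z => F z + G z) (fun z => F' z + G' z).
Proof.
move=> [F0 F1 hF] [G0 G1 hG]; split; [exact: tcontD|exact: tcontD|].
by move=> u t d h; rewrite mulrDl; apply: cderivD; [exact: hF|exact: hG].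
Qed.

Lemma holoM F F' G G' : holo F F' -> holo G G' ->
  holo (fun z => F z * G z) (fun z => F z * G' z + F' z * G z).
Proof.
move=> [F0 F1 hF] [G0 G1 hG]; split.
- exact: tcontM.
- by apply: tcontD; exact: tcontM.
move=> u t d h; apply: (cderiv_eq (cderivM (hF _ _ _ h) (hG _ _ _ h))) => /=; ring.
Qed.

Lemma holoZ c F F' : holo F F' -> holo (fun z => c * F z) (fun z => c * F' z).
Proof.
move=> hF; apply: (holo_eq (holoM (holo_cst c) hF)).
by apply/funext => z; rewrite mul0r addr0.
Qed.

Lemma holo_comp F F' G G' : holo F F' -> holo G G' ->
  holo (fun z => F (G z)) (fun z => F' (G z) * G' z).
Proof.
move=> [F0 F1 hF] [G0 G1 hG]; split.
- exact: (tcont_comp F0 G0).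
- by apply: tcontM => //; exact: (tcont_comp F1 G0).
move=> u t d h; apply: (cderiv_eq (hF _ _ _ (hG _ _ _ h))) => /=; ring.
Qed.

Lemma holo_shift w F F' : holo F F' -> holo (fun z => F (z + w)) (fun z => F' (z + w)).
Proof.
move=> hF; apply: (holo_eq (holo_comp hF (holoD holo_id (holo_cst w)))).
by apply/funext => z; rewrite addr0 mulr1.
Qed.

Lemma holo_cexp c : holo (fun z => cexp (c * z)) (fun z => c * cexp (c * z)).
Proof.
have h : holo (@cexp R) (@cexp R).
  by split; [exact: ccont_cexp|exact: ccont_cexp|exact: cderiv_cexp].
apply: (holo_eq (holo_comp h (holoZ c holo_id))).
by apply/funext => z; rewrite mulr1 mulrC.
Qed.

Definition cis (t : R) : C := cos t +i* sin t.

Lemma conj_imuM z : (imu * z)^* = - imu * z^*.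
Proof. by case: z => a b; apply: complexP => /=; ring. Qed.

Lemma cis0 : cis 0 = 1.
Proof. by rewrite /cis cos0 sin0. Qed.

Lemma cis2pi : cis (2 * pi) = 1.
Proof. by rewrite /cis mulr2n mulrDl mul1r -mulr2n cos2pi sin2pi. Qed.

Lemma cisJ (t : R) : cis t * (cis t)^* = 1.
Proof.
by apply: complexP; rewrite cpartsE /=; [rewrite mulrN opprK -!expr2 cos2Dsin2|ring].
Qed.

Lemma cderiv_cis (t : R) : cderiv cis t (imu * cis t).
Proof.
split => /=.
- by rewrite mul0r mul1r sub0r; exact: is_derive_cos.
- by rewrite mul0r mul1r add0r; exact: is_derive_sin.
Qed.

Lemma tcont_cis (T : topologicalType) (f : T -> R) :
  continuous f -> tcont (fun s => cis (f s)).
Proof.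
move=> cf; split=> s /=.
- by apply: (continuous_comp (cf s)); exact: continuous_cos.
- by apply: (continuous_comp (cf s)); exact: continuous_sin.
Qed.

Lemma tcont_conj (T : topologicalType) (U : T -> C) : tcont U -> tcont (fun s => (U s)^*).
Proof. exact: (tcont_comp (@ccont_conj R)). Qed.

Lemma tcont_real (T : topologicalType) (f : T -> R) : continuous f -> tcont (fun s => (f s)%:C).
Proof. by move=> cf; split => //= s; exact: cst_continuous. Qed.

Let two_pi : C := (2 * pi)%:C.
Let two_pi_neq0 : two_pi != 0.
Proof.
rewrite /two_pi eq_complex /= eqxx andbT; apply: lt0r_neq0.
by rewrite mulr_gt0// pi_gt0.
Qed.

Lemma cint_cst c : cint (fun=> c) = two_pi * c.
Proof.
have E : cint (fun=> 1) = two_pi.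
  apply: complexP; rewrite /= Rintegral_cst//= lebesgue_measure_itv/=;
  by rewrite lte_fin mulr_gt0 ?pi_gt0//= subr0 ?mul1r ?mul0r.
rewrite [X in cint X](_ : _ = (fun=> c * 1)); last by apply/funext => t; rewrite mulr1.
by rewrite cintZ; [rewrite E mulrC|exact: tcont_cst].
Qed.

Lemma tcont_circle F (T : topologicalType) (a : T -> C) (b : T -> C) (f : T -> R) : ccont F ->
  tcont a -> tcont b -> continuous f -> tcont (fun s => F (a s + b s * cis (f s))).
Proof.
move=> cF ca cb cf; apply: (tcont_comp cF); apply: tcontD => //.
by apply: tcontM => //; exact: tcont_cis.
Qed.

Lemma tcont_circle1 F z w : ccont F -> tcont (fun t => F (w + z * cis t)).
Proof.
move=> cF; apply: (tcont_circle (a := fun=> w) (b := fun=> z) (f := fun t => t)) => //.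
- exact: tcont_cst.
- exact: tcont_cst.
- by move=> t; exact: cvg_id.
Qed.

(** Up to the factor [imu], the integrand is the derivative in [t] of the periodic function F(w + z
    e^(it)). Keeping the factor [z] avoids a division when the circle is degenerate. *)
Lemma cint_circle_deriv F F' z w : holo F F' ->
  z * cint (fun t => cis t * F' (w + z * cis t)) = 0.
Proof.
move=> [F0 F1 hF].
have cc : tcont (fun t => cis t * F' (w + z * cis t)).
  apply: tcontM; last exact: tcont_circle1.
  by apply: tcont_cis => t; exact: cvg_id.
have i0 : imu != 0 :> C by rewrite eq_complex /= oner_eq0 andbF.
apply: (mulfI i0); rewrite mulr0 mulrA -cintZ//.
rewrite (@cint_deriv _ (fun t => F (w + z * cis t))).
- by rewrite cis0 cis2pi subrr.
- by apply: tcontM => //; exact: tcont_cst.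
move=> t; apply: (cderiv_eq (hF _ _ _ (cderivD (cderiv_cst w t) (cderivZ z (cderiv_cis t))))).
rewrite /=; ring.
Qed.

(** The circle is shrunk to its centre: by [cint_circle_deriv] the mean over the circle through w +
    s z has derivative 0 in s, and at s = 0 the integrand is constant. *)
Lemma circle_mean F F' z w : holo F F' ->
  cint (fun t => F (w + z * cis t)) = two_pi * F w.
Proof.
move=> hF; have [F0 F1 h] := hF.
pose phi (s : R) := cint (fun t => F (w + (s%:C * z) * cis t)).
have dphi s : cderiv phi s (cint (fun t => z * cis t * F' (w + (s%:C * z) * cis t))).
  apply: (cderiv_under_circle (u := fun s t => F (w + s%:C * z * cis t))
    (du := fun s t => z * cis t * F' (w + s%:C * z * cis t))).
  - move=> x t.
    have := h _ _ _ (cderivD (cderiv_cst w x) (cderivM (cderivM (cderiv_id x) (cderiv_cst z x)) (cderiv_cst (cis t) x))).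
    by move/cderiv_eq; apply; ring.
  - by move=> x; exact: tcont_circle1.
  - apply: tcontM.
      apply: tcontM; first exact: tcont_cst.
      by apply: tcont_cis => p; exact: cvg_snd.
    apply: tcont_circle => //.
    + exact: tcont_cst.
    + apply: tcontM; last exact: tcont_cst.
      by apply: tcont_real => p; exact: cvg_fst.
    + by move=> p; exact: cvg_snd.
have z0 s : cint (fun t => z * cis t * F' (w + (s%:C * z) * cis t)) = 0.
  rewrite [X in cint X](_ : _ = (fun t => z * (cis t * F' (w + (s%:C * z) * cis t)))); last first.
    by apply/funext => t; rewrite mulrA.
  rewrite cintZ; last first.
    apply: tcontM; last exact: tcont_circle1.
    by apply: tcont_cis => t; exact: cvg_id.
  (* At s = 0 the factor [s] cannot be cancelled. There the integrand is a multiple of [cis], whose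
     integral vanishes by the same lemma applied to the identity. *)
  have [->|s0] := eqVneq s 0.
    rewrite [X in cint X](_ : _ = (fun t => F' w * cis t)); last first.
      by apply/funext => t; rewrite mul0r mul0r addr0 mulrC.
    have ct : tcont cis by apply: tcont_cis => t; exact: cvg_id.
    rewrite cintZ//.
    have := @cint_circle_deriv id (fun=> 1) 1 0 holo_id.
    under [X in cint X]funext => t do rewrite mulr1.
    by rewrite mul1r => ->; rewrite !mulr0.
  have sc0 : s%:C != 0 :> C by rewrite eq_complex /= eqxx andbT.
  by apply: (mulfI sc0); rewrite mulrA (cint_circle_deriv _ _ hF) mulr0.
have dphi0 s : cderiv phi s 0 by have := dphi s; rewrite z0.
have := cderiv0_cst dphi0 1 0.
rewrite /phi; under [X in cint X]funext => t do rewrite mul1r.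
move=> ->; rewrite -cint_cst; congr cint; apply/funext => t.
by rewrite !mul0r addr0.
Qed.

Lemma continuous_cst_right (q : R -> R) (c : R) : continuous q ->
  (forall s, 0 < s -> q s = c) -> q 0 = c.
Proof.
move=> cq h.
have h1 : q x @[x --> 0^'+] --> q 0 by apply: cvg_at_right_filter; exact: cq.
have h2 : q x @[x --> 0^'+] --> c.
  apply: cvg_near_cst; near=> x; apply: h; near: x; exact: nbhs_right_gt.
exact: (cvg_unique _ h1 h2).
Unshelve. all: by end_near.
Qed.

(** [circle_mean] does not apply to [F'], which is so far only known to be continuous. Instead the
    integral [psi] over radius s satisfies psi' = m and s m = psi, so psi(s) / s is constant for s >
    0; letting s tend to 0 in [m] gives the value. *)
Lemma circle_deriv F F' w : holo F F' ->
  cint (fun t => F (w + cis t) * (cis t)^*) = two_pi * F' w.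
Proof.
move=> hF; have [F0 F1 h] := hF.
have tcc : tcont (fun t => (cis t)^*).
  by apply: tcont_conj; apply: tcont_cis => t; exact: cvg_id.
pose psi (s : R) := cint (fun t => F (w + s%:C * cis t) * (cis t)^*).
pose m (s : R) := cint (fun t => F' (w + s%:C * cis t)).
have cF' : tcont (fun p : R * R => F' (w + (p.1)%:C * cis p.2)).
  apply: tcont_circle => //; first exact: tcont_cst.
    by apply: tcont_real => p; exact: cvg_fst.
  by move=> p; exact: cvg_snd.
have dpsi s : cderiv psi s (m s).
  apply: (cderiv_under_circle (u := fun s t => F (w + s%:C * cis t) * (cis t)^*)
    (du := fun s t => F' (w + s%:C * cis t))) => //.
  - move=> x t.
    have := cderivM (h _ _ _ (cderivD (cderiv_cst w x) (cderivM (cderiv_id x) (cderiv_cst (cis t) x))))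
      (cderiv_cst (cis t)^* x).
    move/cderiv_eq; apply.
    by rewrite /= !mulr0 !add0r mul1r -mulrA cisJ mulr1.
  - by move=> x; apply: tcontM => //; exact: tcont_circle1.
(* Up to the factor [imu], the difference is the integral over one period of the derivative in t of
   F(w + s e^(it)) e^(-it). *)
have sm s : s%:C * m s = psi s.
  apply/eqP; rewrite -subr_eq0; apply/eqP.
  rewrite /m /psi -cintZ; last exact: tcont_circle1.
  rewrite -[X in _ - X]mul1r -mulNr -cintZ; last by apply: tcontM => //; exact: tcont_circle1.
  have ca : tcont (fun t => s%:C * F' (w + s%:C * cis t)).
    by apply: tcontM; [exact: tcont_cst|exact: tcont_circle1].
  have cb : tcont (fun t => - 1 * (F (w + s%:C * cis t) * (cis t)^*)).
    by apply: tcontM; [exact: tcont_cst|apply: tcontM => //; exact: tcont_circle1].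
  rewrite -cintD//.
  have i0 : imu != 0 :> C by rewrite eq_complex /= oner_eq0 andbF.
  apply: (mulfI i0); rewrite mulr0 -cintZ; last exact: tcontD.
  rewrite (@cint_deriv _ (fun t => F (w + s%:C * cis t) * (cis t)^*)).
  - by rewrite cis0 cis2pi subrr.
  - by apply: tcontM; [exact: tcont_cst|exact: tcontD].
  move=> t.
  have := cderivM (h _ _ _ (cderivD (cderiv_cst w t) (cderivZ s%:C (cderiv_cis t)))) (cderiv_conj (cderiv_cis t)).
  move/cderiv_eq; apply; rewrite /comp.
  rewrite conj_imuM.
  have E := cisJ t.
  transitivity (imu * (s%:C * F' (w + s%:C * cis t)) * (cis t * (cis t)^*)
     - imu * (F (w + s%:C * cis t) * (cis t)^*)); first by ring.
  by rewrite E; ring.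
have mpsi : m 0 = psi 1.
  (* This is psi(s) / s in the variable x = ln s, so that constancy on s > 0 becomes constancy on
     the whole line. *)
  pose r (x : R) := (expR (- x))%:C * psi (expR x).
  have dr x : cderiv r x 0.
    have de : is_derive x 1 (fun x : R => expR (- x)) (- expR (- x)).
      by apply: is_derive_eq; rewrite /GRing.scale /= mulrN1.
    have dp : cderiv (psi \o expR) x ((expR x)%:C * m (expR x)).
      exact: cderiv_comp_real (dpsi _) (is_derive_expR x).
    apply: (cderiv_eq (cderivM (cderiv_real de) dp)).
    by rewrite sm /= -mulrDl -rmorphD subrr mul0r.
  have mE s : 0 < s -> m s = psi 1.
    move=> s0.
    have := cderiv0_cst dr (ln s) 0.
    rewrite /r oppr0 expR0 expRN lnK// mul1r -sm mulrA -rmorphM /= mulVf ?gt_eqF//.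
    by rewrite mul1r.
  have [cm0 cm1] := cF'.
  apply: complexP.
  - apply: (@continuous_cst_right (fun s => Re (m s))).
      exact: (@continuous_under_circle R R (fun s t => Re (F' (w + s%:C * cis t)))).
    by move=> s /mE ->.
  - apply: (@continuous_cst_right (fun s => Im (m s))).
      exact: (@continuous_under_circle R R (fun s t => Im (F' (w + s%:C * cis t)))).
    by move=> s /mE ->.
rewrite [X in cint X](_ : _ = (fun t => F (w + 1%:C * cis t) * (cis t)^*)).
  rewrite -[LHS]mpsi -cint_cst; congr cint; apply/funext => t.
  by rewrite mul0r addr0.
by apply/funext => t; rewrite mul1r.
Qed.

(* Cauchy's integral makes sense of the derivative of an arbitrary [F], so that
   derivatives can be iterated without any choice. *)
Definition cauchy_deriv F : C -> C :=
  fun w => two_pi^-1 * cint (fun t => F (w + cis t) * (cis t)^*).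

Lemma cauchy_derivE F F' : holo F F' -> cauchy_deriv F = F'.
Proof.
by move=> hF; apply/funext => w; rewrite /cauchy_deriv (circle_deriv w hF) mulKf.
Qed.

(** By [cauchy_derivE], [F'] is the Cauchy integral of [F], in which the point enters only through
    F(w + e^(it)). Differentiation under the integral sign replaces [F] by [F'] there, which gives
    one more derivative. *)
Lemma holo_cauchy_deriv F F' : holo F F' -> holo F' (cauchy_deriv F').
Proof.
move=> hF; have [F0 F1 h] := hF.
have tcc (T : topologicalType) (f : T -> R) : continuous f -> tcont (fun s => (cis (f s))^*).
  by move=> cf; apply: tcont_conj; exact: tcont_cis.
have tJ G (T : topologicalType) (a : T -> C) : ccont G -> tcont a ->
    tcont (fun p : T * R => G (a p.1 + cis p.2) * (cis p.2)^*).
  move=> cG [a0 a1]; have c2 : continuous (fun p : T * R => p.2) by move=> p; exact: cvg_snd.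
  apply: tcontM; last exact: tcc.
  apply: (tcont_comp cG); apply: tcontD; last exact: tcont_cis.
  split=> p.
  - by apply: (continuous_comp (f := fst) (g := fun q => Re (a q))); [exact: cvg_fst|exact: a0].
  - by apply: (continuous_comp (f := fst) (g := fun q => Im (a q))); [exact: cvg_fst|exact: a1].
have t1 w : tcont (fun t => F (w + cis t) * (cis t)^*).
  apply: tcontM; last by apply: tcc => t; exact: cvg_id.
  apply: (tcont_comp F0); apply: tcontD; first exact: tcont_cst.
  by apply: tcont_cis => t; exact: cvg_id.
rewrite -{1}(cauchy_derivE hF).
(* Curves of constant velocity [d]: the values 1 and [imu] of [d] yield the two hypotheses of
   [holo_C1]. *)
have D (a : R -> C) (x : R) d : tcont a -> (forall x, cderiv a x d) ->
    cderiv (fun s => cauchy_deriv F (a s)) x (d * cauchy_deriv F' (a x)).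
  move=> ca da; rewrite /cauchy_deriv mulrCA -cintZ.
    apply: cderivZ.
    apply: (cderiv_under_circle (u := fun s t => F (a s + cis t) * (cis t)^*)
      (du := fun s t => d * (F' (a s + cis t) * (cis t)^*))) => //.
    + move=> y t.
      have := cderivM (h _ _ _ (cderivD (da y) (cderiv_cst (cis t) y))) (cderiv_cst (cis t)^* y).
      by move/cderiv_eq; apply; rewrite /comp; ring.
    + by apply: tcontM; [exact: tcont_cst|exact: (@tJ F' R a F1 ca)].
  apply: tcontM; last by apply: tcc => t; exact: cvg_id.
  apply: (tcont_comp F1); apply: tcontD; first exact: tcont_cst.
  by apply: tcont_cis => t; exact: cvg_id.
apply: holo_C1.
- apply: tcontM; first exact: tcont_cst.
  have ci : tcont (fun z : R * R => z.1 +i* z.2) by exact: (@ccont_id R).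
  have [c0 c1] := tJ F' _ _ F1 ci.
  split.
  + have H := @continuous_under_circle R (R * R)%type
      (fun p t => Re (F' (p.1 +i* p.2 + cis t) * (cis t)^*)) c0.
    move=> z; exact: (H z).
  + have H := @continuous_under_circle R (R * R)%type
      (fun p t => Im (F' (p.1 +i* p.2 + cis t) * (cis t)^*)) c1.
    move=> z; exact: (H z).
- move=> x y; rewrite -[X in cderiv _ _ X]mul1r.
  apply: (D (fun s => s +i* y)).
  + by split => s; [exact: cvg_id|exact: cst_continuous].
  + by move=> s; split; [exact: is_derive_id|exact: is_derive_cst].
- move=> x y; apply: (D (fun s => x +i* s)).
  + by split => s; [exact: cst_continuous|exact: cvg_id].
  + by move=> s; split; [exact: is_derive_cst|exact: is_derive_id].
Qed.

Definition tower (D : nat -> C -> C) : Prop := forall k, holo (D k) (D k.+1).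

Lemma holo_tower F F' : holo F F' -> tower (fun k => iter k cauchy_deriv F).
Proof.
move=> hF; elim=> [|k IH]; first by rewrite /= (cauchy_derivE hF).
exact: holo_cauchy_deriv IH.
Qed.

(** The j-th Fourier coefficient on the circle is the j-th Taylor coefficient. Integrating by parts
    in t trades one power of e^(-it) for one derivative of [D m], at the cost of the factors [z] and
    1 / (j + 1). *)
Lemma circle_coef D m j z w : tower D ->
  j`!%:R * cint (fun t => D m (w + z * cis t) * ((cis t)^*) ^+ j)
  = two_pi * z ^+ j * D (m + j)%N w.
Proof.
move=> hD; elim: j m => [|j IH] m.
  rewrite fact0 mul1r expr0 mulr1 addn0 -(circle_mean z w (hD m)).
  by congr cint; apply/funext => t; rewrite expr0 mulr1.
have tcX n : tcont (fun t => (cis t)^* ^+ n).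
  by apply: tcontX; apply: tcont_conj; apply: tcont_cis => t; exact: cvg_id.
have tD k n : tcont (fun t => D k (w + z * cis t) * (cis t)^* ^+ n).
  by apply: tcontM => //; apply: tcont_circle1; have [] := hD k.
have step : j.+1%:R * cint (fun t => D m (w + z * cis t) * ((cis t)^*) ^+ j.+1)
    = z * cint (fun t => D m.+1 (w + z * cis t) * ((cis t)^*) ^+ j).
  apply/eqP; rewrite eq_sym -subr_eq0; apply/eqP.
  rewrite -mulNr -!cintZ//.
  have ca : tcont (fun t => z * (D m.+1 (w + z * cis t) * (cis t)^* ^+ j)).
    by apply: tcontM => //; exact: tcont_cst.
  have cb : tcont (fun t => - j.+1%:R * (D m (w + z * cis t) * (cis t)^* ^+ j.+1)).
    by apply: tcontM => //; exact: tcont_cst.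
  rewrite -cintD//.
  have i0 : imu != 0 :> C by rewrite eq_complex /= oner_eq0 andbF.
  apply: (mulfI i0); rewrite mulr0 -cintZ; last exact: tcontD.
  rewrite (@cint_deriv _ (fun t => D m (w + z * cis t) * (cis t)^* ^+ j.+1)).
  - by rewrite cis0 cis2pi subrr.
  - by apply: tcontM; [exact: tcont_cst|exact: tcontD].
  move=> t; have [_ _ h] := hD m.
  have := cderivM (h _ _ _ (cderivD (cderiv_cst w t) (cderivZ z (cderiv_cis t)))) (cderivX j (cderiv_conj (cderiv_cis t))).
  move/cderiv_eq; apply; rewrite /comp.
  rewrite conj_imuM.
  transitivity (imu * (z * (D m.+1 (w + z * cis t) * (cis t)^* ^+ j)) * (cis t * (cis t)^*)
     - imu * (j.+1%:R * (D m (w + z * cis t) * (cis t)^* ^+ j.+1))); first by rewrite !exprS; ring.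
  by rewrite cisJ; ring.
rewrite factS mulnC natrM -mulrA step mulrCA IH exprS addSnnS; ring.
Qed.

End Holomorphic.

(** * Integrals over the plane *)

Section PlaneIntegral.
Variable R : realType.
Local Notation mu := (@lebesgue_measure R).
Local Notation mu2 := (mu \x mu)%E.
Implicit Types (G : R * R -> R) (T : R * R -> R * R).

(** The plane carries the product sigma-algebra, so an open set has to be exhibited as a countable
    union of rectangles; those with rational corners suffice. *)
Lemma open_prod_measurable (U : set (R * R)) : open U -> measurable U.
Proof.
move=> oU.
pose rect (i : rat * rat * rat * rat) : set (R * R) :=
  `](ratr i.1.1.1 : R), (ratr i.1.1.2 : R)[%classic `*` `](ratr i.1.2 : R), (ratr i.2 : R)[%classic.
pose V i := if `[< rect i `<=` U >] then rect i else set0.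
have -> : U = \bigcup_i V i.
  rewrite eqEsubset; split; last first.
    by move=> z [i _]; rewrite /V; case: asboolP => // + ?; apply.
  move=> [x y] Uxy.
  have /nbhs_ballP[e /= e0 he] : nbhs (x, y) U by apply: open_nbhs_nbhs.
  have /rat_in_itvoo[a] : x - e < x by rewrite ltrBlDr ltrDl.
  rewrite in_itv /= => /andP[a1 a2].
  have /rat_in_itvoo[b] : x < x + e by rewrite ltrDl.
  rewrite in_itv /= => /andP[b1 b2].
  have /rat_in_itvoo[c] : y - e < y by rewrite ltrBlDr ltrDl.
  rewrite in_itv /= => /andP[c1 c2].
  have /rat_in_itvoo[d] : y < y + e by rewrite ltrDl.
  rewrite in_itv /= => /andP[d1 d2].
  exists (a, b, c, d) => //; rewrite /V; case: asboolP => [_|[]].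
    by split; rewrite /= in_itv /= ?a2 ?b1 ?c2 ?d1.
  move=> [u v] [/=]; rewrite !in_itv /= => /andP[au ub] /andP[cv vd].
  apply: he; split; rewrite /ball /= ltr_norml; apply/andP; split; lra.
apply: countable_bigcupT_measurable => // i.
rewrite /V; case: asboolP => // _.
by apply: measurableX; exact: measurable_itv.
Qed.

Lemma continuous_prod_measurable G : continuous G -> measurable_fun setT G.
Proof.
move=> /continuousP cf; apply: (measurability _ (RGenOpens.measurableE R)).
move=> _ [_ [a [b ->] <-]]; rewrite setTI; apply: open_prod_measurable.
exact/cf/interval_open.
Qed.

Lemma continuous_prod_emeasurable G : continuous G -> measurable_fun setT (fun z : R * R => (G z)%:E).
Proof. by move=> cG; apply/measurable_EFinP; exact: continuous_prod_measurable. Qed.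

Lemma ge0_integral_shift (g : R -> R) (c : R) : continuous g -> (forall x, 0 <= g x) ->
  (\int[mu]_x (g (x + c))%:E = \int[mu]_x (g x)%:E)%E.
Proof.
move=> cg g0.
have D : derive1 (fun x : R => x + c) = cst 1.
  by apply/funext => x; rewrite derive1E derive_val addr0.
rewrite [RHS](@increasing_ge0_integration_by_substitutionT R (fun x => x + c))//.
- by apply: eq_integral => x _; rewrite D fctE mulr1.
- by move=> x y xy; rewrite ltrD2r.
- by rewrite D; exact: cst_continuous.
- by rewrite D; exact: is_cvg_cst.
- by rewrite D; exact: is_cvg_cst.
- exact: cvg_addrr_Ny.
- exact: cvg_addrr.
Qed.

Lemma ge0_integral_opp (g : R -> R) : continuous g -> (forall x, 0 <= g x) ->
  (\int[mu]_x (g (- x))%:E = \int[mu]_x (g x)%:E)%E.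
Proof.
move=> cg g0.
have cN : continuous (fun x => g (- x)).
  by move=> x; apply: (continuous_comp (f := -%R)); [exact: opp_continuous|exact: cg].
have H (h : R -> R) : continuous h -> (forall x, 0 <= h x) ->
  (\int[mu]_x (h x)%:E = \int[mu]_(x in `[0%R, +oo[) (h (- x))%:E
     + \int[mu]_(x in `[0%R, +oo[) (h x)%:E)%E.
  move=> ch h0; have mh := continuous_measurable_fun ch.
  have mposnums : measurable [set x : R | 0 <= x] by rewrite -set_itvcy.
  rewrite -(setUv [set x : R | 0 <= x]) ge0_integral_setU//= ; last 4 first.
    exact: measurableC.
    by apply/measurable_EFinP; rewrite setUv.
    by move=> x _; rewrite lee_fin.
    exact/disj_setPCl.
  rewrite addeC -set_itvcy// setCitvr.
  rewrite integral_itv_bndo_bndc; last exact/measurable_EFinP/measurable_funTS.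
  by rewrite -{1}oppr0 ge0_integration_by_substitutionNy//; exact: continuous_subspaceT.
rewrite H// [RHS]H// addeC; congr (_ + _)%E.
by apply: eq_integral => x _; rewrite opprK.
Qed.

(** Invariance is tested on nonnegative continuous functions because Tonelli's theorem applies to
    them without integrability. Signed functions are recovered in [preserves2_integrable]. *)
Definition preserves2 T : Prop := continuous T /\
  forall G, continuous G -> (forall z, 0 <= G z) ->
    (\int[mu2]_z (G (T z))%:E = \int[mu2]_z (G z)%:E)%E.

Lemma preserves2_comp T T' : preserves2 T -> preserves2 T' -> preserves2 (T \o T').
Proof.
move=> [cT hT] [cT' hT']; split.
  by move=> z; apply: continuous_comp; [exact: cT'|exact: cT].
move=> G cG G0; rewrite -(hT G)//; apply: (hT' (G \o T)) => [|z]; last exact: G0.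
by move=> z; apply: continuous_comp; [exact: cT|exact: cG].
Qed.

Lemma continuous_slice1 G (y : R) : continuous G -> continuous (fun x => G (x, y)).
Proof.
move=> cG x; apply: (continuous_comp (f := fun x : R => (x, y))); last exact: cG.
by apply: cvg_pair_nbhs; [exact: cvg_id|exact: cvg_cst].
Qed.

Lemma continuous_slice2 G (x : R) : continuous G -> continuous (fun y => G (x, y)).
Proof.
move=> cG y; apply: (continuous_comp (f := fun y : R => (x, y))); last exact: cG.
by apply: cvg_pair_nbhs; [exact: cvg_cst|exact: cvg_id].
Qed.

Lemma tonelli1 G : continuous G -> (forall z, 0 <= G z) ->
  (\int[mu2]_z (G z)%:E = \int[mu]_x \int[mu]_y (G (x, y))%:E)%E.
Proof.
move=> cG G0; have mG := continuous_prod_emeasurable cG.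
have G0' z : (0 <= (G z)%:E)%E by rewrite lee_fin.
exact: (@fubini_tonelli1 _ _ _ _ R mu mu (fun z => (G z)%:E) mG G0').
Qed.

Lemma tonelli2 G : continuous G -> (forall z, 0 <= G z) ->
  (\int[mu2]_z (G z)%:E = \int[mu]_y \int[mu]_x (G (x, y))%:E)%E.
Proof.
move=> cG G0; have mG := continuous_prod_emeasurable cG.
have G0' z : (0 <= (G z)%:E)%E by rewrite lee_fin.
exact: (@fubini_tonelli2 _ _ _ _ R mu mu (fun z => (G z)%:E) mG G0').
Qed.

(** With the first coordinate fixed, a shear is a translation of the second one, so Tonelli's
    theorem reduces it to translation invariance on the line. *)
Lemma preserves2_shear2 (h : R -> R) : continuous h ->
  preserves2 (fun z => (z.1, z.2 + h z.1)).
Proof.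
move=> ch.
have cT : continuous (fun z : R * R => (z.1, z.2 + h z.1)).
  move=> z; apply: cvg_pair_nbhs; first exact: cvg_fst.
  apply: cvgD; first exact: cvg_snd.
  by apply: (continuous_comp (f := fst)); [exact: cvg_fst|exact: ch].
split => // G cG G0.
have cGT : continuous (fun z => G (z.1, z.2 + h z.1)).
  by move=> z; apply: (continuous_comp (@cT z)); exact: cG.
apply: (etrans (tonelli1 cGT _)) => //.
rewrite (tonelli1 cG)//.
apply: eq_integral => x _; by apply: (ge0_integral_shift (g := fun y => G (x, y)) (h x)) => //; exact: continuous_slice2.
Qed.

Lemma preserves2_shear1 (h : R -> R) : continuous h ->
  preserves2 (fun z => (z.1 + h z.2, z.2)).
Proof.
move=> ch.
have cT : continuous (fun z : R * R => (z.1 + h z.2, z.2)).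
  move=> z; apply: cvg_pair_nbhs; last exact: cvg_snd.
  apply: cvgD; first exact: cvg_fst.
  by apply: (continuous_comp (f := snd)); [exact: cvg_snd|exact: ch].
split => // G cG G0.
have cGT : continuous (fun z => G (z.1 + h z.2, z.2)).
  by move=> z; apply: (continuous_comp (@cT z)); exact: cG.
apply: (etrans (tonelli2 cGT _)) => //.
rewrite (tonelli2 cG)//.
apply: eq_integral => y _; by apply: (ge0_integral_shift (g := fun x => G (x, y)) (h y)) => //; exact: continuous_slice1.
Qed.

Lemma preserves2_reflect : preserves2 (fun z => (z.1, - z.2)).
Proof.
have cT : continuous (fun z : R * R => (z.1, - z.2)).
  move=> z; apply: cvg_pair_nbhs; first exact: cvg_fst.
  by apply: (@cvgN R R^o); exact: cvg_snd.
split => // G cG G0.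
have cGT : continuous (fun z => G (z.1, - z.2)).
  by move=> z; apply: (continuous_comp (@cT z)); exact: cG.
apply: (etrans (tonelli1 cGT _)) => //.
rewrite (tonelli1 cG)//.
apply: eq_integral => x _; by apply: (ge0_integral_opp (g := fun y => G (x, y))) => //; exact: continuous_slice2.
Qed.

Lemma preserves2_shift (a b : R) : preserves2 (fun z => (z.1 + a, z.2 + b)).
Proof.
exact: (preserves2_comp (preserves2_shear1 (@cst_continuous _ _ a))
                        (preserves2_shear2 (@cst_continuous _ _ b))).
Qed.

(* A rotation is a product of three shears, unless its angle is pi. *)
Lemma preserves2_rotation (a b : R) : a ^+ 2 + b ^+ 2 = 1 ->
  preserves2 (fun z => (a * z.1 - b * z.2, b * z.1 + a * z.2)).
Proof.
have cM (k : R) : continuous (fun x => k * x).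
  by move=> x; apply: cvgM; [exact: cvg_cst|exact: cvg_id].
have main (p q : R) : p ^+ 2 + q ^+ 2 = 1 -> p != - 1 ->
    preserves2 (fun z => (p * z.1 - q * z.2, q * z.1 + p * z.2)).
  move=> pq p1.
  have p1' : 1 + p != 0 by rewrite addrC -[1]opprK subr_eq0.
  (* The tangent of half the angle. The shears with slopes [- t], [q], [- t] compose to the rotation
     because t q = 1 - p and t (1 + p) = q. *)
  pose t := q / (1 + p).
  have h1 := preserves2_shear1 (cM (- t)).
  have h2 := preserves2_shear2 (cM q).
  have := preserves2_comp h1 (preserves2_comp h2 h1).
  congr preserves2; apply/funext => z /=.
  have tq : t * q = 1 - p.
    apply: (mulIf p1'); rewrite /t mulrAC divfK// -expr2.
    by rewrite (_ : q ^+ 2 = 1 - p ^+ 2); [ring|rewrite -pq; ring].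
  have tp : t * (1 + p) = q by rewrite /t divfK.
  congr pair.
  - transitivity ((1 - t * q) * z.1 - (t * (1 + (1 - t * q))) * z.2); first by ring.
    by rewrite tq (_ : 1 - (1 - p) = p) ?tp//; ring.
  - transitivity (q * z.1 + (1 - t * q) * z.2); first by ring.
    by rewrite tq; ring.
move=> ab; have [a1|a1] := eqVneq a (- 1); last exact: main.
have b0 : b = 0.
  by apply/eqP; rewrite -sqrf_eq0; apply/eqP; move: ab; rewrite a1 sqrrN expr1n; lra.
(* The half turn is the quarter turn applied twice. *)
have h : preserves2 (fun z => (0 * z.1 - 1 * z.2, 1 * z.1 + 0 * z.2)).
  by apply: main; [ring|rewrite eq_sym oppr_eq0 oner_eq0].
have := preserves2_comp h h; congr preserves2; apply/funext => z /=.
by rewrite a1 b0; congr pair; ring.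
Qed.

(** G is the difference of the nonnegative continuous functions |G| + G and |G|, and the invariance
    of both integrals is known. *)
Lemma preserves2_integrable T G : preserves2 T -> continuous G ->
  mu2.-integrable setT (EFin \o G) ->
  mu2.-integrable setT (fun z => (G (T z))%:E) /\
  (\int[mu2]_z (G (T z)) = \int[mu2]_z G z)%R.
Proof.
move=> [cT hT] cG iG.
have cGT : continuous (G \o T).
  by move=> z; apply: continuous_comp; [exact: cT|exact: cG].
have iGT : mu2.-integrable setT (EFin \o (G \o T)).
  apply/integrableP; split; first exact: continuous_prod_emeasurable.
  rewrite (_ : (fun _ => _) = (fun z => (`|G (T z)|)%:E)); last by apply/funext.
  rewrite (hT (fun z => `|G z|))//; first by move/integrableP : iG => [].
  by move=> z; apply: cvg_norm; exact: cG.
split => //.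
have cp : continuous (fun z => `|G z| + G z).
  by move=> z; apply: cvgD; [apply: cvg_norm; exact: cG|exact: cG].
have cn : continuous (fun z => `|G z| - G z).
  by move=> z; apply: cvgB; [apply: cvg_norm; exact: cG|exact: cG].
have E1 := hT _ cp; have E2 := hT _ cn.
have aG : mu2.-integrable setT (EFin \o (fun z => `|G z|)) by exact: integrable_norm.
have aGT : mu2.-integrable setT (EFin \o (fun z => `|G (T z)|)) by exact: integrable_norm.
have F1 : (\int[mu2]_z `|G (T z)| = \int[mu2]_z `|G z|)%R.
  rewrite /Rintegral (hT (fun z => `|G z|))//.
  by move=> z; apply: cvg_norm; exact: cG.
have F2 : (\int[mu2]_z (`|G (T z)| + G (T z)) = \int[mu2]_z (`|G z| + G z))%R.
  rewrite /Rintegral (hT (fun z => `|G z| + G z))//.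
  by move=> z; rewrite -lerBlDl sub0r lerNl -normrN ler_norm.
by move: F2; rewrite !RintegralD// F1 => /addrI.
Qed.

End PlaneIntegral.

(** * Gaussian moments in the plane *)

Section GaussianMoments.
Variable R : realType.
Local Notation mu := (@lebesgue_measure R).
Local Notation mu2 := (mu \x mu)%E.

Definition sqnorm2 (z : R * R) : R := z.1 ^+ 2 + z.2 ^+ 2.

Lemma sqnorm2_ge0 z : 0 <= sqnorm2 z.
Proof. by rewrite addr_ge0// sqr_ge0. Qed.

Lemma continuous_sqnorm2 : continuous sqnorm2.
Proof.
by move=> z; apply: cvgD; rewrite /= expr2; apply: cvgM;
  (exact: cvg_fst || exact: cvg_snd).
Qed.

(** The rate [c] is kept as a variable because the moments are computed by differentiating in it;
    only 2 pi is needed in the end. *)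
Definition gaussk (c : R) (k : nat) (z : R * R) : R :=
  sqnorm2 z ^+ k * expR (- (c * sqnorm2 z)).

Lemma gaussk_ge0 c k z : 0 <= gaussk c k z.
Proof. by rewrite mulr_ge0 ?expR_ge0// exprn_ge0// sqnorm2_ge0. Qed.

Lemma continuous_gaussk c k : continuous (gaussk c k).
Proof.
move=> z; have cs := @continuous_sqnorm2 z.
apply: cvgM.
  by apply: (continuous_comp (f := sqnorm2) (g := fun x => x ^+ k)) => //; exact: exprn_continuous.
apply: (continuous_comp (f := fun z => - (c * sqnorm2 z))); last exact: continuous_expR.
by apply: (@cvgN R R^o); apply: cvgM; [exact: cvg_cst|exact: cs].
Qed.

Lemma integral_gauss_scaled (c : R) : 0 < c ->
  (\int[mu]_x (expR (- (c * x ^+ 2)))%:E = (Num.sqrt (pi / c))%:E)%E.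
Proof.
(* The standard deviation for which the exponent x^2 / (2 s^2) of the normal density is c x^2. *)
move=> c0; pose s := Num.sqrt ((2 * c)^-1).
have s0 : s != 0 by rewrite gt_eqF// sqrtr_gt0 invr_gt0 mulr_gt0.
have s2 : s ^+ 2 *+ 2 = c^-1.
  rewrite sqr_sqrtr; last by rewrite invr_ge0 mulr_ge0// ltW.
  by rewrite -mulr_natr; field; rewrite gt_eqF.
have pk : normal_peak s = (Num.sqrt (pi / c))^-1.
  by rewrite /normal_peak -mulrnAl s2 mulrC.
have p0 : 0 < Num.sqrt (pi / c) by rewrite sqrtr_gt0 divr_gt0// pi_gt0.
have := integral_normal_pdf 0 s.
rewrite normal_pdfE// => H.
transitivity (\int[mu]_x ((Num.sqrt (pi / c))%:E * (normal_peak s * normal_fun 0 s x)%:E))%E.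
  apply: eq_integral => x _; rewrite -EFinM pk mulVKf ?gt_eqF//.
  by rewrite /normal_fun subr0 s2 invrK; congr (expR _)%:E; ring.
rewrite ge0_integralZl_EFin//=.
- by rewrite H mule1.
- by move=> x _; rewrite lee_fin mulr_ge0 ?normal_peak_ge0// expR_ge0.
- apply/measurable_EFinP; apply: measurable_funM => //.
  exact: measurable_normal_fun.
Qed.

Lemma integral_gaussk0 (c : R) : 0 < c ->
  (\int[mu2]_z (gaussk c 0 z)%:E = (pi / c)%:E)%E.
Proof.
move=> c0; rewrite (tonelli1 (@continuous_gaussk c 0) (gaussk_ge0 c 0)).
have pc0 : 0 <= pi / c by rewrite divr_ge0 ?pi_ge0 // ltW.
have m1 : measurable_fun setT (fun x : R => (expR (- (c * x ^+ 2)))%:E).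
  have h : continuous (fun x : R => expR (- (c * x ^+ 2))).
    have h2 : continuous (fun x : R => - (c * x ^+ 2)).
      by move=> x; apply: (@cvgN R R^o); apply: cvgM; [exact: cvg_cst|exact: exprn_continuous].
    by move=> x; exact: (continuous_comp (h2 x) (@continuous_expR R _)).
  by apply/measurable_EFinP; exact: continuous_measurable_fun.
transitivity (\int[mu]_x ((Num.sqrt (pi / c))%:E * (expR (- (c * x ^+ 2)))%:E))%E.
  apply: eq_integral => x _.
  transitivity (\int[mu]_y ((expR (- (c * x ^+ 2)))%:E * (expR (- (c * y ^+ 2)))%:E))%E.
    apply: eq_integral => y _.
    by rewrite /gaussk expr0 mul1r /sqnorm2 /= mulrDr opprD expRD EFinM.
  rewrite ge0_integralZl_EFin//= ?expR_ge0//.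
  by rewrite integral_gauss_scaled// muleC.
rewrite ge0_integralZl_EFin//= ?sqrtr_ge0//.
by rewrite integral_gauss_scaled// -EFinM -expr2 sqr_sqrtr.
Qed.

(** Half of the Gaussian absorbs the polynomial: (c s / 2)^k <= k! e^(c s / 2) for s >= 0, which
    leaves a multiple of [gaussk (c / 2) 0]. *)
Lemma integrable_gaussk (c : R) k : 0 < c -> mu2.-integrable setT (EFin \o gaussk c k).
Proof.
move=> c0; have c20 : 0 < c / 2 by rewrite divr_gt0.
have i0 : mu2.-integrable setT (EFin \o gaussk (c / 2) 0).
  apply/integrableP; split.
    by apply: continuous_prod_emeasurable; exact: continuous_gaussk.
  rewrite (_ : (fun _ => _) = (fun z => (gaussk (c / 2) 0 z)%:E)).
    by rewrite integral_gaussk0 ?ltry.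
  by apply/funext => z /=; rewrite ger0_norm// gaussk_ge0.
apply: (le_integrable _ _ _ (integrableZl _ (k`!%:R * (2 / c) ^+ k) i0)) => //.
  by apply: continuous_prod_emeasurable; exact: continuous_gaussk.
move=> z _; rewrite /= lee_fin ger0_norm ?gaussk_ge0//.
rewrite ger0_norm; last first.
  by rewrite mulr_ge0 ?gaussk_ge0// mulr_ge0// exprn_ge0// divr_ge0// ltW.
rewrite /gaussk expr0 mul1r; set s := sqnorm2 z.
have s0 : 0 <= s := sqnorm2_ge0 z.
have cs0 : 0 <= c / 2 * s by rewrite mulr_ge0// ltW.
have E : expR (- (c * s)) = expR (- (c / 2 * s)) * expR (- (c / 2 * s)).
  by rewrite -expRD; congr expR; field.
rewrite E mulrA ler_pM2r ?expR_gt0// expRN ler_pdivrMr ?expR_gt0//.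
have H : (c / 2 * s) ^+ k <= k`!%:R * expR (c / 2 * s).
  case: k => [|k].
    by rewrite expr0 fact0 mul1r; apply: le_trans (expR_ge1Dx _); rewrite lerDl.
  rewrite [leRHS]mulrC -ler_pdivrMr ?ltr0n ?fact_gt0//.
  by apply: le_trans (expR_ge1Dxn k cs0); rewrite lerDr.
have -> : s ^+ k = (2 / c) ^+ k * (c / 2 * s) ^+ k.
  by rewrite -exprMn; congr (_ ^+ _); field; rewrite gt_eqF.
by rewrite (mulrC k`!%:R) -[leRHS]mulrA ler_pM2l// exprn_gt0// divr_gt0.
Qed.

Lemma is_derive_gaussk (x : R) k z :
  is_derive x 1 (fun c => gaussk c k z) (- gaussk x k.+1 z).
Proof.
have d : is_derive x 1 (fun c => - (c * sqnorm2 z)) (- sqnorm2 z).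
  by apply: is_derive_eq; rewrite /GRing.scale /=; ring.
have e := @is_derive1_comp R expR (fun c => - (c * sqnorm2 z)) x _ _ (is_derive_expR _) d.
rewrite (_ : (fun c => _) = (sqnorm2 z ^+ k) \*: (expR \o (fun c => - (c * sqnorm2 z)))).
  by apply: is_derive_eq; rewrite /gaussk /GRing.scale /= exprS; ring.
by apply/funext => c.
Qed.

Lemma is_derive_Rintegral_gaussk (c : R) k : 0 < c ->
  is_derive c 1 (fun x => \int[mu2]_z gaussk x k z)%R
    (- \int[mu2]_z gaussk c k.+1 z)%R.
Proof.
move=> c0; have c20 : 0 < c / 2 by rewrite divr_gt0.
(* On this neighbourhood of [c] the rate exceeds c / 2, hence [gaussk (c / 2) k.+1] bounds all the
   derivatives. *)
have cI : `]c / 2, 2 * c[%classic c by rewrite /= in_itv /=; apply/andP; split; lra.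
have E x z : partial1of2 (fun c z => gaussk c k z) x z = - gaussk x k.+1 z.
  by rewrite partial1of2E; apply: derive_val; exact: is_derive_gaussk.
have p x : `]c / 2, 2 * c[%classic x -> 0 < x.
  by rewrite /= in_itv /= => /andP[h _]; exact: lt_trans h.
have B x z : `]c / 2, 2 * c[%classic x -> setT z ->
    `|partial1of2 (fun c z => gaussk c k z) x z| <= gaussk (c / 2) k.+1 z.
  rewrite /= in_itv /= => /andP[h _] _.
  rewrite E normrN ger0_norm ?gaussk_ge0// /gaussk ler_wpM2l ?exprn_ge0 ?sqnorm2_ge0//.
  by rewrite ler_expR lerN2 ler_wpM2r ?sqnorm2_ge0// ltW.
have Hd := @derivable_under_integral R _ _ mu2 (fun c z => gaussk c k z) setT measurableT
  c (c / 2) (2 * c) cI (fun x xI => @integrable_gaussk x k (p x xI))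
  (fun x z _ _ => @ex_derive _ _ _ _ _ _ _ (is_derive_gaussk x k z))
  _ (gaussk_ge0 (c / 2) k.+1) (integrable_gaussk k.+1 c20) B.
have Hv := @differentiation_under_integral R _ _ mu2 (fun c z => gaussk c k z) setT measurableT
  c (c / 2) (2 * c) cI (fun x xI => @integrable_gaussk x k (p x xI))
  (fun x z _ _ => @ex_derive _ _ _ _ _ _ _ (is_derive_gaussk x k z))
  _ (gaussk_ge0 (c / 2) k.+1) (integrable_gaussk k.+1 c20) B.
apply: DeriveDef; first exact: Hd.
rewrite -derive1E Hv -mulN1r -RintegralZl//; last exact: integrable_gaussk.
by apply: eq_Rintegral => z _; rewrite E mulN1r.
Qed.

Lemma is_derive_invX (c : R) k : c != 0 ->
  is_derive c 1 (fun x : R => x ^- k.+1) (- (k.+1%:R * c ^- k.+2)).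
Proof.
move=> c0; have dX : is_derive c 1 (fun x : R => x ^+ k.+1) (k.+1%:R * c ^+ k).
  have := @is_deriveX R R^o id k.+1 c 1 1 (is_derive_id c 1).
  by rewrite /GRing.scale /= mulr1 exprfctE.
have ck : c ^+ k.+1 != 0 by rewrite expf_neq0.
have := @is_deriveV R (fun x : R => x ^+ k.+1) c _ _ ck dX.
move/is_derive_eq; apply.
rewrite /GRing.scale /= mulNr mulrCA; congr (- (_ * _)).
by rewrite !exprS; field; rewrite c0 expf_neq0.
Qed.

(** The moment of order k is differentiated in [c] twice over: under the integral sign, which raises
    the order, and through the closed form. The induction runs over all rates since the closed form
    is needed near [c]. *)
Lemma Rintegral_gaussk (c : R) k : 0 < c ->
  (\int[mu2]_z gaussk c k z)%R = pi * k`!%:R / c ^+ k.+1.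
Proof.
elim: k c => [|k IH] c c0.
  by rewrite /Rintegral integral_gaussk0//= mulr1 expr1.
have H1 := is_derive_Rintegral_gaussk k c0.
have H2 : is_derive c 1 (fun x => (\int[mu2]_z gaussk x k z)%R)
    (- (pi * k`!%:R * (k.+1%:R * c ^- k.+2))).
  have D : is_derive c 1 ((pi * k`!%:R) \*: (fun x : R => x ^- k.+1))
      ((pi * k`!%:R) *: (- (k.+1%:R * c ^- k.+2))).
    by apply: is_deriveZ; apply: is_derive_invX; rewrite gt_eqF.
  rewrite -mulrN; apply: near_eq_is_derive D.
  near=> x; rewrite IH//; near: x; exact: lt_nbhsr.
have := @derive_val _ _ _ _ _ _ _ H1; rewrite (@derive_val _ _ _ _ _ _ _ H2) => /oppr_inj <-.
rewrite factS natrM; ring.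
Unshelve. all: by end_near.
Qed.

End GaussianMoments.

(** * Averaging over rotations *)

Section RotationAverage.
Variable R : realType.
Local Notation C := R[i].
Local Notation mu := (@lebesgue_measure R).
Local Notation mu2 := (mu \x mu)%E.
Local Notation J := [set` `[0 : R, 2 * pi]].

Definition pt (z : R * R) : C := z.1 +i* z.2.

Lemma pt_mul_cis z (t : R) :
  pt z * cis t = pt (cos t * z.1 - sin t * z.2, sin t * z.1 + cos t * z.2).
Proof. by apply: complexP; rewrite cpartsE /=; ring. Qed.

Lemma sqnorm2_rotation z (t : R) :
  sqnorm2 (cos t * z.1 - sin t * z.2, sin t * z.1 + cos t * z.2) = sqnorm2 z.
Proof.
rewrite /sqnorm2 /=.
transitivity ((cos t ^+ 2 + sin t ^+ 2) * (z.1 ^+ 2 + z.2 ^+ 2)); first by ring.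
by rewrite cos2Dsin2 mul1r.
Qed.

Let plane_sigma_finite : sigma_finite setT mu2.
Proof.
exists (fun n => `]- (n%:R : R), n%:R[%classic `*` `]- (n%:R : R), n%:R[%classic).
  apply/esym; rewrite -subTset => -[x y] _.
  have bnd (a : R) : `|a| < (Num.truncn `|a|).+1%:R by exact: truncnS_gt.
  exists (maxn (Num.truncn `|x|).+1 (Num.truncn `|y|).+1) => //.
  split; rewrite /= in_itv /= -ltr_norml.
    by apply: lt_le_trans (bnd x) _; rewrite ler_nat leq_maxl.
  by apply: lt_le_trans (bnd y) _; rewrite ler_nat leq_maxr.
move=> n; split; first by apply: measurableX; exact: measurable_itv.
rewrite product_measure1E ?measurable_itv//= lebesgue_measure_itv /= lte_fin.
by case: ifP => _; rewrite ?mule0 ?mul0e// -EFinD -EFinM ltry.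
Qed.

Lemma fubini_plane_line (F : (R * R) * R -> \bar R) : measurable_fun setT F ->
  (\int[mu]_t \int[mu2]_z `|F (z, t)| < +oo)%E ->
  (\int[mu2]_z \int[mu]_t F (z, t) = \int[mu]_t \int[mu2]_z F (z, t))%E.
Proof.
move=> mF iF.
pose M : {sigma_finite_measure set _ -> \bar R} :=
  HB.pack mu2 (Measure_isSigmaFinite.Build _ _ _ mu2 plane_sigma_finite).
exact: (@Fubini _ _ _ _ R M mu F ((@integrable21ltyP _ _ _ _ R M mu F mF).2 iF)).
Qed.

Let pi2_gt0 : (0 : R) < 2 * pi. Proof. by rewrite mulr_gt0// pi_gt0. Qed.

Let integral_indic_cst (c : R) :
  (\int[mu]_t (\1_J t * c)%:E = (2 * pi * c)%:E)%E.
Proof.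
have -> : (\int[mu]_t (\1_J t * c)%:E = \int[mu]_(t in J) cst c%:E t)%E.
  rewrite [RHS]integral_mkcond; apply: eq_integral => t _.
  by rewrite patchE indicE; case: ifP; rewrite ?mul1r ?mul0r.
rewrite integral_cst//= lebesgue_measure_itv/= lte_fin pi2_gt0 -EFinM.
by congr EFin; ring.
Qed.

(** A substitute for polar coordinates. The function is composed with the rotation of angle t and
    integrated over the plane and over t: the plane integral does not depend on t by invariance,
    while the integral over t is the circle mean given by hypothesis. Fubini's theorem equates the
    two. *)
Lemma rotation_average (k m : R -> R) (u : C -> R) (u0 : R) :
  continuous k -> continuous (u \o pt) ->
  (forall z, (\int[mu]_(t in J) u (z * cis t))%R
      = 2 * pi * (m (Re z ^+ 2 + Im z ^+ 2) * u0)) ->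
  mu2.-integrable setT (fun z => (k (sqnorm2 z) * u (pt z))%:E) ->
  mu2.-integrable setT (fun z => (k (sqnorm2 z) * m (sqnorm2 z))%:E) ->
  (\int[mu2]_z (k (sqnorm2 z) * u (pt z)) =
    u0 * \int[mu2]_z (k (sqnorm2 z) * m (sqnorm2 z)))%R.
Proof.
move=> ck cu hu iG ikm.
pose G z := k (sqnorm2 z) * u (pt z).
have cks : continuous (k \o @sqnorm2 R).
  by move=> z; apply: continuous_comp; [exact: continuous_sqnorm2|exact: ck].
have cG : continuous G by move=> z; apply: cvgM; [exact: cks|exact: cu].
pose rot (t : R) (z : R * R) := (cos t * z.1 - sin t * z.2, sin t * z.1 + cos t * z.2).
have prot t : preserves2 (rot t) by apply: preserves2_rotation; exact: cos2Dsin2.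
(* The indicator confines the angle to one period while both integrals run over whole spaces, as
   Fubini's theorem is stated. *)
pose F (p : (R * R) * R) : \bar R := (\1_J p.2 * G (rot p.2 p.1))%:E.
have mF : measurable_fun setT F.
  apply/measurable_EFinP; apply: measurable_funM.
    by apply: measurableT_comp => //; exact: measurable_indic.
  apply: (measurableT_comp (f := G) (g := fun p : (R * R) * R => rot p.2 p.1)).
    exact: continuous_prod_measurable.
  have mc : measurable_fun setT (fun p : (R * R) * R => cos p.2).
    by apply: measurableT_comp => //; apply: continuous_measurable_fun; exact: continuous_cos.
  have ms : measurable_fun setT (fun p : (R * R) * R => sin p.2).
    by apply: measurableT_comp => //; apply: continuous_measurable_fun; exact: continuous_sin.
  have m1 : measurable_fun setT (fun p : (R * R) * R => p.1.1).
    by apply: measurableT_comp => //.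
  have m2 : measurable_fun setT (fun p : (R * R) * R => p.1.2).
    by apply: measurableT_comp => //.
  apply: measurable_fun_pair.
    by apply: measurable_funB; apply: measurable_funM.
  by apply: measurable_funD; apply: measurable_funM.
have aG t : (\int[mu2]_z (`|G (rot t z)|)%:E = \int[mu2]_z (`|G z|)%:E)%E.
  apply: ((prot t).2 (fun z => `|G z|)) => // z.
  by apply: cvg_norm; exact: cG.
pose A := (\int[mu2]_z `|G z|)%R.
have AE : (\int[mu2]_z (`|G z|)%:E = A%:E)%E.
  rewrite /A /Rintegral fineK//.
  by apply: integrable_fin_num => //; exact: (integrable_norm iG).
have iF : (\int[mu]_t \int[mu2]_z `|F (z, t)| < +oo)%E.
  rewrite (_ : (fun t => _) = (fun t => (\1_J t * A)%:E)).
    by rewrite integral_indic_cst ltry.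
  apply/funext => t.
  transitivity (\int[mu2]_z ((\1_J t)%:E * (`|G (rot t z)|)%:E))%E.
    apply: eq_integral => z _.
    by rewrite /F /= normrM EFinM ger0_norm// indicE.
  rewrite ge0_integralZl_EFin//= ?aG ?AE// ?indicE//.
  apply/measurable_EFinP; apply: (measurableT_comp (f := fun x : R => `|x|)) => //.
  apply: continuous_prod_measurable => z.
  by apply: (continuous_comp (f := rot t)); [exact: (prot t).1|exact: cG].
have := fubini_plane_line mF iF.
have -> : (\int[mu2]_z \int[mu]_t F (z, t) =
    \int[mu2]_z (2 * pi * u0 * (k (sqnorm2 z) * m (sqnorm2 z)))%:E)%E.
  apply: eq_integral => z _.
  transitivity (\int[mu]_(t in J) (k (sqnorm2 z) * u (pt z * cis t))%:E)%E.
    rewrite [RHS]integral_mkcond; apply: eq_integral => t _.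
    rewrite patchE /F /= indicE /G sqnorm2_rotation -pt_mul_cis.
    by case: ifP; rewrite ?mul1r ?mul0r.
  have ct : continuous (fun t => u (pt z * cis t)).
    move=> t; rewrite (_ : (fun _ => _) = (u \o pt) \o (fun t => rot t z)).
      apply: continuous_comp; last exact: cu.
      apply: cvg_pair_nbhs.
        by apply: cvgB; apply: cvgM; try exact: cvg_cst;
          [exact: continuous_cos|exact: continuous_sin].
      by apply: cvgD; apply: cvgM; try exact: cvg_cst;
        [exact: continuous_sin|exact: continuous_cos].
    by apply/funext => s; rewrite /= pt_mul_cis.
  have it := integrable_circle ct.
  have : (\int[mu]_(t in J) (k (sqnorm2 z) * u (pt z * cis t)) =
      k (sqnorm2 z) * \int[mu]_(t in J) u (pt z * cis t))%R by rewrite RintegralZl.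
  rewrite hu /Rintegral => E.
  rewrite -[LHS]fineK.
    by rewrite E /sqnorm2 /=; congr EFin; ring.
  apply: integrable_fin_num => //.
  by apply: (integrable_circle (f := fun t => k (sqnorm2 z) * u (pt z * cis t))) => t;
    apply: cvgM; [exact: cvg_cst|exact: ct].
have -> : (\int[mu]_t \int[mu2]_z F (z, t) =
    \int[mu]_t (\1_J t * \int[mu2]_z G z)%:E)%E.
  apply: eq_integral => t _.
  have [i1 e1] := preserves2_integrable (prot t) cG iG.
  rewrite -e1 -RintegralZl// /Rintegral fineK//.
  apply: integrable_fin_num => //.
  rewrite (_ : (fun z => _) = (fun z => (\1_J t)%:E * (G (rot t z))%:E)%E).
    exact: integrableZl.
  by apply/funext => z; rewrite EFinM.
rewrite integral_indic_cst => /(congr1 fine) /=.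
rewrite -/(Rintegral mu2 setT (fun z => 2 * pi * u0 * (k (sqnorm2 z) * m (sqnorm2 z)))%R).
rewrite RintegralZl// -mulrA => /mulfI <- //.
by rewrite gt_eqF.
Qed.

End RotationAverage.

(** * The complex polyanalytic kernel *)

Section Laguerre.

Definition laguerre (F : fieldType) (n : nat) (x : F) : F :=
  \sum_(i < n.+1) (-1) ^+ i * 'C(n, n - i)%:R * (1 / i`!%:R) * x ^+ i.

(** Pascal's rule and a shift of index trade one binomial order for one finite difference of [f]. *)
Lemma sum_sign_binS (R : comRingType) n (f : nat -> R) :
  \sum_(i < n.+2) (-1) ^+ i * 'C(n.+1, i)%:R * f i =
  \sum_(i < n.+1) (-1) ^+ i * 'C(n, i)%:R * (f i - f i.+1).
Proof.
rewrite big_ord_recl /= expr0 bin0 !mul1r.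
under eq_bigr => i _ do
  rewrite /bump /= add1n binS natrD mulrDr mulrDl exprS !mulN1r !mulNr.
under [RHS]eq_bigr => i _ do rewrite mulrBr.
rewrite big_split /= sumrB -sumrN.
rewrite [in RHS]big_ord_recl /= expr0 bin0 !mul1r [X in _ + (X + _)]big_ord_recr /=.
rewrite bin_small// mulr0 mul0r oppr0 addr0 addrA; congr (_ + _ + _).
by apply: eq_bigr => i _; rewrite /bump /= add1n exprS mulN1r !mulNr.
Qed.

(** An n-fold finite difference of i -> C(i + a, j). Each difference lowers j by one and changes the
    sign, so nothing survives when j < n. *)
Lemma sum_sign_bin (R : comRingType) n a j :
  \sum_(i < n.+1) (-1) ^+ i * 'C(n, i)%:R * 'C(i + a, j)%:R =
  (if (n <= j)%N then (-1) ^+ n * 'C(a, j - n)%:R else 0) :> R.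
Proof.
elim: n j => [|n IH] j; first by rewrite big_ord1 expr0 bin0 !mul1r leq0n add0n subn0.
rewrite (sum_sign_binS n (fun i => 'C(i + a, j)%:R)).
case: j => [|j].
  by rewrite big1 // => i _; rewrite !bin0 subrr mulr0.
have E (i : nat) : 'C(i + a, j.+1)%:R - 'C(i.+1 + a, j.+1)%:R = - 'C(i + a, j)%:R :> R.
  by rewrite addSn binS natrD; ring.
under eq_bigr => i _ do rewrite E mulrN.
by rewrite sumrN IH ltnS subSS; case: ifP; rewrite ?oppr0// exprS mulN1r mulNr.
Qed.

(** This is the integral of L_n(x)^2 e^(-x) over the half-line, (i + j)! being the moment of order i
    + j. Writing (i + j)! / (i! j!) as C(i + j, j) makes the sum over i a finite difference that
    vanishes for j < n, and only j = n contributes. *)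
Lemma sum_laguerre_coef (R : numFieldType) n :
  \sum_(i < n.+1) \sum_(j < n.+1)
    ((-1) ^+ i * 'C(n, n - i)%:R * (1 / i`!%:R)) *
    ((-1) ^+ j * 'C(n, n - j)%:R * (1 / j`!%:R)) * (i + j)`!%:R = 1 :> R.
Proof.
have f0 k : k`!%:R != 0 :> R by rewrite pnatr_eq0 -lt0n fact_gt0.
transitivity (\sum_(j < n.+1) (-1) ^+ j * 'C(n, j)%:R *
    \sum_(i < n.+1) (-1) ^+ i * 'C(n, i)%:R * 'C(i + j, j)%:R : R).
  rewrite exchange_big /=; apply: eq_bigr => j _; rewrite big_distrr /=.
  apply: eq_bigr => i _.
  have hi : (i <= n)%N by rewrite -ltnS.
  have hj : (j <= n)%N by rewrite -ltnS.
  rewrite (bin_sub hi) (bin_sub hj).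
  have -> : (i + j)`!%:R = 'C(i + j, j)%:R * (j`!%:R * i`!%:R) :> R.
    by rewrite -!natrM -(bin_fact (leq_addl i j)) addnK.
  by field; rewrite !f0.
rewrite big_ord_recr /= big1 ?add0r.
  rewrite sum_sign_bin leqnn subnn bin0 binn !mulr1 -exprD addnn -mul2n exprM.
  by rewrite sqrrN !expr1n.
move=> j _; rewrite sum_sign_bin leqNgt ltn_ord mulr0//.
Qed.

Lemma rmorph_laguerre (F G : fieldType) (h : {rmorphism F -> G}) n x :
  h (laguerre n x) = laguerre n (h x).
Proof.
rewrite rmorph_sum; apply: eq_bigr => i _.
by rewrite !rmorphM !rmorphXn rmorphN1 fmorphV !rmorph_nat rmorph1.
Qed.

End Laguerre.

(** * The operator (d/dz - 2 pi z^* )^n *)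

Section FockOperator.
Variable R : realType.
Local Notation C := R[i].
Implicit Types (s t w z : C) (D : nat -> C -> C).

Let twopi : C := (2 * pi)%:C.

(* For a tower [D k = H^(k)], [iter n (shift_op s) D 0 z] is (d/dz + s)^n H at z
   with s held constant. *)
Definition shift_op s D : nat -> C -> C := fun k z => D k.+1 z + s * D k z.

(** Since d/dz annihilates z^*, the power of the operator may be evaluated with - 2 pi z^* frozen at
    its value at [z]. The operator thereby acts on towers of holomorphic functions although its
    result is not holomorphic. *)
Definition fock_op n D z := iter n (shift_op (- twopi * z^*)) D 0 z.

Lemma shift_opC s t D : shift_op s (shift_op t D) = shift_op t (shift_op s D).
Proof. by apply/funext => k; apply/funext => z; rewrite /shift_op; ring. Qed.

Lemma iter_shift_opC n s t D :
  iter n (shift_op t) (shift_op s D) = shift_op s (iter n (shift_op t) D).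
Proof. by elim: n => //= n ->; rewrite shift_opC. Qed.

Lemma iter_shift_opE n s D k z : iter n (shift_op s) D k z =
  \sum_(j < n.+1) 'C(n, j)%:R * s ^+ j * D (n - j + k)%N z.
Proof.
elim: n k => [|n IH] k; first by rewrite big_ord1 bin0 expr0 !mul1r.
rewrite iterS {1}/shift_op !IH [RHS]big_ord_recl /= bin0 expr0 !mul1r subn0.
under [X in _ = _ + X]eq_bigr => j _ do rewrite /bump /= add1n binS natrD !mulrDl subSS.
rewrite big_split /= addrA; congr (_ + _).
  rewrite big_ord_recl /= bin0 expr0 !mul1r subn0 addnS addSn; congr (_ + _).
  rewrite [RHS]big_ord_recr /= bin_small// !mul0r addr0.
  apply: eq_bigr => j _; rewrite /bump /= add1n; congr (_ * D _ z).
  by rewrite addnS -addSn -subSn// subSS.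
rewrite mulr_sumr; apply: eq_bigr => j _.
by rewrite exprS; ring.
Qed.

(* The tower of z |-> e^(t z) H(z + w). *)
Definition weyl t w D : nat -> C -> C :=
  fun k z => cexp (t * z) * iter k (shift_op t) D 0 (z + w).

(** Differentiating the factor e^(t z) adds [t] to the constant [s]. *)
Lemma shift_op_weyl s t w D : shift_op s (weyl t w D) = weyl t w (shift_op (s + t) D).
Proof.
apply/funext => k; apply/funext => z.
rewrite /weyl iter_shift_opC [LHS]/shift_op iterS.
set Y := iter k _ D; rewrite /shift_op; ring.
Qed.

Lemma iter_shift_op_weyl n s t w D :
  iter n (shift_op s) (weyl t w D) = weyl t w (iter n (shift_op (s + t)) D).
Proof. by elim: n => //= n ->; rewrite shift_op_weyl. Qed.

(** For t = - 2 pi w^*, the shifted constant - 2 pi z^* + t is - 2 pi (z + w)^*, precisely the one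
    that [fock_op] freezes at the translated point. *)
Lemma fock_op_weyl n w D z :
  fock_op n (weyl (- twopi * w^*) w D) z = cexp (- twopi * w^* * z) * fock_op n D (z + w).
Proof.
rewrite /fock_op iter_shift_op_weyl /weyl /= rmorphD mulrDr.
by rewrite [X in iter _ (shift_op X)]addrC.
Qed.

Lemma tower_shift_op s D : tower D -> tower (shift_op s D).
Proof. by move=> hD k; apply: holoD; [exact: hD|apply: holoZ; exact: hD]. Qed.

Lemma tower_iter_shift_op n s D : tower D -> tower (iter n (shift_op s) D).
Proof. by move=> hD; elim: n => //= n; exact: tower_shift_op. Qed.

Lemma tower_weyl t w D : tower D -> tower (weyl t w D).
Proof.
move=> hD k.
have hk := holo_shift w (tower_iter_shift_op k t hD 0).
apply: (holo_eq (holoM (holo_cexp t) hk)).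
apply/funext => z; rewrite /weyl iterS.
set Y := iter k _ D; rewrite /shift_op; ring.
Qed.

Lemma ccont_fock_op n D : tower D -> ccont (fock_op n D).
Proof.
move=> hD.
have -> : fock_op n D = (fun z => \sum_(j < n.+1) 'C(n, j)%:R * (- twopi * z^*) ^+ j * D (n - j)%N z).
  apply/funext => z; rewrite /fock_op iter_shift_opE.
  by apply: eq_bigr => j _; rewrite addn0.
apply: tcont_sum => j _; apply: tcontM; last by have [] := hD (n - j)%N.
apply: tcontM; first exact: tcont_cst.
apply: tcontX; apply: tcontM; first exact: tcont_cst.
exact: ccont_conj.
Qed.

Definition normsq z : R := Re z ^+ 2 + Im z ^+ 2.

Lemma normsqE z : z^* * z = (normsq z)%:C.
Proof. by apply: complexP; rewrite cpartsE /normsq; case: z => a b /=; ring. Qed.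

(** In the binomial expansion the term of index j carries e^(-ijt) H^(n-j), so its integral extracts
    the j-th Taylor coefficient of H^(n-j). By [circle_coef] this is always a multiple of H^(n)(0),
    which is [fock_op n D 0], and the factors C(n, j) (- 2 pi |z|^2)^j / j! are the terms of L_n. *)
Lemma circle_fock_op n D z : tower D ->
  cint (fun t : R => fock_op n D (z * cis t)) =
  (2 * pi * laguerre n (2 * pi * normsq z))%:C * fock_op n D 0.
Proof.
move=> hD.
have f0 : fock_op n D 0 = D n 0.
  rewrite /fock_op iter_shift_opE big_ord_recl bin0 expr0 !mul1r subn0 addn0.
  by rewrite big1 ?addr0// => j _; rewrite rmorph0 mulr0 exprS mul0r mulr0 mul0r.
have tcc j : tcont (fun t : R => D j (z * cis t) * (cis t)^* ^+ (n - j)).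
  apply: tcontM.
    have [c0 _ _] := hD j.
    have := tcont_circle1 z 0 c0; congr tcont.
    by apply/funext => t; rewrite add0r.
  apply: tcontX; apply: tcont_conj; apply: tcont_cis => t; exact: cvg_id.
have tcc' (j : 'I_n.+1) : tcont (fun t : R => D (n - j)%N (z * cis t) * (cis t)^* ^+ j).
  by have := tcc (n - j)%N; rewrite subKn// -ltnS.
transitivity (cint (fun t : R => \sum_(j < n.+1) ('C(n, j)%:R * (- twopi * z^*) ^+ j) *
   (D (n - j)%N (z * cis t) * (cis t)^* ^+ j))).
  congr cint; apply/funext => t; rewrite /fock_op iter_shift_opE.
  apply: eq_bigr => j _; rewrite addn0 rmorphM mulrA !exprMn; ring.
rewrite cint_sum; last by move=> j _; apply: tcontM; [exact: tcont_cst|exact: tcc'].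
have -> : (2 * pi * laguerre n (2 * pi * normsq z))%:C =
    twopi * laguerre n (twopi * (z^* * z)).
  rewrite normsqE /twopi (rmorphM (real_complex R) (2 * pi)) rmorph_laguerre.
  by rewrite (rmorphM (real_complex R) (2 * pi)).
rewrite f0.
rewrite /laguerre -mulrA mulr_suml mulr_sumr.
apply: eq_bigr => j _; rewrite cintZ//.
have H := circle_coef (n - j) j z 0 hD.
have jn : (j <= n)%N by rewrite -ltnS.
rewrite subnK// in H.
have fj : j`!%:R != 0 :> C by rewrite pnatr_eq0 -lt0n fact_gt0.
have -> : cint (fun t : R => D (n - j)%N (z * cis t) * (cis t)^* ^+ j) =
    (j`!%:R)^-1 * (twopi * z ^+ j * D n 0).
  apply: (mulfI fj); rewrite mulVKf// -H; congr (_ * cint _).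
  by apply/funext => t; rewrite add0r.
rewrite bin_sub// !exprMn (exprNn twopi); field.
exact: fj.
Qed.

End FockOperator.

(** * Weighted square-integrability and the complex reproducing property *)

Section WeightedL2.
Variable R : realType.
Local Notation C := R[i].
Local Notation mu := (@lebesgue_measure R).
Local Notation mu2 := (mu \x mu)%E.
Implicit Types (u v : R * R -> R) (w : C).

Let twopi : C := (2 * pi)%:C.
Let pi2_gt0 : (0 : R) < 2 * pi. Proof. by rewrite mulr_gt0// pi_gt0. Qed.

Definition gauss_weight : R * R -> R := fun z => expR (- (2 * pi * sqnorm2 z)).

Lemma gauss_weightE : gauss_weight = gaussk (2 * pi) 0.
Proof. by apply/funext => z; rewrite /gaussk expr0 mul1r. Qed.

Lemma gauss_weight_ge0 z : 0 <= gauss_weight z.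
Proof. exact: expR_ge0. Qed.

Lemma continuous_gauss_weight : continuous gauss_weight.
Proof. rewrite gauss_weightE; exact: continuous_gaussk. Qed.

Definition weighted_l2 u : Prop :=
  continuous u /\ mu2.-integrable setT (fun z => (u z ^+ 2 * gauss_weight z)%:E).

Lemma le_integrable_continuous u v : continuous u -> (forall z, `|u z| <= v z) ->
  mu2.-integrable setT (fun z => (v z)%:E) -> mu2.-integrable setT (fun z => (u z)%:E).
Proof.
move=> cu uv iv; apply: le_integrable iv => //.
  exact: continuous_prod_emeasurable.
by move=> z _ /=; rewrite lee_fin (le_trans (uv z))// ler_norm.
Qed.

Lemma integrableD_real u v : mu2.-integrable setT (fun z => (u z)%:E) ->
  mu2.-integrable setT (fun z => (v z)%:E) -> mu2.-integrable setT (fun z => (u z + v z)%:E).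
Proof. by move=> iu iv; exact: (integrableD measurableT iu iv). Qed.

Lemma integrableZ_real (c : R) u : mu2.-integrable setT (fun z => (u z)%:E) ->
  mu2.-integrable setT (fun z => (c * u z)%:E).
Proof. by move=> iu; exact: (integrableZl measurableT c iu). Qed.

Lemma weighted_l2M u v : weighted_l2 u -> weighted_l2 v ->
  mu2.-integrable setT (fun z => (u z * v z * gauss_weight z)%:E).
Proof.
move=> [cu iu] [cv iv].
apply: le_integrable_continuous (integrableD_real iu iv).
  move=> z; apply: cvgM; last exact: continuous_gauss_weight.
  by apply: cvgM; [exact: cu|exact: cv].
move=> z; rewrite normrM (ger0_norm (gauss_weight_ge0 z)) -mulrDl.
rewrite ler_wpM2r ?gauss_weight_ge0// normrM -[u z ^+ 2]real_normK ?num_real// -[v z ^+ 2]real_normK ?num_real//.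
have := sqr_ge0 (`|u z| - `|v z|); have := mulr_ge0 (normr_ge0 (u z)) (normr_ge0 (v z)).
by rewrite sqrrB; nra.
Qed.

Lemma weighted_l2D u v : weighted_l2 u -> weighted_l2 v -> weighted_l2 (fun z => u z + v z).
Proof.
move=> hu hv; have iuv := weighted_l2M hu hv.
case: hu hv => cu iu [cv iv]; split.
  by move=> z; apply: cvgD; [exact: cu|exact: cv].
rewrite (_ : (fun z => _) = (fun z => ((u z ^+ 2 * gauss_weight z + v z ^+ 2 * gauss_weight z)
   + 2 * (u z * v z * gauss_weight z))%:E)).
  by apply: integrableD_real; [exact: integrableD_real|exact: integrableZ_real].
by apply/funext => z; congr EFin; ring.
Qed.

Lemma weighted_l2Z (c : R) u : weighted_l2 u -> weighted_l2 (fun z => c * u z).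
Proof.
move=> [cu iu]; split.
  by move=> z; apply: cvgM; [exact: cvg_cst|exact: cu].
rewrite (_ : (fun z => _) = (fun z => (c ^+ 2 * (u z ^+ 2 * gauss_weight z))%:E)).
  exact: integrableZ_real.
by apply/funext => z; congr EFin; ring.
Qed.

Lemma weighted_l2_reflect u : weighted_l2 u -> weighted_l2 (fun z => u (z.1, - z.2)).
Proof.
move=> [cu iu]; split.
  by move=> z; apply: (continuous_comp (f := fun z => (z.1, - z.2)));
    [exact: (preserves2_reflect R).1|exact: cu].
have cG : continuous (fun z => u z ^+ 2 * gauss_weight z).
  move=> z; apply: cvgM; last exact: continuous_gauss_weight.
  by rewrite expr2; apply: cvgM; exact: cu.
have [+ _] := preserves2_integrable (preserves2_reflect R) cG iu.
congr (_.-integrable _ _); apply/funext => z.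
by rewrite /gauss_weight /sqnorm2 /= sqrrN.
Qed.

Lemma Rintegral_sum (I : Type) (r : seq I) (F : I -> R * R -> R) :
  (forall i, mu2.-integrable setT (fun z => (F i z)%:E)) ->
  mu2.-integrable setT (fun z => (\sum_(i <- r) F i z)%:E) /\
  (\int[mu2]_z (\sum_(i <- r) F i z) = \sum_(i <- r) \int[mu2]_z F i z)%R.
Proof.
move=> hF; elim: r => [|i r [IH1 IH2]].
  under eq_fun do rewrite big_nil; split; first exact: integrable0.
  by rewrite big_nil; under eq_Rintegral do rewrite big_nil; rewrite Rintegral_cst// mul0r.
under eq_fun do rewrite big_cons; split; first exact: integrableD_real.
under eq_Rintegral do rewrite big_cons.
by rewrite (RintegralD measurableT (hF i) IH1) big_cons; congr (_ + _).
Qed.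

(** The kernel for w = 0 times the Gaussian weight, as a function of s = |z|^2. *)
Definition laguerre_gauss n (s : R) : R :=
  2 * laguerre n (2 * pi * s) * expR (- (2 * pi * s)).

(** The moment of order i + j at rate 2 pi is pi (i + j)! / (2 pi)^(i + j + 1). The powers of 2 pi
    cancel against those from the argument of L_n, and the remaining pi / (2 pi) explains the
    constant 2 of the kernel; [sum_laguerre_coef] does the rest. *)
Lemma laguerre_normalized n :
  mu2.-integrable setT
    (fun z => (laguerre_gauss n (sqnorm2 z) * laguerre n (2 * pi * sqnorm2 z))%:E) /\
  (\int[mu2]_z (laguerre_gauss n (sqnorm2 z) * laguerre n (2 * pi * sqnorm2 z)) = 1)%R.
Proof.
pose c i : R := (-1) ^+ i * 'C(n, n - i)%:R * (1 / i`!%:R).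
pose F (i j : 'I_n.+1) z := (2 * (c i * c j) * (2 * pi) ^+ (i + j)) * gaussk (2 * pi) (i + j) z.
have iF i j : mu2.-integrable setT (fun z => (F i j z)%:E).
  by apply: integrableZ_real; exact: integrable_gaussk.
have E : (fun z => laguerre_gauss n (sqnorm2 z) * laguerre n (2 * pi * sqnorm2 z)) =
    (fun z => \sum_(i < n.+1) \sum_(j < n.+1) F i j z).
  apply/funext => z; rewrite /laguerre_gauss.
  transitivity (laguerre n (2 * pi * sqnorm2 z) * laguerre n (2 * pi * sqnorm2 z) *
    (2 * expR (- (2 * pi * sqnorm2 z)))); first by ring.
  rewrite {1}/laguerre !mulr_suml; apply: eq_bigr => i _.
  rewrite /laguerre mulr_sumr mulr_suml; apply: eq_bigr => j _.
  rewrite /F /gaussk -/(c i) -/(c j) !exprMn !exprD; ring.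
have S j := Rintegral_sum (index_enum 'I_n.+1) (iF j).
have [S1 S2] := Rintegral_sum (index_enum 'I_n.+1) (fun j => (S j).1).
split; first by move: S1; rewrite -(funext (fun z => congr1 EFin (congr1 (@^~ z) E))).
rewrite E S2 -[RHS](sum_laguerre_coef R n); apply: eq_bigr => i _.
rewrite (S i).2; apply: eq_bigr => j _.
rewrite /F RintegralZl//; last exact: integrable_gaussk.
rewrite Rintegral_gaussk// exprS -/(c i) -/(c j).
have p0 : (pi : R) != 0 by rewrite gt_eqF// pi_gt0.
have p1 : (2 * pi : R) ^+ (i + j) != 0 by rewrite expf_neq0// gt_eqF.
move: (pi : R) p0 p1 => p p0 p1; field; rewrite p1; exact: p0.
Qed.

Definition fock_kernel_complex n w : C -> C := fun z =>
  2 * cexp (twopi * z * w^*) * (laguerre n (2 * pi * normsq (z - w)))%:C.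

(** The exponents 2 pi (z + w)^* w and - 2 pi (z + w)^* (z + w) add up to - 2 pi |z|^2 - 2 pi w^* z.
    The second part is the exponential that appears in [fock_op_weyl]. *)
Lemma fock_kernel_complex_shift n w (z : C) :
  (fock_kernel_complex n w (z + w))^* * (expR (- (2 * pi * normsq (z + w))))%:C =
  (laguerre_gauss n (normsq z))%:C * cexp (- twopi * w^* * z).
Proof.
have rc (x y : R) : (x * y)%:C = x%:C * y%:C by exact: (rmorphM (real_complex R)).
have rn (x : R) : (- x)%:C = - x%:C by exact: (rmorphN (real_complex R)).
have r2 : (2 : R)%:C = 2 by exact: (rmorph_nat (real_complex R) 2).
have cr (x : R) : (x%:C)^* = x%:C :> C by apply: complexP => //=; rewrite oppr0.
have c2 : (2 : C)^* = 2 by rewrite -r2 cr.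
have cM (a b : C) : (a * b)^* = a^* * b^* by exact: rmorphM.
have cD (a b : C) : (a + b)^* = a^* + b^* by exact: rmorphD.
rewrite /fock_kernel_complex addrK /laguerre_gauss !cM cr c2 cexp_conj !cM conjcK !cr cD.
rewrite /twopi !(rc, r2) -!cexp_real !(rn, rc) -!normsqE cD r2.
transitivity (2 * (laguerre n (2 * pi * normsq z))%:C *
  (cexp (2 * pi%:C * (z^* + w^*) * w) * cexp (- (2 * pi%:C * ((z^* + w^*) * (z + w)))))).
  by ring.
rewrite -cexpD.
transitivity (2 * (laguerre n (2 * pi * normsq z))%:C *
  (cexp (- (2 * pi%:C * (z^* * z))) * cexp (- (2 * pi%:C) * w^* * z))).
  by rewrite -cexpD; congr (_ * cexp _); ring.
by ring.
Qed.

Lemma normsqM (a b : C) : normsq (a * b) = normsq a * normsq b.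
Proof. by rewrite /normsq !cpartsE; ring. Qed.

Lemma normsq_cexp (a : C) : normsq (cexp a) = expR (2 * Re a).
Proof.
rewrite /normsq /= !exprMn -mulrDr cos2Dsin2 mulr1 expr2 -expRD; congr expR; ring.
Qed.

Lemma ccont_fock_kernel_complex n w : ccont (fock_kernel_complex n w).
Proof.
rewrite /fock_kernel_complex; apply: tcontM.
  apply: tcontM; first exact: tcont_cst.
  apply: (tcont_comp (@ccont_cexp R)); apply: tcontM; last exact: tcont_cst.
  by apply: tcontM; [exact: tcont_cst|exact: ccont_id].
have -> : (fun z : R * R => (laguerre n (2 * pi * normsq (z.1 +i* z.2 - w)))%:C) =
   (fun z => laguerre n (twopi * ((z.1 +i* z.2 - w)^* * (z.1 +i* z.2 - w)))).
  apply/funext => z; rewrite normsqE /twopi -(rmorphM (real_complex R)).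
  by rewrite -(rmorph_laguerre (real_complex R)).
have cd : tcont (fun z : R * R => z.1 +i* z.2 - w).
  by apply: tcontD; [exact: ccont_id|exact: tcont_cst].
rewrite /laguerre; apply: tcont_sum => j _; apply: tcontM; first exact: tcont_cst.
apply: tcontX; apply: tcontM; first exact: tcont_cst.
by apply: tcontM => //; apply: tcont_conj.
Qed.

Definition shift2 w : R * R -> R * R := fun z => (z.1 + Re w, z.2 + Im w).

Lemma pt_shift2 w z : pt (shift2 w z) = pt z + w.
Proof. by case: w => a b. Qed.

Lemma sqnorm2_shift2 w z : sqnorm2 (shift2 w z) = normsq (pt z + w).
Proof. by case: w => a b. Qed.

Lemma tcont_normsq (U : R * R -> C) : tcont U -> continuous (fun z => normsq (U z)).
Proof.
move=> [c0 c1] z; rewrite /normsq; apply: cvgD.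
  by rewrite expr2; apply: cvgM; exact: c0.
by rewrite expr2; apply: cvgM; exact: c1.
Qed.

Lemma weighted_l2_of_normsq (U : R * R -> C) : tcont U ->
  mu2.-integrable setT (fun z => (normsq (U z) * gauss_weight z)%:E) ->
  weighted_l2 (fun z => Re (U z)) /\ weighted_l2 (fun z => Im (U z)).
Proof.
move=> [c0 c1] iU.
have cg (h : R * R -> R) : continuous h -> continuous (fun z => h z ^+ 2 * gauss_weight z).
  move=> ch z; apply: cvgM; last exact: continuous_gauss_weight.
  by rewrite expr2; apply: cvgM; exact: ch.
split; split => //; apply: le_integrable_continuous iU; try exact: cg.
- move=> z; rewrite ger0_norm; last by apply: mulr_ge0; [exact: sqr_ge0|exact: gauss_weight_ge0].
  by rewrite ler_wpM2r ?gauss_weight_ge0// /normsq lerDl sqr_ge0.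
- move=> z; rewrite ger0_norm; last by apply: mulr_ge0; [exact: sqr_ge0|exact: gauss_weight_ge0].
  by rewrite ler_wpM2r ?gauss_weight_ge0// /normsq lerDr sqr_ge0.
Qed.

(** Completing the square turns |K|^2 e^(- 2 pi |z|^2) into the translate by w of 2 e^(2 pi |w|^2)
    times the integrand of [laguerre_normalized], so integrability comes from translation
    invariance. *)
Lemma weighted_l2_fock_kernel_complex n w :
  weighted_l2 (fun z => Re (fock_kernel_complex n w (pt z))) /\
  weighted_l2 (fun z => Im (fock_kernel_complex n w (pt z))).
Proof.
apply: (weighted_l2_of_normsq (U := fun z => fock_kernel_complex n w (pt z))).
  exact: ccont_fock_kernel_complex.
have [i1 _] := laguerre_normalized n.
have i2 := integrableZ_real (2 * expR (2 * pi * normsq w)) i1.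
pose G z := 2 * expR (2 * pi * normsq w) *
   (laguerre_gauss n (sqnorm2 z) * laguerre n (2 * pi * sqnorm2 z)).
have GE : (fun z => normsq (fock_kernel_complex n w (pt z)) * gauss_weight z) = G \o shift2 (- w).
  apply/funext => z.
  rewrite /G /= sqnorm2_shift2 /fock_kernel_complex !normsqM normsq_cexp /laguerre_gauss.
  set L := laguerre _ _.
  have -> : normsq (L%:C : C) = L ^+ 2 by rewrite /normsq /= expr0n addr0.
  have -> : normsq (2 : C) = 4.
    by rewrite /normsq Re_natr Im_natr expr0n addr0 -natrX.
  have E : expR (2 * Re (twopi * pt z * w^*)) * gauss_weight z =
      expR (2 * pi * normsq w) * expR (- (2 * pi * normsq (pt z - w))).
    rewrite /gauss_weight -!expRD; congr expR.
    by case: (w) => a b; rewrite /normsq /sqnorm2 /=; ring.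
  transitivity (4 * L ^+ 2 * (expR (2 * Re (twopi * pt z * w^*)) * gauss_weight z)); first by ring.
  by rewrite E; ring.
have cG : continuous (fun z => normsq (fock_kernel_complex n w (pt z)) * gauss_weight z).
  move=> z; apply: cvgM; last exact: continuous_gauss_weight.
  by apply: (tcont_normsq (U := fun z => fock_kernel_complex n w (pt z))); exact: ccont_fock_kernel_complex.
have GE' : G = (fun z => normsq (fock_kernel_complex n w (pt z)) * gauss_weight z) \o shift2 w.
  rewrite GE; apply/funext => z; congr G; case: z => x y.
  by rewrite /shift2 /=; case: (w) => a b /=; rewrite !addrK.
have cG2 : continuous G.
  rewrite GE' => z.
  apply: (continuous_comp (f := shift2 w)); [exact: (preserves2_shift _ _).1|exact: cG].
have [+ _] := preserves2_integrable (preserves2_shift (Re (- w)) (Im (- w))) cG2 i2.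
by rewrite -(funext (fun z => congr1 EFin (congr1 (@^~ z) GE))).
Qed.

Lemma complex_reproducing n (D : nat -> C -> C) w : tower D ->
  weighted_l2 (fun z => Re (fock_op n D (pt z))) ->
  weighted_l2 (fun z => Im (fock_op n D (pt z))) ->
  (\int[mu2]_z (Re ((fock_kernel_complex n w (pt z))^* * fock_op n D (pt z)) * gauss_weight z)
     = Re (fock_op n D w))%R /\
  (\int[mu2]_z (Im ((fock_kernel_complex n w (pt z))^* * fock_op n D (pt z)) * gauss_weight z)
     = Im (fock_op n D w))%R.
Proof.
move=> hD f0 f1.
have [k0 k1] := weighted_l2_fock_kernel_complex n w.
pose U z := (fock_kernel_complex n w (pt z))^* * fock_op n D (pt z).
have hD' : tower (weyl (- twopi * w^*) w D) by exact: tower_weyl.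
(* The translated function times its exponential factor: it is again in the image of the operator,
   and its value at 0 is the value of the original function at w. *)
pose g : C -> C := fock_op n (weyl (- twopi * w^*) w D).
have cg : ccont g by exact: ccont_fock_op.
have g0 : g 0 = fock_op n D w.
  by rewrite /g fock_op_weyl mulr0 cexp0 mul1r add0r.
have UE z : U (shift2 w z) * (gauss_weight (shift2 w z))%:C =
    (laguerre_gauss n (sqnorm2 z))%:C * g (pt z).
  rewrite /U pt_shift2 mulrAC /gauss_weight sqnorm2_shift2 fock_kernel_complex_shift.
  by rewrite /g fock_op_weyl mulrA.
have cU : tcont U.
  apply: tcontM; first by apply: tcont_conj; exact: ccont_fock_kernel_complex.
  exact: ccont_fock_op.
have ReC (a : C) (b : R) : Re (a * b%:C) = Re a * b by rewrite ReM /= mulr0 subr0.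
have ImC (a : C) (b : R) : Im (a * b%:C) = Im a * b by rewrite ImM /= mulr0 add0r.
have ReC' (a : C) (b : R) : Re (b%:C * a) = b * Re a by rewrite mulrC ReC mulrC.
have ImC' (a : C) (b : R) : Im (b%:C * a) = b * Im a by rewrite mulrC ImC mulrC.
have ck : continuous (@laguerre_gauss n).
  have cm : continuous (fun s : R => 2 * pi * s).
    by move=> s; apply: cvgM; [exact: cvg_cst|exact: cvg_id].
  have cl : continuous (fun s : R => laguerre n (2 * pi * s)).
    have : tcont (fun s : R => laguerre n ((2 * pi * s)%:C)).
      rewrite /laguerre; apply: tcont_sum => j _; apply: tcontM; first exact: tcont_cst.
      by apply: tcontX; exact: tcont_real.
    move=> [c0 _]; rewrite (_ : (fun s => _) = (fun s : R => Re (laguerre n ((2 * pi * s)%:C : C)))) //.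
    by apply/funext => s; rewrite -(rmorph_laguerre (real_complex R)).
  have cN : continuous (fun s : R => - (2 * pi * s)).
    by move=> s; apply: (@cvgN R R^o); exact: cm.
  move=> s; apply: cvgM.
    by apply: cvgM; [exact: cvg_cst|exact: cl].
  by apply: continuous_comp; [exact: cN|exact: continuous_expR].
have [ikm vkm] := laguerre_normalized n.
(* [h] stands for [Re] or [Im], so that the rotation average, a statement on real functions, is
   carried out once for both. *)
have main (h : C -> R) : (forall (a : C) (b : R), h (a * b%:C) = h a * b) ->
    (forall (a : C) (b : R), h (b%:C * a) = b * h a) ->
    (forall (V : R * R -> C), tcont V -> continuous (fun z => h (V z))) ->
    (forall u : R -> C, h (cint u) = \int[mu]_(t in [set` `[0, 2 * pi]]) h (u t))%R ->
    mu2.-integrable setT (fun z => (h (U z) * gauss_weight z)%:E) ->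
    (\int[mu2]_z (h (U z) * gauss_weight z))%R = h (fock_op n D w).
  move=> h1 h2 ch hint iU.
  have cH : continuous (fun z => h (U z) * gauss_weight z).
    by move=> z; apply: cvgM; [exact: ch|exact: continuous_gauss_weight].
  have [iS eS] := preserves2_integrable (preserves2_shift (Re w) (Im w)) cH iU.
  have E : (fun z => h (U (shift2 w z)) * gauss_weight (shift2 w z)) =
     (fun z => laguerre_gauss n (sqnorm2 z) * h (g (pt z))).
    by apply/funext => z; rewrite -h1 UE h2.
  rewrite -eS -/(shift2 w) E.
  rewrite (@rotation_average R (laguerre_gauss n) (fun s => laguerre n (2 * pi * s))
    (fun z => h (g z)) (h (g 0)))//.
  - by rewrite vkm mulr1 g0.
  - exact: ch.
  - move=> z; rewrite -hint circle_fock_op// -/(normsq z) -/g h2; ring.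
  - by move: iS; rewrite -(funext (fun z => congr1 EFin (congr1 (@^~ z) E))).
have conjM (a b : C) : Re (a^* * b) = Re a * Re b + Im a * Im b /\
   Im (a^* * b) = Re a * Im b - Im a * Re b.
  by case: a b => [a1 a2] [b1 b2] /=; split; ring.
split; apply: main => //.
- by move=> V [].
- rewrite (_ : (fun z => _) = (fun z => (
     Re (fock_kernel_complex n w (pt z)) * Re (fock_op n D (pt z)) * gauss_weight z +
     Im (fock_kernel_complex n w (pt z)) * Im (fock_op n D (pt z)) * gauss_weight z)%:E)).
    by apply: integrableD_real; exact: weighted_l2M.
  by apply/funext => z; rewrite /U (conjM _ _).1 mulrDl.
- by move=> V [].
- rewrite (_ : (fun z => _) = (fun z => (
     Re (fock_kernel_complex n w (pt z)) * Im (fock_op n D (pt z)) * gauss_weight z +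
     (-1) * (Im (fock_kernel_complex n w (pt z)) * Re (fock_op n D (pt z)) * gauss_weight z))%:E)).
    apply: integrableD_real; first exact: weighted_l2M.
    by apply: integrableZ_real; exact: weighted_l2M.
  by apply/funext => z; rewrite /U (conjM _ _).2 mulrBl mulN1r.
Qed.

End WeightedL2.

(** * Slice functions *)

Section Slices.
Variable R : realType.
Local Notation C := R[i].
Local Notation H := (quat R).
Implicit Types (L I p q : H) (F G : C -> C) (x y : R).

(** For an imaginary unit [L], the embedding of the complex field as the slice C_L. *)
Definition iota L (c : C) : H := slicept L (Re c) (Im c).

Lemma iotaD L (a b : C) : iota L (a + b) = iota L a + iota L b.
Proof. by rewrite /iota /slicept !cpartsE !scalerDl addrACA. Qed.

Lemma iota0 L : iota L 0 = 0.
Proof. by rewrite /iota /slicept !scale0r addr0. Qed.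

Lemma iotaN L (a : C) : iota L (- a) = - iota L a.
Proof. by rewrite /iota /slicept !cpartsE !scaleNr opprD. Qed.

Lemma iota_real L (a : R) : iota L a%:C = a%:A.
Proof. by rewrite /iota /slicept scale0r addr0. Qed.

Lemma iotaZ L (a : R) (b : C) : iota L (a%:C * b) = a *: iota L b.
Proof. by rewrite /iota /slicept !cpartsE !mul0r subr0 addr0 scalerDr !scalerA. Qed.

Lemma iotaM L (a b : C) : imagunit L -> iota L (a * b) = iota L a * iota L b.
Proof.
move=> hL; rewrite /iota /slicept !cpartsE mulrDl !mulrDr.
rewrite -!scalerAl -!scalerAr !mul1r mulr1 -expr2 hL !scalerA scalerBl scalerDl scalerN.
by rewrite [X in _ = _ + X]addrC [RHS]addrACA.
Qed.

Lemma iota1 L : iota L 1 = 1.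
Proof. by rewrite -[1 in LHS]/(1%:C) iota_real scale1r. Qed.

Lemma iota_imu L : iota L imu = L.
Proof. by rewrite /iota /slicept /= scale0r scale1r add0r. Qed.

Lemma qconj_iota L (a : C) : imagunit L -> qconj (iota L a) = iota L a^*.
Proof.
move=> /imagunitP[h _]; case: L h => l0 l1 l2 l3 /= ->.
by case: a => a b; apply: quatP; split => /=; ring.
Qed.

Lemma qconjD p q : qconj (p + q) = qconj p + qconj q.
Proof. by apply: quatP; split => //=; rewrite opprD. Qed.

Lemma qconjM p q : qconj (p * q) = qconj q * qconj p.
Proof. by apply: quatP; split => /=; ring. Qed.

Lemma qconj_imagunit I : imagunit I -> qconj I = - I.
Proof. by move=> /imagunitP[h _]; apply: quatP; split => //=; rewrite h oppr0. Qed.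

(** The stem determined by the values of F on one slice: F = [evenp F] + i [oddp F], with the parity
    in y that a stem must have. Both parts are complex in general, and real when F commutes with
    conjugation. *)
Definition evenp F (z : C) : C := 2^-1 * (F z + F z^*).
Definition oddp F (z : C) : C := - (imu / 2) * (F z - F z^*).

Lemma evenp_conj F z : evenp F z^* = evenp F z.
Proof. by rewrite /evenp conjcK addrC. Qed.

Lemma oddp_conj F z : oddp F z^* = - oddp F z.
Proof. by rewrite /oddp conjcK -[RHS]mulrN opprB. Qed.

Lemma imu2 : imu * imu = -1 :> C.
Proof. by apply: complexP => /=; rewrite ?mulr0 ?mul0r ?mulr1 ?sub0r ?addr0 ?oppr0. Qed.

Lemma evenp_oddp F z : evenp F z + imu * oddp F z = F z.
Proof.
rewrite /evenp /oddp mulrA mulrN [imu * (imu / 2)]mulrA imu2 -mulNr opprK mul1r.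
by field.
Qed.

Definition of_stem (a b : R -> R -> H) : H -> H :=
  fun q => a (re q) (im q) + imdir q * b (re q) (im q).

Lemma slice_stem_of_stem (a b : R -> R -> H) :
  (forall x y, a x (- y) = a x y) -> (forall x y, b x (- y) = - b x y) ->
  slice_stem (of_stem a b) a b.
Proof.
move=> ae bo; split => // I hI x y.
have [->|y0] := eqVneq y 0.
  rewrite /of_stem re_slicept// im_slicept// normr0 (oddq0 (bo _)).
  by rewrite !mulr0.
apply: (slice_decomp (P := fun I x y => of_stem a b (slicept I x y) = a x y + I * b x y) _ hI y0).
  by move=> I' u v; rewrite sliceptN ae bo mulrNN.
by rewrite sliceptE.
Qed.

Lemma conj_complex x y : (x +i* y)^* = x +i* (- y) :> C. Proof. by []. Qed.

Section Ext.
Variables (m : nat) (c : 'I_m -> H) (L : H).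
Implicit Types (P : 'I_m -> C -> C).

(** Two instances matter: the coefficients 1, i, j, k for the members of the space, and the single
    coefficient 1 for the kernel. *)
Definition stem_sum P x y : H := \sum_(k < m) iota L (P k (x +i* y)) * c k.

(* The slice function equal to [\sum_k iota L (P k z) * c k] on the slice C_L. *)
Definition slice_ext P : H -> H :=
  of_stem (stem_sum (fun k => evenp (P k))) (stem_sum (fun k => oddp (P k))).

Lemma slice_stem_ext P : slice_stem (slice_ext P)
  (stem_sum (fun k => evenp (P k))) (stem_sum (fun k => oddp (P k))).
Proof.
apply: slice_stem_of_stem => x y.
  by apply: eq_bigr => k _; rewrite -conj_complex evenp_conj.
rewrite /stem_sum -sumrN; apply: eq_bigr => k _.
by rewrite -conj_complex oddp_conj iotaN mulNr.
Qed.

Lemma slice_ext_slicept P I x y : imagunit I ->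
  slice_ext P (slicept I x y) =
  stem_sum (fun k => evenp (P k)) x y + I * stem_sum (fun k => oddp (P k)) x y.
Proof. by move=> hI; have [_ _ ->] := slice_stem_ext P. Qed.

Lemma slice_ext_self P x y : imagunit L ->
  slice_ext P (slicept L x y) = \sum_(k < m) iota L (P k (x +i* y)) * c k.
Proof.
move=> hL; rewrite slice_ext_slicept// /stem_sum mulr_sumr -big_split /=.
apply: eq_bigr => k _; rewrite mulrA -mulrDl; congr (_ * _).
by rewrite -{2}(iota_imu L) -iotaM// -iotaD evenp_oddp.
Qed.

End Ext.

Lemma slice_fun_eq (f g : H -> H) a b : slice_stem f a b ->
  (forall q, g q = a (re q) (im q) + imdir q * b (re q) (im q)) -> f = g.
Proof.
move=> [_ _ fE] gE; apply/funext => q; rewrite gE -fE ?sliceptE//; exact: imdirP.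
Qed.

End Slices.

(** * The slice derivative of extended functions *)

Section SliceCalculus.
Variable R : realType.
Local Notation C := R[i].
Local Notation H := (quat R).
Implicit Types (L I p q : H) (F G A B : C -> C) (x y : R) (z : C).

Let twopi : C := (2 * pi)%:C.

Definition qis_derive (u : R -> H) (t : R) (d : H) : Prop :=
  [/\ is_derive t 1 (fun s => q0 (u s)) (q0 d), is_derive t 1 (fun s => q1 (u s)) (q1 d),
      is_derive t 1 (fun s => q2 (u s)) (q2 d) & is_derive t 1 (fun s => q3 (u s)) (q3 d)].

Lemma qis_derive_qderive1 u t d : qis_derive u t d -> qderive1 u t = d.
Proof.
by move=> [h0 h1 h2 h3]; apply: quatP; split; rewrite /= derive1E; apply: derive_val.
Qed.

Lemma qis_derive_qderivable u t d : qis_derive u t d -> qderivable u t.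
Proof. by move=> [h0 h1 h2 h3]; split; apply: ex_derive. Qed.

Lemma is_derive_lin2 (a b : R) (f g : R -> R) (t df dg : R) :
  is_derive t 1 f df -> is_derive t 1 g dg ->
  is_derive t 1 (fun s => a * f s + b * g s) (a * df + b * dg).
Proof.
move=> hf hg; have h0 : is_derive t 1 (fun=> 0 : R) (0 : R) by exact: is_derive_cst.
have := is_derive1_lin b (is_derive1_lin a h0 hf) hg.
rewrite add0r; congr is_derive; apply/funext => s; by rewrite add0r.
Qed.

Lemma qis_derive_iota L (c : H) (u : R -> C) (t : R) d : cderiv u t d ->
  qis_derive (fun s => iota L (u s) * c) t (iota L d * c).
Proof.
move=> [h0 h1].
have K (a b : R) (f : R -> R) (v : R) :
    f = (fun s => a * Re (u s) + b * Im (u s)) -> v = a * Re d + b * Im d ->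
    is_derive t 1 f v.
  by move=> -> ->; exact: is_derive_lin2.
case: L c => [l0 l1 l2 l3] [c0 c1 c2 c3]; split; rewrite /iota /slicept /=.
- apply: (K c0 (l0 * c0 - l1 * c1 - l2 * c2 - l3 * c3)); last by ring.
  by apply/funext => s; ring.
- apply: (K c1 (l0 * c1 + l1 * c0 + l2 * c3 - l3 * c2)); last by ring.
  by apply/funext => s; ring.
- apply: (K c2 (l0 * c2 - l1 * c3 + l2 * c0 + l3 * c1)); last by ring.
  by apply/funext => s; ring.
- apply: (K c3 (l0 * c3 + l1 * c2 - l2 * c1 + l3 * c0)); last by ring.
  by apply/funext => s; ring.
Qed.

Lemma qis_deriveD u v t d e : qis_derive u t d -> qis_derive v t e ->
  qis_derive (fun s => u s + v s) t (d + e).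
Proof. by move=> [u0 u1 u2 u3] [v0 v1 v2 v3]; split; exact: is_deriveD. Qed.

Lemma qis_derive_sum (J : Type) (r : seq J) (u : J -> R -> H) t (d : J -> H) :
  (forall j, qis_derive (u j) t (d j)) ->
  qis_derive (fun s => \sum_(j <- r) u j s) t (\sum_(j <- r) d j).
Proof.
move=> hu; elim: r => [|j r IH].
  rewrite big_nil [X in qis_derive X](_ : _ = (fun=> 0)).
    by split; exact: is_derive_cst.
  by apply/funext => s; rewrite big_nil.
rewrite big_cons [X in qis_derive X](_ : _ = (fun s => u j s + \sum_(j <- r) u j s)).
  exact: qis_deriveD.
by apply/funext => s; rewrite big_cons.
Qed.

(* [A] is the holomorphic part dF/dz of the differential of F; the
   antiholomorphic part B is left unspecified. *)
Definition wirtinger F A : Prop := exists B, forall (u : R -> C) t d,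
  cderiv u t d -> cderiv (F \o u) t (A (u t) * d + B (u t) * d^*).

Lemma holo_wirtinger F F' : holo F F' -> wirtinger F F'.
Proof.
move=> [_ _ h]; exists (fun=> 0) => u t d hu.
by rewrite mul0r addr0; exact: h.
Qed.

Lemma wirtingerD F A G A' : wirtinger F A -> wirtinger G A' ->
  wirtinger (fun z => F z + G z) (fun z => A z + A' z).
Proof.
move=> [B hF] [B' hG]; exists (fun z => B z + B' z) => u t d hu.
by apply: (cderiv_eq (cderivD (hF _ _ _ hu) (hG _ _ _ hu))); ring.
Qed.

Lemma wirtingerM F A G A' : wirtinger F A -> wirtinger G A' ->
  wirtinger (fun z => F z * G z) (fun z => A z * G z + F z * A' z).
Proof.
move=> [B hF] [B' hG]; exists (fun z => B z * G z + F z * B' z) => u t d hu.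
by apply: (cderiv_eq (cderivM (hF _ _ _ hu) (hG _ _ _ hu))); rewrite /=; ring.
Qed.

Lemma wirtinger_conj (a : C) : wirtinger (fun z => a * z^*) (fun=> 0).
Proof.
exists (fun=> a) => u t d hu.
by rewrite mul0r add0r; exact: cderivZ (cderiv_conj hu).
Qed.

Lemma wirtinger_iter_shift_op n (D : nat -> C -> C) k : tower D ->
  wirtinger (fun z => iter n (shift_op (- twopi * z^*)) D k z)
            (fun z => iter n (shift_op (- twopi * z^*)) D k.+1 z).
Proof.
move=> hD; elim: n k => [|n IH] k; first exact: holo_wirtinger.
have [B h] := wirtingerD (IH k.+1) (wirtingerM (wirtinger_conj (- twopi)) (IH k)).
exists B => u t d hu; apply: (cderiv_eq (h u t d hu)).
by rewrite mul0r add0r.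
Qed.

Definition cgauss z : R := expR (- (2 * pi * normsq z)).

Lemma cgauss_conj z : cgauss z^* = cgauss z.
Proof. by rewrite /cgauss /normsq; case: z => a b /=; rewrite sqrrN. Qed.

Lemma wirtinger_cgauss : wirtinger (fun z => (cgauss z)%:C) (fun z => - twopi * z^* * (cgauss z)%:C).
Proof.
have E z : (cgauss z)%:C = cexp (- twopi * z^* * z).
  transitivity (cexp (- (twopi * (normsq z)%:C))).
    rewrite /cgauss -cexp_real /twopi -(rmorphM (real_complex R)).
    by rewrite -(rmorphN (real_complex R)).
  by rewrite -normsqE; congr cexp; ring.
exists (fun z => - twopi * z * (cgauss z)%:C) => u t d hu.
have h := cderiv_cexp (cderivM (cderivZ (- twopi) (cderiv_conj hu)) hu).
rewrite (_ : (fun z => (cgauss z)%:C) \o u = (fun s => cexp (- twopi * (u s)^* * u s))).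
  apply: (cderiv_eq h); rewrite E; ring.
by apply/funext => s /=; rewrite E.
Qed.

(** The derivative of the Gaussian supplies the term - 2 pi z^*, which completes d/dz to one more
    factor of the operator. *)
Lemma wirtinger_fock n D : tower D ->
  wirtinger (fun z => (cgauss z)%:C * fock_op n D z) (fun z => (cgauss z)%:C * fock_op n.+1 D z).
Proof.
move=> hD.
have [B h] := wirtingerM wirtinger_cgauss (wirtinger_iter_shift_op n 0 hD).
exists B => u t d hu; apply: (cderiv_eq (h u t d hu)).
congr (_ * _ + _); rewrite /fock_op iterS.
set Y := iter n _ D; rewrite /shift_op; ring.
Qed.

Section Ext.
Variables (m : nat) (c : 'I_m -> H) (L : H).
Hypothesis hL : imagunit L.
Implicit Types (P Q : 'I_m -> C -> C).

Lemma qis_derive_stem_sum (u : 'I_m -> R -> C) t (d : 'I_m -> C) :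
  (forall k, cderiv (u k) t (d k)) ->
  qis_derive (fun s => \sum_(k < m) iota L (u k s) * c k) t (\sum_(k < m) iota L (d k) * c k).
Proof. by move=> h; apply: qis_derive_sum => k; exact: qis_derive_iota. Qed.

Lemma cderiv_hline x y : cderiv (fun s => s +i* y) x 1.
Proof. by split; [exact: is_derive_id|exact: is_derive_cst]. Qed.

Lemma cderiv_vline x y : cderiv (fun s => x +i* s) y imu.
Proof. by split; [exact: is_derive_cst|exact: is_derive_id]. Qed.

Lemma cderiv_evenp F A B (u : R -> C) t d :
  (forall (u : R -> C) t d, cderiv u t d -> cderiv (F \o u) t (A (u t) * d + B (u t) * d^*)) ->
  cderiv u t d -> cderiv (fun s => evenp F (u s)) t
    (2^-1 * ((A (u t) * d + B (u t) * d^*) + (A (u t)^* * d^* + B (u t)^* * d))).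
Proof.
move=> h hu; apply: cderivZ; apply: cderivD; first exact: h.
have := h _ _ _ (cderiv_conj hu); by rewrite conjcK.
Qed.

Lemma cderiv_oddp F A B (u : R -> C) t d :
  (forall (u : R -> C) t d, cderiv u t d -> cderiv (F \o u) t (A (u t) * d + B (u t) * d^*)) ->
  cderiv u t d -> cderiv (fun s => oddp F (u s)) t
    (- (imu / 2) * ((A (u t) * d + B (u t) * d^*) - (A (u t)^* * d^* + B (u t)^* * d))).
Proof.
move=> h hu; apply: cderivZ; apply: cderivD; first exact: h.
apply: cderivN; have := h _ _ _ (cderiv_conj hu); by rewrite conjcK.
Qed.

(** [slice_deriv] differentiates along the slice of the point and not along C_L, so the computation
    goes through the partial derivatives of the even and odd parts. In the two combinations
    [ax + by_] and [bx - ay] the antiholomorphic parts cancel. *)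
Lemma slice_deriv_ext P Q : (forall k, wirtinger (P k) (Q k)) ->
  slice_deriv (slice_ext c L P) = slice_ext c L Q.
Proof.
move=> /choice[B hB]; apply/funext => q.
rewrite /slice_deriv; set I := imdir q; have hI : imagunit I by exact: imdirP.
set x := re q; set y := im q; set z := x +i* y : C.
rewrite /partialx /partialy.
have -> : (fun t => slice_ext c L P (slicept I t y)) =
   (fun t => stem_sum c L (fun k => evenp (P k)) t y + I * stem_sum c L (fun k => oddp (P k)) t y).
  by apply/funext => t; rewrite slice_ext_slicept.
have -> : (fun t => slice_ext c L P (slicept I x t)) =
   (fun t => stem_sum c L (fun k => evenp (P k)) x t + I * stem_sum c L (fun k => oddp (P k)) x t).
  by apply/funext => t; rewrite slice_ext_slicept.
have c1 : (1 : C)^* = 1 by apply: complexP; rewrite /= ?oppr0.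
have ci : imu^* = - imu :> C by apply: complexP; rewrite /= ?oppr0.
have i2 := imu2 R.
have Ex k : cderiv (fun s => evenp (P k) (s +i* y)) x
    (2^-1 * (Q k z + B k z + (Q k z^* + B k z^*))).
  by apply: cderiv_eq (cderiv_evenp (hB k) (cderiv_hline x y)) _; rewrite c1; ring.
have Ox k : cderiv (fun s => oddp (P k) (s +i* y)) x
    (- (imu / 2) * (Q k z + B k z - (Q k z^* + B k z^*))).
  by apply: cderiv_eq (cderiv_oddp (hB k) (cderiv_hline x y)) _; rewrite c1; ring.
have Ey k : cderiv (fun s => evenp (P k) (x +i* s)) y
    (imu / 2 * (Q k z - B k z - (Q k z^* - B k z^*))).
  by apply: cderiv_eq (cderiv_evenp (hB k) (cderiv_vline x y)) _; rewrite ci; ring.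
have Oy k : cderiv (fun s => oddp (P k) (x +i* s)) y
    (2^-1 * (Q k z - B k z + (Q k z^* - B k z^*))).
  apply: cderiv_eq (cderiv_oddp (hB k) (cderiv_vline x y)) _; rewrite ci.
  transitivity (- (imu * imu) / 2 * (Q k z - B k z + (Q k z^* - B k z^*))); first by ring.
  by rewrite i2 opprK mul1r.
have ex := qis_derive_stem_sum Ex.
have ox := qis_derive_stem_sum Ox.
have ey := qis_derive_stem_sum Ey.
have oy := qis_derive_stem_sum Oy.
rewrite (qderive1_lin _ (qis_derive_qderivable ex) (qis_derive_qderivable ox)).
rewrite (qderive1_lin _ (qis_derive_qderivable ey) (qis_derive_qderivable oy)).
rewrite (qis_derive_qderive1 ex) (qis_derive_qderive1 ox).
rewrite (qis_derive_qderive1 ey) (qis_derive_qderive1 oy).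
rewrite /slice_ext /of_stem -/x -/y -/I /stem_sum -/z.
clearbody z.
set a := \sum_(k < m) iota L (evenp (Q k) z) * c k.
set b := \sum_(k < m) iota L (oddp (Q k) z) * c k.
set ax := \sum_(i < m) _; set bx := \sum_(i < m) _.
set ay := \sum_(i < m) _; set by_ := \sum_(i < m) _.
have r2 : (2 : R)%:C = 2 by exact: (rmorph_nat (real_complex R) 2).
have E1 : ax + by_ = 2 *: a.
  rewrite /ax /by_ /a -big_split scaler_sumr /=; apply: eq_bigr => k _.
  rewrite -mulrDl -iotaD scalerAl -iotaZ; congr (iota L _ * _).
  by rewrite /evenp r2; field.
have E2 : bx - ay = 2 *: b.
  rewrite /bx /ay /b -sumrB scaler_sumr /=; apply: eq_bigr => k _.
  rewrite -mulrBl -iotaN -iotaD scalerAl -iotaZ; congr (iota L _ * _).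
  by rewrite /oddp r2; field.
have -> : ax + I * bx - I * (ay + I * by_) = (ax + by_) + I * (bx - ay).
  rewrite !mulrDr mulrN mulrA -expr2 hI mulN1r opprD opprK.
  by rewrite [X in _ + X]addrC addrACA.
by rewrite E1 E2 -scalerAr -scalerDr scalerA mulVf// scale1r.
Qed.

Lemma iter_slice_deriv_ext n (D : 'I_m -> nat -> C -> C) : (forall k, tower (D k)) ->
  iter n (@slice_deriv R) (slice_ext c L (fun k z => (cgauss z)%:C * D k 0 z)) =
  slice_ext c L (fun k z => (cgauss z)%:C * fock_op n (D k) z).
Proof.
move=> hD; elim: n => [|n IH] //=; rewrite IH.
by apply: slice_deriv_ext => k; exact: wirtinger_fock.
Qed.

Lemma slice_ext_scale (a : C -> R) P q : (forall z, a z^* = a z) ->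
  a (re q +i* im q) *: slice_ext c L P q = slice_ext c L (fun k z => (a z)%:C * P k z) q.
Proof.
move=> ha; rewrite /slice_ext /of_stem scalerDr scalerAr.
congr (_ + _ * _); rewrite /stem_sum scaler_sumr; apply: eq_bigr => k _.
- rewrite scalerAl -iotaZ; congr (iota L _ * _).
  by rewrite /evenp ha; ring.
- rewrite scalerAl -iotaZ; congr (iota L _ * _).
  by rewrite /oddp ha; ring.
Qed.

Lemma qnorm_normsq q : qnorm q ^+ 2 = normsq (re q +i* im q).
Proof.
rewrite /qnorm sqr_sqrtr ?addr_ge0 ?sqr_ge0// /normsq /= /im /qnorm /=.
rewrite sqr_sqrtr ?addr_ge0 ?sqr_ge0// /re.
by rewrite expr0n /= add0r !addrA.
Qed.

Lemma fock_weight_cgauss q : fock_weight q = cgauss (re q +i* im q).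
Proof. by rewrite /fock_weight qnorm_normsq. Qed.

Lemma slice_ext_fock n (b : R) (D : 'I_m -> nat -> C -> C) q : (forall k, tower (D k)) ->
  (b * expR (2 * pi * qnorm q ^+ 2)) *:
    iter n (@slice_deriv R) (fun p => fock_weight p *: slice_ext c L (fun k => D k 0%N) p) q =
  slice_ext c L (fun k z => b%:C * fock_op n (D k) z) q.
Proof.
move=> hD.
have -> : (fun p => fock_weight p *: slice_ext c L (fun k => D k 0%N) p) =
    slice_ext c L (fun k z => (cgauss z)%:C * D k 0%N z).
  apply/funext => p; rewrite fock_weight_cgauss.
  by rewrite (slice_ext_scale _ _ cgauss_conj).
rewrite iter_slice_deriv_ext// -(slice_ext_scale _ _ cgauss_conj) scalerA.
rewrite qnorm_normsq -mulrA /cgauss expRN mulfV ?mulr1; last by rewrite gt_eqF ?expR_gt0.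
exact: (@slice_ext_scale (fun=> b)).
Qed.

Lemma qcontinuous2_stem_sum P : (forall k, ccont (P k)) -> qcontinuous2 (stem_sum c L P).
Proof.
move=> hP.
(* Every quaternionic coordinate is a sum of terms al Re P + be Im P, each of them the real part of
   (al - i be) P, so [tcont_sum] applies. *)
have K (al be : 'I_m -> R) (f : R * R -> R) :
    f = (fun s => \sum_(k < m) (al k * Re (P k (s.1 +i* s.2)) + be k * Im (P k (s.1 +i* s.2)))) ->
    continuous f.
  have [h _] := @tcont_sum R (R * R)%type _ (index_enum 'I_m) xpredT
    (fun k (s : R * R) => (al k -i* be k) * P k (s.1 +i* s.2))
    (fun k _ => tcontM (tcont_cst _ _) (hP k)).
  move=> ->; rewrite (_ : (fun s => _) = (fun s : R * R =>
    Re (\sum_k (al k -i* be k) * P k (s.1 +i* s.2)))) //.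
  apply/funext => s; rewrite (big_morph (@complex.Re R) (@ReD R) (erefl _)).
  by apply: eq_bigr => k _; rewrite ReM /= mulNr opprK.
have S0 (u : 'I_m -> H) : q0 (\sum_(k < m) u k) = \sum_(k < m) q0 (u k).
  exact: (big_morph (@q0 R)).
have S1 (u : 'I_m -> H) : q1 (\sum_(k < m) u k) = \sum_(k < m) q1 (u k).
  exact: (big_morph (@q1 R)).
have S2 (u : 'I_m -> H) : q2 (\sum_(k < m) u k) = \sum_(k < m) q2 (u k).
  exact: (big_morph (@q2 R)).
have S3 (u : 'I_m -> H) : q3 (\sum_(k < m) u k) = \sum_(k < m) q3 (u k).
  exact: (big_morph (@q3 R)).
split.
- apply: (K (fun k => q0 (c k)) (fun k => q0 (L * c k))).
  by apply/funext => z; rewrite S0; apply: eq_bigr => k _; rewrite /iota /slicept /=; ring.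
- apply: (K (fun k => q1 (c k)) (fun k => q1 (L * c k))).
  by apply/funext => z; rewrite S1; apply: eq_bigr => k _; rewrite /iota /slicept /=; ring.
- apply: (K (fun k => q2 (c k)) (fun k => q2 (L * c k))).
  by apply/funext => z; rewrite S2; apply: eq_bigr => k _; rewrite /iota /slicept /=; ring.
- apply: (K (fun k => q3 (c k)) (fun k => q3 (L * c k))).
  by apply/funext => z; rewrite S3; apply: eq_bigr => k _; rewrite /iota /slicept /=; ring.
Qed.

End Ext.

End SliceCalculus.

(** * Slice regular functions and their holomorphic components *)

Section SliceRegular.
Variable R : realType.
Local Notation C := R[i].
Local Notation H := (quat R).
Implicit Types (L I p q : H) (F G : C -> C) (x y : R).

Section Ext.
Variables (m : nat) (c : 'I_m -> H) (L : H).
Hypothesis hL : imagunit L.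
Implicit Types (P Q : 'I_m -> C -> C).

Lemma qC1_stem_sum P Px Py :
  (forall k x y, cderiv (fun s => P k (s +i* y)) x (Px k (x +i* y))) ->
  (forall k x y, cderiv (fun s => P k (x +i* s)) y (Py k (x +i* y))) ->
  (forall k, ccont (Px k)) -> (forall k, ccont (Py k)) ->
  [/\ qC1 (stem_sum c L P), partialx (stem_sum c L P) = stem_sum c L Px &
      partialy (stem_sum c L P) = stem_sum c L Py].
Proof.
move=> hx hy cx cy.
have Ex x y := qis_derive_stem_sum c L (fun k => hx k x y).
have Ey x y := qis_derive_stem_sum c L (fun k => hy k x y).
have px : partialx (stem_sum c L P) = stem_sum c L Px.
  by apply/funext => x; apply/funext => y; exact: (qis_derive_qderive1 (Ex x y)).
have py : partialy (stem_sum c L P) = stem_sum c L Py.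
  by apply/funext => x; apply/funext => y; exact: (qis_derive_qderive1 (Ey x y)).
split => //; split.
- by move=> x y; exact: (qis_derive_qderivable (Ex x y)).
- by move=> x y; exact: (qis_derive_qderivable (Ey x y)).
- by rewrite px; exact: qcontinuous2_stem_sum.
- by rewrite py; exact: qcontinuous2_stem_sum.
Qed.

Lemma ccont_evenp F : ccont F -> ccont (evenp F).
Proof.
move=> cF; apply: tcontM; first exact: tcont_cst.
by apply: tcontD => //; exact: (tcont_comp cF (@ccont_conj R)).
Qed.

Lemma ccont_oddp F : ccont F -> ccont (oddp F).
Proof.
move=> cF; apply: tcontM; first exact: tcont_cst.
have -> : (fun z : R * R => F (z.1 +i* z.2) - F (z.1 +i* z.2)^*) =
  (fun z => F (z.1 +i* z.2) + (-1) * F (z.1 +i* z.2)^*).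
  by apply/funext => z; rewrite mulN1r.
apply: tcontD => //; apply: tcontM; first exact: tcont_cst.
exact: (tcont_comp cF (@ccont_conj R)).
Qed.

(** The even and odd parts a, b of a holomorphic P have partial derivatives a', - b' for a and b',
    a' for b, where a', b' are the parts of P'. This is the Cauchy-Riemann system of a stem, valid
    on all slices at once. *)
Lemma slice_regular_ext P P' : (forall k, holo (P k) (P' k)) ->
  slice_regular (slice_ext c L P).
Proof.
move=> hP.
have c1 : (1 : C)^* = 1 by apply: complexP; rewrite /= ?oppr0.
have ci : imu^* = - imu :> C by apply: complexP; rewrite /= ?oppr0.
have i2 := imu2 R.
have hB k : forall (u : R -> C) t d, cderiv u t d ->
    cderiv (P k \o u) t (P' k (u t) * d + 0 * d^*).
  by move=> u t d hu; rewrite mul0r addr0; have [_ _ h] := hP k; exact: h.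
have cP k : ccont (P' k) by have [] := hP k.
have Ex k x y : cderiv (fun s => evenp (P k) (s +i* y)) x (evenp (P' k) (x +i* y)).
  apply: cderiv_eq (cderiv_evenp (B := fun=> 0) (hB k) (cderiv_hline x y)) _.
  by rewrite c1 /evenp; ring.
have Ey k x y : cderiv (fun s => evenp (P k) (x +i* s)) y (- oddp (P' k) (x +i* y)).
  apply: cderiv_eq (cderiv_evenp (B := fun=> 0) (hB k) (cderiv_vline x y)) _.
  by rewrite ci /oddp; ring.
have Ox k x y : cderiv (fun s => oddp (P k) (s +i* y)) x (oddp (P' k) (x +i* y)).
  apply: cderiv_eq (cderiv_oddp (B := fun=> 0) (hB k) (cderiv_hline x y)) _.
  by rewrite c1 /oddp; ring.
have Oy k x y : cderiv (fun s => oddp (P k) (x +i* s)) y (evenp (P' k) (x +i* y)).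
  apply: cderiv_eq (cderiv_oddp (B := fun=> 0) (hB k) (cderiv_vline x y)) _.
  rewrite ci /evenp; set z := x +i* y.
  transitivity (- (imu * imu) / 2 * (P' k z + P' k z^*)); first by ring.
  by rewrite i2 opprK mul1r.
have cN k : ccont (fun z => - oddp (P' k) z).
  rewrite (_ : (fun z => _) = (fun z => (-1) * oddp (P' k) z)).
    by apply: tcontM; [exact: tcont_cst|exact: ccont_oddp].
  by apply/funext => z; rewrite mulN1r.
have [Ca ax ay] := qC1_stem_sum (P := fun k => evenp (P k)) Ex Ey (fun k => ccont_evenp (cP k)) cN.
have [Cb bx by_] := qC1_stem_sum (P := fun k => oddp (P k)) Ox Oy (fun k => ccont_oddp (cP k)) (fun k => ccont_evenp (cP k)).
exists (stem_sum c L (fun k => evenp (P k))), (stem_sum c L (fun k => oddp (P k))).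
split => //; first exact: slice_stem_ext.
move=> I hI x y /=.
rewrite /partialx /partialy.
have -> : (fun t => slice_ext c L P (slicept I t y)) =
   (fun t => stem_sum c L (fun k => evenp (P k)) t y + I * stem_sum c L (fun k => oddp (P k)) t y).
  by apply/funext => t; rewrite slice_ext_slicept.
have -> : (fun t => slice_ext c L P (slicept I x t)) =
   (fun t => stem_sum c L (fun k => evenp (P k)) x t + I * stem_sum c L (fun k => oddp (P k)) x t).
  by apply/funext => t; rewrite slice_ext_slicept.
case: Ca Cb => [a1 a2 _ _] [b1 b2 _ _].
rewrite (qderive1_lin _ (a1 x y) (b1 x y)) (qderive1_lin _ (a2 x y) (b2 x y)).
rewrite -!/(partialx _ _ _) -!/(partialy _ _ _) ax ay bx by_.
have -> : stem_sum c L (fun k z => - oddp (P' k) z) x y = - stem_sum c L (fun k => oddp (P' k)) x y.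
  by rewrite /stem_sum -sumrN; apply: eq_bigr => k _; rewrite iotaN mulNr.
rewrite mulrDr mulrN mulrA -expr2 hI mulN1r.
set a := stem_sum _ _ _ _ _; set b := stem_sum _ _ _ _ _.
by rewrite [X in _ + X]addrC addrACA subrr subrr addr0 scaler0.
Qed.

End Ext.

Definition qcomp (k : 'I_4) (q : H) : R :=
  match val k with 0%N => q0 q | 1%N => q1 q | 2%N => q2 q | _ => q3 q end.

Definition qbasis (k : 'I_4) : H :=
  match val k with
  | 0%N => Quat 1 0 0 0 | 1%N => Quat 0 1 0 0 | 2%N => Quat 0 0 1 0 | _ => Quat 0 0 0 1
  end.

Lemma sum_qcomp q : \sum_(k < 4) qcomp k q *: qbasis k = q.
Proof.
rewrite !big_ord_recl big_ord0 /qcomp /qbasis /= addr0.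
by apply: quatP; split => /=; rewrite ?(mulr0, mulr1, addr0, add0r).
Qed.

Lemma qcompD k p q : qcomp k (p + q) = qcomp k p + qcomp k q.
Proof. by case: k => -[|[|[|[|]]]] //=. Qed.

Lemma qcompN k p : qcomp k (- p) = - qcomp k p.
Proof. by case: k => -[|[|[|[|]]]] //=. Qed.

Lemma qcomp_continuous2 k (a : R -> R -> H) : qcontinuous2 a ->
  continuous (fun z : R * R => qcomp k (a z.1 z.2)).
Proof. by case=> ? ? ? ?; case: k => -[|[|[|[|]]]]. Qed.

Lemma qcomp_is_derive k (u : R -> H) (t : R) : qderivable u t ->
  is_derive t 1 (fun s => qcomp k (u s)) (qcomp k (qderive1 u t)).
Proof.
case=> h0 h1 h2 h3; case: k => -[|[|[|[|]]]] //= i; rewrite /qcomp /= derive1E;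
  exact/derivableP.
Qed.

Lemma half_add_conj (a b : R) : 2^-1 * ((a +i* b) + (a -i* b)) = a%:C.
Proof.
have n2 : 2 != 0 :> C by rewrite pnatr_eq0.
apply: (mulfI n2); rewrite mulVKf// mulr_natl mulr2n.
by apply: complexP; rewrite !cpartsE /= ?subrr ?addr0.
Qed.

Lemma half_sub_conj (a b : R) : - (imu / 2) * ((a +i* b) - (a -i* b)) = b%:C.
Proof.
have n2 : 2 != 0 :> C by rewrite pnatr_eq0.
apply: (mulfI n2); rewrite mulr_natl mulr2n.
transitivity (- imu * ((a +i* b) - (a -i* b)) : C); first by field.
by apply: complexP; rewrite !cpartsE /=; ring.
Qed.

(** The k-th coordinates of a and b are real, so they form one complex function whose even and odd
    parts are these coordinates again, by the parity of the stem. Since [iota L] is only applied to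
    reals, any slice may be chosen for [L]. *)
Lemma slice_stem_intrinsic f a b L : imagunit L -> slice_stem f a b ->
  f = slice_ext qbasis L (fun k z => qcomp k (a (Re z) (Im z)) +i* qcomp k (b (Re z) (Im z))).
Proof.
move=> hL fs; apply: (slice_fun_eq fs) => q; case: fs => ae bo _.
rewrite /slice_ext /of_stem /stem_sum.
set x := re q; set y := im q.
have E k : evenp (fun z => qcomp k (a (Re z) (Im z)) +i* qcomp k (b (Re z) (Im z))) (x +i* y)
    = (qcomp k (a x y))%:C.
  by rewrite /evenp /= ae bo qcompN half_add_conj.
have O k : oddp (fun z => qcomp k (a (Re z) (Im z)) +i* qcomp k (b (Re z) (Im z))) (x +i* y)
    = (qcomp k (b x y))%:C.
  by rewrite /oddp /= ae bo qcompN half_sub_conj.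
congr (_ + _ * _); [rewrite -[RHS]sum_qcomp|rewrite -[RHS]sum_qcomp]; apply: eq_bigr => k _.
  by rewrite E iota_real -scalerAl mul1r.
by rewrite O iota_real -scalerAl mul1r.
Qed.

Lemma slice_regular_holo h L : imagunit L -> slice_regular h ->
  exists F F' : 'I_4 -> C -> C, [/\ forall k, holo (F k) (F' k),
    forall k z, F k z^* = (F k z)^* & h = slice_ext qbasis L F].
Proof.
move=> hL [a [b [hs [ax ay cax cay] [bx by_ cbx cby] cr]]].
(* Regularity on a single slice mixes the two equations; comparing the slices of I and - I separates
   them. *)
have CR x y : partialx a x y = partialy b x y /\ partialx b x y = - partialy a x y.
  have hi := imagunit_i R; have hN := imagunitN hi.
  have [_ _ hE] := hs.
  have K I : imagunit I -> partialx a x y + I * partialx b x y +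
      I * (partialy a x y + I * partialy b x y) = 0.
    move=> hI; have := cr I hI x y; rewrite /= /partialx /partialy.
    have -> : (fun t => h (slicept I t y)) = (fun t => a t y + I * b t y).
      by apply/funext => t; rewrite hE.
    have -> : (fun t => h (slicept I x t)) = (fun t => a x t + I * b x t).
      by apply/funext => t; rewrite hE.
    rewrite (qderive1_lin _ (ax x y) (bx x y)) (qderive1_lin _ (ay x y) (by_ x y)).
    move/(congr1 (fun q => 2 *: q)); rewrite scalerA divff// scale1r scaler0.
    by [].
  have := K _ hN; have := K _ hi.
  move: (partialx a x y) (partialx b x y) (partialy a x y) (partialy b x y).
  move=> [a0 a1 a2 a3] [b0 b1 b2 b3] [c0 c1 c2 c3] [d0 d1 d2 d3] [] e0 e1 e2 e3 [] f0 f1 f2 f3.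
  split; apply: quatP; split => /=; lra.
pose F (k : 'I_4) (z : C) : C := qcomp k (a (Re z) (Im z)) +i* qcomp k (b (Re z) (Im z)).
pose F' (k : 'I_4) (z : C) : C :=
  qcomp k (partialx a (Re z) (Im z)) +i* qcomp k (partialx b (Re z) (Im z)).
exists F, F'; split.
- move=> k; apply: holo_C1.
  + by split; exact: qcomp_continuous2.
  + by move=> x y; split; [exact: (qcomp_is_derive k (ax x y))|exact: (qcomp_is_derive k (bx x y))].
  + move=> x y; have [E1 E2] := CR x y; split; rewrite cpartsE /= E1 E2 qcompN.
    * by rewrite !mul0r mul1r sub0r opprK; exact: (qcomp_is_derive k (ay x y)).
    * by rewrite !mul0r mul1r add0r; exact: (qcomp_is_derive k (by_ x y)).
- move=> k [x y]; have [ae bo _] := hs; rewrite /F /= ae bo qcompN.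
  by apply: complexP.
- exact: slice_stem_intrinsic.
Qed.

End SliceRegular.

(** * Convergence of the complex exponential series *)

Section ComplexExponentialSeries.
Variable R : realType.
Local Notation C := R[i].
Implicit Types (z : C) (u : nat -> C).

Definition cmod z : R := Num.sqrt (normsq z).

Lemma cmodM (a b : C) : cmod (a * b) = cmod a * cmod b.
Proof. by rewrite /cmod normsqM sqrtrM// addr_ge0 ?sqr_ge0. Qed.

Lemma cmodX z n : cmod (z ^+ n) = cmod z ^+ n.
Proof.
elim: n => [|n IH]; last by rewrite !exprS cmodM IH.
by rewrite !expr0 /cmod /normsq /= expr1n expr0n addr0 sqrtr1.
Qed.

Lemma cmod_real (a : R) : cmod a%:C = `|a|.
Proof. by rewrite /cmod /normsq /= expr0n addr0 sqrtr_sqr. Qed.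

Lemma normr_Re_le z : `|Re z| <= cmod z.
Proof. by rewrite -sqrtr_sqr ler_sqrt ?addr_ge0 ?sqr_ge0// /normsq lerDl sqr_ge0. Qed.

Lemma normr_Im_le z : `|Im z| <= cmod z.
Proof. by rewrite -sqrtr_sqr ler_sqrt ?addr_ge0 ?sqr_ge0// /normsq lerDr sqr_ge0. Qed.

Lemma cmod_cexp z : cmod (cexp z) = expR (Re z).
Proof. by rewrite /cmod normsq_cexp mulrC mulr_natr mulr2n expRD -expr2 sqrtr_sqr ger0_norm ?expR_ge0. Qed.

Definition ccvg u (l : C) : Prop :=
  Re (u n) @[n --> \oo] --> Re l /\ Im (u n) @[n --> \oo] --> Im l.

Definition cexp_partial n z : C := \sum_(j < n) (j`!%:R)^-1 * z ^+ j.

(** The curve leads from the partial sum at s = 0 to e^z at s = 1. Its derivative telescopes, since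
    differentiating a partial sum drops its last term, and one term of order n remains. *)
Lemma cexp_remainder_deriv n z (t : R) :
  cderiv (fun s => cexp_partial n.+1 ((1 - s)%:C * z) * cexp (s%:C * z)) t
    ((n`!%:R)^-1 * ((1 - t)%:C * z) ^+ n * z * cexp (t%:C * z)).
Proof.
have d1 : cderiv (fun s => (1 - s)%:C * z) t (- z).
  have d : is_derive t 1 (fun s : R => 1 - s) (-1).
    have := is_deriveB (is_derive_cst (1 : R) t 1) (is_derive_id t 1).
    by rewrite sub0r.
  apply: (cderiv_eq (cderivM (cderiv_real d) (cderiv_cst z t))).
  by rewrite mulr0 add0r (rmorphN1 (real_complex R)) mulN1r.
have dP m : cderiv (fun s => cexp_partial m.+1 ((1 - s)%:C * z)) t
    (- z * cexp_partial m ((1 - t)%:C * z)).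
  elim: m => [|m IH].
    rewrite (_ : (fun s => _) = (fun=> 1)).
      by rewrite /cexp_partial big_ord0 mulr0; exact: cderiv_cst.
    by apply/funext => s; rewrite /cexp_partial big_ord1 expr0 fact0 invr1 mulr1.
  rewrite (_ : (fun s => _) = (fun s => cexp_partial m.+1 ((1 - s)%:C * z) +
     (m.+1`!%:R)^-1 * ((1 - s)%:C * z) ^+ m.+1)).
    apply: (cderiv_eq (cderivD IH (cderivZ _ (cderivX m d1)))).
    rewrite [in RHS]/cexp_partial big_ord_recr /= -/(cexp_partial m _) mulrDr.
    congr (_ + _); rewrite factS natrM invfM.
    have m1 : m.+1%:R != 0 :> C by rewrite pnatr_eq0.
    have fm : m`!%:R != 0 :> C by rewrite pnatr_eq0 -lt0n fact_gt0.
    by move: (m.+1%:R : C) (m`!%:R : C) m1 fm => a b a0 b0; field; rewrite a0 b0.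
  by apply/funext => s; rewrite /cexp_partial big_ord_recr.
apply: (cderiv_eq (cderivM (dP n) (cderiv_cexp (cderivM (cderiv_id t) (cderiv_cst z t))))).
rewrite [in LHS]/cexp_partial big_ord_recr /= -/(cexp_partial n _); ring.
Qed.

(** [h] stands for [Re] or [Im]: the mean value theorem on [0, 1] has no complex version, so the
    bound is obtained for each part. *)
Lemma cexp_remainder n z (h : C -> R) :
  (forall (u : R -> C) (t : R) d, cderiv u t d -> is_derive t 1 (fun s => h (u s)) (h d)) ->
  (forall a, `|h a| <= cmod a) -> (forall a b, h (a - b) = h a - h b) ->
  `|h (cexp z) - h (cexp_partial n.+1 z)| <=
    cmod z * expR (cmod z) * (cmod z ^+ n / n`!%:R).
Proof.
move=> hd hc hB.
pose G s := cexp_partial n.+1 ((1 - s)%:C * z) * cexp (s%:C * z).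
have dG s := hd _ _ _ (cexp_remainder_deriv n z s).
have cG : {within `[0, 1], continuous (fun s => h (G s))}.
  apply: continuous_subspaceT => s.
  by apply: differentiable_continuous; apply/derivable1_diffP; have [] := dG s.
have [s + E] := MVT ltr01 (fun s _ => dG s) cG.
rewrite in_itv /= => /andP[s0 s1].
have G1 : G 1 = cexp z.
  rewrite /G subrr mul0r mul1r (_ : cexp_partial n.+1 0 = 1) ?mul1r//.
  rewrite /cexp_partial big_ord_recl expr0 fact0 invr1 mulr1 big1 ?addr0// => j _.
  by rewrite exprS mul0r mulr0.
have G0 : G 0 = cexp_partial n.+1 z by rewrite /G subr0 mul1r mul0r cexp0 mulr1.
rewrite -G1 -G0 E subr0 mulr1; apply: (le_trans (hc _)).
rewrite !cmodM cmodX cmodM cmod_real cmod_cexp.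
have -> : cmod ((n`!%:R)^-1 : C) = (n`!%:R)^-1.
  have -> : (n`!%:R)^-1 = ((n`!%:R)^-1)%:C :> C.
    by rewrite (fmorphV (real_complex R)) (rmorph_nat (real_complex R)).
  by rewrite cmod_real ger0_norm.
have z0 : 0 <= cmod z by exact: sqrtr_ge0.
have fn0 : (0 : R) < n`!%:R by rewrite ltr0n fact_gt0.
have e1 : (`|1 - s| * cmod z) ^+ n <= cmod z ^+ n.
  have s2 : `|1 - s| <= 1 by rewrite ger0_norm; lra.
  by rewrite lerXn2r ?nnegrE ?mulr_ge0// ler_piMl.
have e2 : expR (Re (s%:C * z)) <= expR (cmod z).
  rewrite ler_expR ReM /= mul0r subr0 (le_trans (ler_norm _))// normrM.
  have s2 : `|s| <= 1 by rewrite ger0_norm; lra.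
  by rewrite (le_trans _ (normr_Re_le z))// ler_piMl.
rewrite [leRHS](_ : _ = (n`!%:R)^-1 * cmod z ^+ n * cmod z * expR (cmod z)); last by ring.
have i0 : (0 : R) <= (n`!%:R)^-1 by rewrite invr_ge0 ltW.
apply: ler_pM; [|exact: expR_ge0| |exact: e2].
  by apply: mulr_ge0 => //; apply: mulr_ge0 => //; apply: exprn_ge0; exact: mulr_ge0.
by apply: ler_wpM2r => //; exact: ler_wpM2l.
Qed.

Lemma ccvg_cexp z : ccvg (fun n => cexp_partial n z) (cexp z).
Proof.
have main (h : C -> R) : (forall n, `|h (cexp z) - h (cexp_partial n.+1 z)| <=
    cmod z * expR (cmod z) * (cmod z ^+ n / n`!%:R)) ->
    h (cexp_partial n z) @[n --> \oo] --> h (cexp z).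
  move=> hb; rewrite -(cvg_shiftn 1).
  have e0 : (cmod z * expR (cmod z) * exp_coeff (cmod z) n) @[n --> \oo] --> (0 : R).
    rewrite -(mulr0 (cmod z * expR (cmod z))); apply: cvgM; first exact: cvg_cst.
    exact: cvg_series_cvg_0 (is_cvg_series_exp_coeff _).
  apply/cvgrPdist_le => e ep.
  move/cvgr0Pnorm_le : e0 => /(_ e ep); apply: filterS => n hn.
  rewrite /= ?addn1; apply: (le_trans (hb n)); apply: le_trans hn; exact: ler_norm.
split; apply: main => n; apply: cexp_remainder.
- by move=> u t d [].
- exact: normr_Re_le.
- by move=> a b; rewrite ReD ReN.
- by move=> u t d [].
- exact: normr_Im_le.
- by move=> a b; rewrite ImD ImN.
Qed.

Lemma ccvgD u v a b : ccvg u a -> ccvg v b -> ccvg (fun n => u n + v n) (a + b).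
Proof.
move=> [u0 u1] [v0 v1]; split; rewrite cpartsE.
- by under eq_fun do rewrite ReD; apply: cvgD.
- by under eq_fun do rewrite ImD; apply: cvgD.
Qed.

Lemma ccvgZ c u a : ccvg u a -> ccvg (fun n => c * u n) (c * a).
Proof.
move=> [u0 u1]; split; rewrite cpartsE.
- by under eq_fun do rewrite ReM; apply: cvgB; apply: cvgM => //; exact: cvg_cst.
- by under eq_fun do rewrite ImM; apply: cvgD; apply: cvgM => //; exact: cvg_cst.
Qed.

End ComplexExponentialSeries.

(** * The kernel as a slice extension *)

Section Kernel.
Variable R : realType.
Local Notation C := R[i].
Local Notation H := (quat R).
Implicit Types (L I p q r : H) (F G : C -> C) (z w : C).

Let twopi : C := (2 * pi)%:C.

Definition slice_point q : C := re q +i* im q.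

Definition kernel_ext L F : H -> H := slice_ext (fun _ : 'I_1 => 1) L (fun=> F).

Lemma kernel_extE L F q : kernel_ext L F q =
  iota L (evenp F (slice_point q)) + imdir q * iota L (oddp F (slice_point q)).
Proof. by rewrite /kernel_ext /slice_ext /of_stem /stem_sum !big_ord1 !mulr1. Qed.

Lemma slice_stem_kernel_ext L F : slice_stem (kernel_ext L F)
  (fun x y => iota L (evenp F (x +i* y))) (fun x y => iota L (oddp F (x +i* y))).
Proof.
have := slice_stem_ext (fun _ : 'I_1 => 1) L (fun=> F); congr slice_stem;
  apply/funext => x; apply/funext => y; by rewrite /stem_sum big_ord1 mulr1.
Qed.

(** Both stems take values in the commutative field C_L, so the product of stems obeys the complex
    rule for the even and odd parts of F G. *)
Lemma star_kernel_ext L F G : imagunit L ->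
  star (kernel_ext L F) (kernel_ext L G) = kernel_ext L (fun z => F z * G z).
Proof.
move=> hL; apply/funext => q; rewrite -{1}(sliceptE q).
rewrite (starE (slice_stem_kernel_ext L F) (slice_stem_kernel_ext L G)); last exact: imdirP.
rewrite kernel_extE -/(slice_point q) -!iotaM// -iotaN -!iotaD.
have i2 := imu2 R; set z := slice_point q.
congr (iota L _ + _ * iota L _).
- rewrite /evenp /oddp.
  transitivity (4^-1 * (F z + F z^*) * (G z + G z^*)
     - (imu * imu) / 4 * (F z - F z^*) * (G z - G z^*)); first by field.
  by rewrite i2; field.
- by rewrite /evenp /oddp; field.
Qed.

Lemma starpow_kernel_ext L F k : imagunit L ->
  starpow (kernel_ext L F) k = kernel_ext L (fun z => F z ^+ k).
Proof.
move=> hL; elim: k => [|k IH] /=.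
  apply/funext => q; rewrite kernel_extE /evenp /oddp !expr0 subrr mulr0 iota0 mulr0 addr0.
  by rewrite (_ : 2^-1 * (1 + 1) = 1) ?iota1//; field.
rewrite IH star_kernel_ext//; congr kernel_ext; apply/funext => z; by rewrite exprS.
Qed.

Lemma kernel_extD L F G q : kernel_ext L F q + kernel_ext L G q = kernel_ext L (fun z => F z + G z) q.
Proof.
rewrite !kernel_extE addrACA -mulrDr -!iotaD.
by congr (iota L _ + _ * iota L _); rewrite /evenp /oddp; ring.
Qed.

Lemma kernel_extN L F q : - kernel_ext L F q = kernel_ext L (fun z => - F z) q.
Proof.
rewrite !kernel_extE opprD -mulrN -!iotaN.
by congr (iota L _ + _ * iota L _); rewrite /evenp /oddp; ring.
Qed.

Lemma kernel_extZ L F q (a : R) : a *: kernel_ext L F q = kernel_ext L (fun z => a%:C * F z) q.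
Proof.
rewrite !kernel_extE scalerDr scalerAr -!iotaZ.
by congr (iota L _ + _ * iota L _); rewrite /evenp /oddp; ring.
Qed.

Lemma kernel_extMr L F q (d : C) : imagunit L ->
  kernel_ext L F q * iota L d = kernel_ext L (fun z => F z * d) q.
Proof.
move=> hL; rewrite !kernel_extE mulrDl -mulrA -!iotaM//.
by congr (iota L _ + _ * iota L _); rewrite /evenp /oddp; ring.
Qed.

Lemma kernel_ext_sum L (m : nat) (F : nat -> C -> C) q :
  \sum_(0 <= k < m) kernel_ext L (F k) q = kernel_ext L (fun z => \sum_(k < m) F k z) q.
Proof.
elim: m => [|m IH].
  rewrite big_nil kernel_extE /evenp /oddp !big_ord0 addr0 subrr !mulr0 iota0 mulr0 addr0.
  by [].
rewrite big_nat_recr //= IH kernel_extD; congr (kernel_ext L _ q); apply/funext => z.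
by rewrite big_ord_recr.
Qed.

(** Such an F preserves every slice, and its extension is the same from any [L]. Powers of q and
    [qconj q] are of this type, which lets them be rewritten as extensions from the slice of r. *)
Lemma kernel_ext_intrinsic L F q : imagunit L -> (forall z, F z^* = (F z)^*) ->
  kernel_ext L F q = iota (imdir q) (F (slice_point q)).
Proof.
move=> hL hF; rewrite kernel_extE /evenp /oddp hF.
case: (F _) => a b /=.
rewrite half_add_conj half_sub_conj !iota_real -scalerAr mulr1.
by rewrite /iota /slicept.
Qed.

Lemma iota_slice_point q : iota (imdir q) (slice_point q) = q.
Proof. by rewrite /iota /= sliceptE. Qed.

Lemma iotaX L z m : imagunit L -> iota L (z ^+ m) = iota L z ^+ m.
Proof.
move=> hL; elim: m => [|m IH]; first by rewrite !expr0 iota1.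
by rewrite !exprS iotaM// IH.
Qed.

Lemma kernel_extX L q m : imagunit L -> q ^+ m = kernel_ext L (fun z => z ^+ m) q.
Proof.
move=> hL; rewrite kernel_ext_intrinsic//; last by move=> z; rewrite rmorphXn.
by rewrite iotaX ?iota_slice_point//; exact: imdirP.
Qed.

(** Quantifying over real-linear functionals treats the four coordinate limits of [qseries] by one
    argument. *)
Lemma qseriesE (u : nat -> H) (l : H) :
  (forall h : H -> R, (forall p q, h (p + q) = h p + h q) ->
     (forall (a : R) p, h (a *: p) = a * h p) ->
     h (\sum_(0 <= k < n) u k) @[n --> \oo] --> h l) ->
  qseries u = l.
Proof.
move=> hu.
have K (h : H -> R) : h 0 = 0 -> (forall p q, h (p + q) = h p + h q) ->
    (forall (a : R) p, h (a *: p) = a * h p) ->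
    limn (series (fun m => h (u m))) = h l.
  move=> h0 hD hZ; apply/cvg_lim => //.
  have -> : series (fun m => h (u m)) = (fun n => h (\sum_(0 <= k < n) u k)).
    by apply/funext => n; rewrite /series /= (big_morph h hD h0).
  exact: hu.
by apply: quatP; split; apply: K.
Qed.

Lemma kernel_ext_cvg L (F : nat -> C -> C) (G : C -> C) q (h : H -> R) :
  (forall p q, h (p + q) = h p + h q) -> (forall (a : R) p, h (a *: p) = a * h p) ->
  (forall z, ccvg (fun n => F n z) (G z)) ->
  h (kernel_ext L (F n) q) @[n --> \oo] --> h (kernel_ext L G q).
Proof.
move=> hD hZ hF.
have E (d : C) p : h (p * iota L d) = Re d * h p + Im d * h (p * L).
  by rewrite /iota /slicept mulrDr hD -!scalerAr mulr1 !hZ.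
have T (p : H) (v : nat -> C) (l : C) : ccvg v l ->
    h (p * iota L (v n)) @[n --> \oo] --> h (p * iota L l).
  move=> [v0 v1]; rewrite E; under eq_fun do rewrite E.
  by apply: cvgD; apply: cvgM => //; exact: cvg_cst.
set z := slice_point q.
have e : ccvg (fun n => evenp (F n) z) (evenp G z) by apply: ccvgZ; apply: ccvgD.
have o : ccvg (fun n => oddp (F n) z) (oddp G z).
  apply: ccvgZ; have := ccvgD (hF z) (ccvgZ (-1) (hF z^*)).
  by rewrite mulN1r; under eq_fun do rewrite mulN1r.
rewrite kernel_extE hD; under eq_fun do rewrite kernel_extE hD.
apply: cvgD; last exact: T.
by have := T 1 _ _ e; rewrite mul1r; under eq_fun do rewrite mul1r.
Qed.

Lemma expstarE r q : expstar r q =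
  kernel_ext (imdir r) (fun z => cexp (twopi * z * (slice_point r)^*)) q.
Proof.
set L := imdir r; have hL : imagunit L by exact: imdirP.
set w := slice_point r.
have hr : qconj r = iota L w^* by rewrite -{1}(iota_slice_point r) qconj_iota.
apply: qseriesE => h hD hZ.
have -> : (fun n => h (\sum_(0 <= k < n) ((2 * pi) ^+ k / k`!%:R) *: (q ^+ k * qconj r ^+ k))) =
   (fun n => h (kernel_ext L (fun z => cexp_partial n (twopi * z * w^*)) q)).
  apply/funext => n; congr h.
  rewrite -(kernel_ext_sum L n (fun k z => (k`!%:R)^-1 * (twopi * z * w^*) ^+ k)).
  apply: eq_big_nat => k _.
  rewrite hr -iotaX// (kernel_extX _ _ hL) kernel_extMr// kernel_extZ.
  congr (kernel_ext L _ q); apply/funext => z.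
  rewrite (rmorphM (real_complex R)) (fmorphV (real_complex R)) (rmorph_nat (real_complex R)).
  by rewrite (rmorphXn (real_complex R)) -/twopi !exprMn; ring.
apply: kernel_ext_cvg => // z; exact: ccvg_cexp.
Qed.

(** With [L = imdir r], both r and its conjugate lie in C_L, so each factor is an extension from
    C_L. There the base of the *-powers is 2 pi |z - w|^2, and the sum is a Laguerre polynomial. *)
Lemma fock_kernelE n r : (fun q => fock_kernel n q r) =
  kernel_ext (imdir r) (fock_kernel_complex n (slice_point r)).
Proof.
set L := imdir r; have hL : imagunit L by exact: imdirP.
set w := slice_point r.
have hr : r = iota L w by rewrite iota_slice_point.
have hr' : qconj r = iota L w^* by rewrite -{1}(iota_slice_point r) qconj_iota.
have r2 : (2 : R)%:C = 2 :> C by exact: (rmorph_nat (real_complex R) 2).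
rewrite /fock_kernel.
have -> : (fun p => 2 *: expstar r p) = kernel_ext L (fun z => 2 * cexp (twopi * z * w^*)).
  by apply/funext => p; rewrite expstarE kernel_extZ r2.
have -> : (fun s => (2 * pi) *: (qconj s * s - s * qconj r - qconj s * r + qconj r * r)) =
    kernel_ext L (fun z => (2 * pi * normsq (z - w))%:C).
  apply/funext => s.
  have hs := kernel_extX s 1 hL; rewrite expr1 in hs.
  have hsc : qconj s = kernel_ext L (fun z => z^*) s.
    rewrite kernel_ext_intrinsic// -{1}(iota_slice_point s) qconj_iota//; exact: imdirP.
  have hss : qconj s * s = kernel_ext L (fun z => z^* * z) s.
    rewrite kernel_ext_intrinsic//; last by move=> z; rewrite rmorphM.
    rewrite iotaM; last exact: imdirP.
    by rewrite iota_slice_point -{1}(iota_slice_point s) qconj_iota//; exact: imdirP.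
  have hrr : qconj r * r = kernel_ext L (fun=> w^* * w) s.
    rewrite hr' [X in _ * X]hr -iotaM// kernel_extE /evenp /oddp subrr mulr0 iota0 mulr0 addr0.
    by congr iota; field.
  have e1 : s * qconj r = kernel_ext L (fun z => z * w^*) s.
    by rewrite hr' [X in X * _]hs kernel_extMr.
  have e2 : qconj s * r = kernel_ext L (fun z => z^* * w) s.
    by rewrite [X in _ * X]hr hsc kernel_extMr.
  rewrite hss hrr e1 e2 !kernel_extN !kernel_extD kernel_extZ.
  congr (kernel_ext L _ s); apply/funext => z.
  have cB (a b : C) : (a - b)^* = a^* - b^* by exact: rmorphB.
  have -> : (2 * pi * normsq (z - w))%:C = twopi * ((z - w)^* * (z - w)).
    by rewrite normsqE /twopi -(rmorphM (real_complex R)).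
  by rewrite cB -/twopi; ring.
have -> : (fun p => \sum_(0 <= k < n.+1) ((-1) ^+ k * 'C(n, n - k)%:R * (1 / k`!%:R)) *:
    starpow (kernel_ext L (fun z => (2 * pi * normsq (z - w))%:C)) k p) =
    kernel_ext L (fun z => (laguerre n (2 * pi * normsq (z - w)))%:C).
  apply/funext => p.
  under eq_bigr => k _ do rewrite starpow_kernel_ext// kernel_extZ.
  rewrite (kernel_ext_sum L n.+1 (fun k z => ((-1) ^+ k * 'C(n, n - k)%:R * (1 / k`!%:R))%:C *
     (2 * pi * normsq (z - w))%:C ^+ k)).
  congr (kernel_ext L _ p); apply/funext => z.
  rewrite (rmorph_sum (real_complex R)); apply: eq_bigr => k _.
  by rewrite (rmorphM (real_complex R) _ (_ ^+ _)) (rmorphXn (real_complex R)).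
by rewrite star_kernel_ext.
Qed.

End Kernel.

(** * The quaternionic kernel *)

Section Reproducing.
Variable R : realType.
Local Notation C := R[i].
Local Notation H := (quat R).
Local Notation mu := (@lebesgue_measure R).
Local Notation mu2 := (mu \x mu)%E.
Implicit Types (L I J p q r : H) (V W : R * R -> H) (U : R * R -> C) (w : C).

Let twopi : C := (2 * pi)%:C.

Definition ql2 V : Prop := forall k, weighted_l2 (fun z => qcomp k (V z)).

Definition cl2 U : Prop := weighted_l2 (fun z => Re (U z)) /\ weighted_l2 (fun z => Im (U z)).

Definition reflect (z : R * R) : R * R := (z.1, - z.2).

Lemma pt_reflect z : pt (reflect z) = (pt z)^*. Proof. by []. Qed.

Lemma weighted_l2_sum (T : Type) (s : seq T) (u : T -> R * R -> R) :
  (forall i, weighted_l2 (u i)) -> weighted_l2 (fun z => \sum_(i <- s) u i z).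
Proof.
move=> hu; elim: s => [|i s IH].
  under eq_fun do rewrite big_nil; split; first by move=> z; exact: cst_continuous.
  under eq_fun do rewrite expr0n mul0r; exact: integrable0.
by under eq_fun do rewrite big_cons; exact: weighted_l2D.
Qed.

Lemma cl2D U U' : cl2 U -> cl2 U' -> cl2 (fun z => U z + U' z).
Proof.
move=> [u0 u1] [v0 v1]; split.
- by under eq_fun do rewrite ReD; exact: weighted_l2D.
- by under eq_fun do rewrite ImD; exact: weighted_l2D.
Qed.

Lemma cl2Z (a : C) U : cl2 U -> cl2 (fun z => a * U z).
Proof.
move=> [u0 u1]; split.
- under eq_fun do rewrite ReM -mulNr; apply: weighted_l2D; exact: weighted_l2Z.
- under eq_fun do rewrite ImM; apply: weighted_l2D; exact: weighted_l2Z.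
Qed.

Lemma cl2_reflect U : cl2 U -> cl2 (fun z => U (reflect z)).
Proof.
move=> [u0 u1]; split; [exact: (weighted_l2_reflect u0)|exact: (weighted_l2_reflect u1)].
Qed.

Lemma cl2_evenp (F : C -> C) : cl2 (fun z => F (pt z)) -> cl2 (fun z => evenp F (pt z)).
Proof. by move=> hF; apply: cl2Z; apply: cl2D => //; exact: (cl2_reflect hF). Qed.

Lemma cl2_oddp (F : C -> C) : cl2 (fun z => F (pt z)) -> cl2 (fun z => oddp F (pt z)).
Proof.
move=> hF; apply: cl2Z.
under eq_fun do rewrite -mulN1r.
by apply: cl2D => //; apply: cl2Z; exact: (cl2_reflect hF).
Qed.

Lemma qcompZ k (a : R) p : qcomp k (a *: p) = a * qcomp k p.
Proof. by case: k => -[|[|[|[|]]]]. Qed.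

Lemma qcomp_sum k (T : Type) (s : seq T) (u : T -> H) :
  qcomp k (\sum_(i <- s) u i) = \sum_(i <- s) qcomp k (u i).
Proof.
apply: (big_morph (qcomp k)) => [p q|]; first exact: qcompD.
by case: k => -[|[|[|[|]]]].
Qed.

Lemma qcomp_basis k (a : 'I_4 -> R) : qcomp k (\sum_(j < 4) a j *: qbasis R j) = a k.
Proof.
rewrite !big_ord_recl big_ord0 addr0 /qbasis /qcomp /=.
case: k => -[|[|[|[|]]]] //= i; rewrite !(mulr0, mulr1, addr0, add0r);
  congr (a _); exact: val_inj.
Qed.

Lemma ql2_linear V (g : H -> H) : (forall p q, g (p + q) = g p + g q) ->
  (forall (a : R) p, g (a *: p) = a *: g p) -> ql2 V -> ql2 (fun z => g (V z)).
Proof.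
move=> gD gZ hV k.
have g0 : g 0 = 0 by rewrite -(scale0r 0) gZ !scale0r.
have -> : (fun z => qcomp k (g (V z))) =
    (fun z => \sum_(j < 4) qcomp k (g (qbasis R j)) * qcomp j (V z)).
  apply/funext => z; rewrite -{1}(sum_qcomp (V z)) (big_morph g gD g0) qcomp_sum.
  by apply: eq_bigr => j _; rewrite gZ qcompZ mulrC.
by apply: weighted_l2_sum => j; apply: weighted_l2Z; exact: hV.
Qed.

Lemma ql2D V W : ql2 V -> ql2 W -> ql2 (fun z => V z + W z).
Proof. by move=> hV hW k; under eq_fun do rewrite qcompD; exact: weighted_l2D. Qed.

Lemma ql2_sum (T : Type) (s : seq T) (V : T -> R * R -> H) :
  (forall i, ql2 (V i)) -> ql2 (fun z => \sum_(i <- s) V i z).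
Proof.
by move=> hV k; under eq_fun do rewrite qcomp_sum; apply: weighted_l2_sum => i; exact: hV.
Qed.

Lemma ql2_reflect V : ql2 V -> ql2 (fun z => V (reflect z)).
Proof. by move=> hV k; exact: (weighted_l2_reflect (hV k)). Qed.

Lemma qcomp_iotaM k L (c : H) (u : C) :
  qcomp k (iota L u * c) = qcomp k c * Re u + qcomp k (L * c) * Im u.
Proof.
rewrite /iota /slicept mulrDl -!scalerAl mul1r qcompD !qcompZ.
by rewrite ![_ * qcomp k _]mulrC.
Qed.

Lemma ql2_iota L (c : H) U : cl2 U -> ql2 (fun z => iota L (U z) * c).
Proof.
move=> [u0 u1] k; under eq_fun do rewrite qcomp_iotaM.
by apply: weighted_l2D; exact: weighted_l2Z.
Qed.

Lemma ql2_slice_ext m (c : 'I_m -> H) L (P : 'I_m -> C -> C) J : imagunit J ->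
  (forall k, cl2 (fun z => P k (pt z))) ->
  ql2 (fun z => slice_ext c L P (slicept J z.1 z.2)).
Proof.
move=> hJ hP; under eq_fun do rewrite slice_ext_slicept//.
apply: ql2D.
  by apply: ql2_sum => k; apply: ql2_iota; exact: cl2_evenp.
apply: (ql2_linear (g := fun p => J * p)) => [p q|a p|].
- exact: mulrDr.
- by rewrite scalerAr.
by apply: ql2_sum => k; apply: ql2_iota; exact: cl2_oddp.
Qed.

Lemma qnorm_sqr q : qnorm q ^+ 2 = \sum_(k < 4) qcomp k q ^+ 2.
Proof.
rewrite /qnorm sqr_sqrtr ?addr_ge0 ?sqr_ge0//.
by rewrite !big_ord_recl big_ord0 addr0 /qcomp /= !addrA.
Qed.

Lemma ql2_integral V : ql2 V ->
  (\int[mu2]_z (qnorm (V z) ^+ 2 * gauss_weight z)%:E < +oo)%E.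
Proof.
move=> hV.
have [i1 _] := @Rintegral_sum R _ (index_enum 'I_4)
  (fun k z => qcomp k (V z) ^+ 2 * gauss_weight z) (fun k => (hV k).2).
have := i1 => /integrableP[_]; congr (_ < _)%E; apply: eq_integral => z _.
rewrite qnorm_sqr mulr_suml gee0_abs// lee_fin sumr_ge0// => k _.
by rewrite mulr_ge0 ?sqr_ge0// gauss_weight_ge0.
Qed.

Lemma ql2_of_integral V : (forall k, continuous (fun z => qcomp k (V z))) ->
  (\int[mu2]_z (qnorm (V z) ^+ 2 * gauss_weight z)%:E < +oo)%E -> ql2 V.
Proof.
move=> cV iV k; split => //.
have c2 j : continuous (fun z => qcomp j (V z) ^+ 2 * gauss_weight z).
  move=> z; apply: cvgM; last exact: continuous_gauss_weight.
  by rewrite expr2; apply: cvgM; exact: cV.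
have E : (fun z => qnorm (V z) ^+ 2 * gauss_weight z) =
   (fun z => \sum_(j < 4) qcomp j (V z) ^+ 2 * gauss_weight z).
  by apply/funext => z; rewrite qnorm_sqr mulr_suml.
have cN : continuous (fun z => qnorm (V z) ^+ 2 * gauss_weight z).
  rewrite E; under eq_fun do rewrite !big_ord_recl big_ord0 addr0.
  by move=> z; apply: cvgD; [exact: c2|apply: cvgD; [exact: c2|apply: cvgD; exact: c2]].
have N0 z : 0 <= qnorm (V z) ^+ 2 * gauss_weight z.
  by rewrite mulr_ge0 ?sqr_ge0// gauss_weight_ge0.
have iN : mu2.-integrable setT (fun z => (qnorm (V z) ^+ 2 * gauss_weight z)%:E).
  apply/integrableP; split; first exact: continuous_prod_emeasurable.
  by under eq_integral do rewrite gee0_abs ?lee_fin//.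
apply: le_integrable_continuous iN; first exact: c2.
move=> z; rewrite ger0_norm; last by rewrite mulr_ge0 ?sqr_ge0// gauss_weight_ge0.
rewrite ler_wpM2r ?gauss_weight_ge0// qnorm_sqr (bigD1 k) //= lerDl sumr_ge0// => j _.
exact: sqr_ge0.
Qed.

Lemma fock_weight_slicept I (z : R * R) : imagunit I ->
  fock_weight (slicept I z.1 z.2) = gauss_weight z.
Proof.
move=> hI; rewrite fock_weight_cgauss re_slicept// im_slicept//.
by rewrite /cgauss /gauss_weight /normsq /sqnorm2 /= real_normK ?num_real.
Qed.

Lemma fock_op_scale n (D : nat -> C -> C) (a : C) z :
  fock_op n (fun k z => a * D k z) z = a * fock_op n D z.
Proof.
rewrite /fock_op !iter_shift_opE mulr_sumr; apply: eq_bigr => j _; ring.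
Qed.

(** The successive derivatives of z^n. For k > n the falling factorial vanishes, so the truncated
    exponent does no harm. *)
Definition ffact_tower n (k : nat) (z : C) : C := (n ^_ k)%:R * z ^+ (n - k).

Lemma tower_ffact n : tower (ffact_tower n).
Proof.
have X m : holo (fun z : C => z ^+ m) (fun z => m%:R * z ^+ m.-1).
  elim: m => [|m IH].
    rewrite (_ : (fun z => _) = (fun=> 1)); last by apply/funext => z; rewrite expr0.
    by apply: (holo_eq (holo_cst 1)); apply/funext => z; rewrite mul0r.
  rewrite (_ : (fun z => _) = (fun z => z * z ^+ m)); last by apply/funext => z; rewrite exprS.
  apply: (holo_eq (holoM (@holo_id R) IH)); apply/funext => z /=.
  by case: m {IH} => [|m] /=; rewrite -[in RHS]natr1 ?exprS; ring.
move=> k; apply: (holo_eq (holoZ (n ^_ k)%:R (X (n - k)%N))).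
apply/funext => z; rewrite /ffact_tower mulrA -natrM -ffactnSr.
by rewrite subnS.
Qed.

Lemma fock_kernel_complex_op n w z :
  fock_op n (weyl (twopi * w^*) (- w) (ffact_tower n)) z =
  (n`!%:R / 2) * fock_kernel_complex n w z.
Proof.
rewrite /fock_op iter_shift_op_weyl /weyl [iter 0 _ _]/= iter_shift_opE /fock_kernel_complex.
have -> : (laguerre n (2 * pi * normsq (z - w)))%:C = laguerre n (twopi * ((z - w)^* * (z - w))).
  rewrite normsqE /twopi -(rmorphM (real_complex R)).
  by rewrite -(rmorph_laguerre (real_complex R)).
have cB (a b : C) : (a - b)^* = a^* - b^* by exact: rmorphB.
transitivity (cexp (twopi * z * w^*) * (n`!%:R * laguerre n (twopi * ((z - w)^* * (z - w))))); last by field.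
rewrite (_ : twopi * w^* * z = twopi * z * w^*); last by ring.
congr (_ * _); rewrite /laguerre mulr_sumr; apply: eq_bigr => j _.
have jn : (j <= n)%N by rewrite -ltnS.
have fj : j`!%:R != 0 :> C by rewrite pnatr_eq0 -lt0n fact_gt0.
rewrite addn0 /ffact_tower bin_sub// subKn//.
have -> : n`!%:R = (n ^_ (n - j))%:R * j`!%:R :> C.
  by rewrite -natrM -[X in (_ * X`!)%N](subKn jn) ffact_fact// leq_subr.
have -> : - twopi * z^* + twopi * w^* = - (twopi * (z - w)^*) by rewrite cB; ring.
rewrite (exprNn (twopi * (z - w)^*)) !exprMn; field.
exact: fj.
Qed.

Lemma fock_kernel_in_true_fock n I r : imagunit I ->
  true_fock I n (fun q => fock_kernel n q r).
Proof.
move=> hI; rewrite fock_kernelE; set L := imdir r; set w := slice_point r.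
have hL : imagunit L by exact: imdirP.
split.
  have V : ql2 (fun z => kernel_ext L (fock_kernel_complex n w) (slicept I z.1 z.2)).
    by apply: ql2_slice_ext => // k; exact: weighted_l2_fock_kernel_complex.
  have := ql2_integral V; congr (_ < _)%E; apply: eq_integral => z _.
  by rewrite fock_weight_slicept.
set b : R := (-1) ^+ n * _.
have p0 : (0 : R) < (2 * pi) ^+ n * n`!%:R.
  by rewrite mulr_gt0 ?exprn_gt0 ?mulr_gt0 ?pi_gt0// ltr0n fact_gt0.
have b0 : b != 0.
  by rewrite /b mulf_neq0 ?signr_eq0// gt_eqF// sqrtr_gt0 divr_gt0.
have bC : b%:C != 0 :> C by rewrite eq_complex /= eqxx andbT.
have fn : n`!%:R != 0 :> C by rewrite pnatr_eq0 -lt0n fact_gt0.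
(* The constant undoes the normalization [b] of the space and the factor n! / 2 of
   [fock_kernel_complex_op]. *)
pose D : nat -> C -> C := fun k z =>
  (2 / (b%:C * n`!%:R)) * weyl (twopi * w^*) (- w) (ffact_tower n) k z.
have hD : tower D.
  by move=> k; apply: holoZ; apply: tower_weyl; exact: tower_ffact.
exists (kernel_ext L (D 0%N)).
  by apply: (@slice_regular_ext R 1 (fun=> 1) L (fun=> D 0%N) (fun=> D 1%N)) => k; exact: (hD 0%N).
move=> q; rewrite (@slice_ext_fock R 1 (fun=> 1) L n b (fun=> D) q)//.
rewrite /kernel_ext; congr (slice_ext _ _ _ q); apply/funext => _; apply/funext => z.
rewrite fock_op_scale fock_kernel_complex_op.
by field; rewrite bC fn.
Qed.

Definition intrinsic (F : C -> C) := forall z, F z^* = (F z)^*.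

Lemma cderiv_unique (u : R -> C) (t : R) d e : cderiv u t d -> cderiv u t e -> d = e.
Proof.
move=> [d0 d1] [e0 e1]; apply: complexP.
- by rewrite -(@derive_val _ _ _ _ _ _ _ d0) (@derive_val _ _ _ _ _ _ _ e0).
- by rewrite -(@derive_val _ _ _ _ _ _ _ d1) (@derive_val _ _ _ _ _ _ _ e1).
Qed.

Lemma intrinsic_deriv F F' : holo F F' -> intrinsic F -> intrinsic F'.
Proof.
move=> [_ _ h] iF [x y].
have h1 := h _ _ _ (cderiv_hline x (- y)).
have h2 := cderiv_conj (h _ _ _ (cderiv_hline x y)).
rewrite !mulr1 in h1 h2; apply: cderiv_unique h1 _.
rewrite [X in cderiv X](_ : _ = (fun s => ((F \o (fun s => s +i* y)) s)^*)) //.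
by apply/funext => s /=; rewrite -iF.
Qed.

Lemma intrinsic_fock_op n D : tower D -> intrinsic (D 0%N) -> intrinsic (fock_op n D).
Proof.
move=> hD iD.
have iDk k : intrinsic (D k) by elim: k => // k; exact: intrinsic_deriv (hD k).
have cM (a b : C) : (a * b)^* = a^* * b^* by exact: rmorphM.
have cX (a : C) m : (a ^+ m)^* = a^* ^+ m by exact: rmorphXn.
have cS (u : 'I_n.+1 -> C) : (\sum_j u j)^* = \sum_j (u j)^* by exact: rmorph_sum.
have ct : (- twopi)^* = - twopi by apply: complexP; rewrite /= ?oppr0.
move=> z; rewrite /fock_op !iter_shift_opE cS; apply: eq_bigr => j _.
by rewrite !cM cX cM conjc_nat iDk conjcK ct.
Qed.

Lemma slice_ext_qbasis L (F : 'I_4 -> C -> C) J (z : R * R) : imagunit J ->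
  (forall k, intrinsic (F k)) ->
  slice_ext (qbasis R) L F (slicept J z.1 z.2) =
  \sum_(k < 4) Re (F k (pt z)) *: qbasis R k + J * \sum_(k < 4) Im (F k (pt z)) *: qbasis R k.
Proof.
move=> hJ iF; rewrite slice_ext_slicept// /stem_sum.
congr (_ + _ * _); apply: eq_bigr => k _; rewrite /evenp /oddp iF -/(pt z).
- by case: (F k _) => a b /=; rewrite half_add_conj iota_real -scalerAl mul1r.
- by case: (F k _) => a b /=; rewrite half_sub_conj iota_real -scalerAl mul1r.
Qed.

(** The values at z and at its reflection on C_I are A + I B and A - I B, so A and B are
    square-integrable separately. The components F k are common to all slices, which transfers
    integrability from the slice of [I] to any other. *)
Lemma cl2_intrinsic_components L (F : 'I_4 -> C -> C) I : imagunit I ->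
  (forall k, intrinsic (F k)) -> (forall k, ccont (F k)) ->
  (\int[@lambda2 R]_z (qnorm (slice_ext (qbasis R) L F (slicept I z.1 z.2)) ^+ 2
     * fock_weight (slicept I z.1 z.2))%:E < +oo)%E ->
  forall k, cl2 (fun z => F k (pt z)).
Proof.
move=> hI iF cF fin.
pose V z := slice_ext (qbasis R) L F (slicept I z.1 z.2).
pose A z : H := \sum_(k < 4) Re (F k (pt z)) *: qbasis R k.
pose B z : H := \sum_(k < 4) Im (F k (pt z)) *: qbasis R k.
have VE z : V z = A z + I * B z by exact: slice_ext_qbasis.
have Vr z : V (reflect z) = A z - I * B z.
  rewrite VE -mulrN /A /B -sumrN; congr (_ + _ * _); apply: eq_bigr => k _.
  - by rewrite pt_reflect iF; case: (F k _).
  - by rewrite pt_reflect iF -scaleNr; case: (F k _).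
have hV : ql2 V.
  apply: ql2_of_integral.
    move=> k; rewrite (_ : (fun z => _) = (fun z => Re (F k (pt z)) +
        \sum_(j < 4) qcomp k (I * qbasis R j) * Im (F j (pt z)))).
      have cs j z : (qcomp k (I * qbasis R j) * Im (F j (pt z))) @[z --> z] -->
          qcomp k (I * qbasis R j) * Im (F j (pt z)).
        by apply: cvgM; [exact: cvg_cst|exact: (cF j).2].
      under eq_fun do rewrite !big_ord_recl big_ord0 addr0.
      move=> z; apply: cvgD; first exact: (cF k).1.
      by do 3! (apply: cvgD; first exact: cs); exact: cs.
    apply/funext => z; rewrite VE qcompD qcomp_basis mulr_sumr qcomp_sum; congr (_ + _).
    by apply: eq_bigr => j _; rewrite -scalerAr qcompZ mulrC.
  move: fin; congr (_ < _)%E; apply: eq_integral => z _.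
  by rewrite fock_weight_slicept.
have hVr := ql2_reflect hV.
have sc (a : R) W : ql2 W -> ql2 (fun z => a *: W z).
  by move=> hW k; under eq_fun do rewrite qcompZ; apply: weighted_l2Z; exact: hW.
have hA : ql2 A.
  rewrite (_ : A = (fun z => 2^-1 *: (V z + V (reflect z)))); first by apply: sc; exact: ql2D.
  apply/funext => z; rewrite Vr VE addrACA subrr addr0 -mulr2n.
  by rewrite -[A z *+ 2]scaler_nat scalerA mulVf ?scale1r.
have hB : ql2 B.
  rewrite (_ : B = (fun z => - 2^-1 *: (I * (V z + (-1) *: V (reflect z))))).
    apply: (sc); apply: (ql2_linear (g := fun p => I * p)) => [p q|a p|].
    - exact: mulrDr.
    - by rewrite scalerAr.
    by apply: ql2D => //; exact: sc.
  apply/funext => z; rewrite Vr VE scaleN1r opprB [A z + _]addrC addrACA subrr addr0.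
  rewrite -mulr2n -[(I * B z) *+ 2]scaler_nat -scalerAr mulrA -expr2 hI mulN1r scalerA mulNr mulVf//.
  by rewrite scaleN1r opprK.
move=> k; split.
- by have := hA k; under eq_fun do rewrite qcomp_basis.
- by have := hB k; under eq_fun do rewrite qcomp_basis.
Qed.

Lemma qconj_sum (T : Type) (s : seq T) (u : T -> H) :
  qconj (\sum_(i <- s) u i) = \sum_(i <- s) qconj (u i).
Proof.
by apply: (big_morph _ (@qconjD R)); apply: quatP; split => //=; rewrite oppr0.
Qed.

Lemma ql2_product V W k : ql2 V -> ql2 W ->
  continuous (fun z => qcomp k (gauss_weight z *: (qconj (V z) * W z))) /\
  mu2.-integrable setT (fun z => (qcomp k (gauss_weight z *: (qconj (V z) * W z)))%:E).
Proof.
move=> hV hW.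
pose F (i j : 'I_4) z := qcomp k (qconj (qbasis R i) * qbasis R j) *
  (qcomp i (V z) * qcomp j (W z) * gauss_weight z).
have E : (fun z => qcomp k (gauss_weight z *: (qconj (V z) * W z))) =
   (fun z => \sum_(i < 4) \sum_(j < 4) F i j z).
  apply/funext => z; rewrite -{1}(sum_qcomp (V z)) -{1}(sum_qcomp (W z)) qconj_sum.
  rewrite mulr_suml qcompZ qcomp_sum mulr_sumr; apply: eq_bigr => i _.
  rewrite mulr_sumr qcomp_sum mulr_sumr; apply: eq_bigr => j _.
  have -> : qconj (qcomp i (V z) *: qbasis R i) = qcomp i (V z) *: qconj (qbasis R i).
    by apply: quatP; split => //=; rewrite mulrN.
  by rewrite -scalerAl -scalerAr !qcompZ /F; ring.
have iF i j : mu2.-integrable setT (fun z => (F i j z)%:E).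
  by apply: integrableZ_real; apply: weighted_l2M.
have cF i j : continuous (F i j).
  move=> z; apply: cvgM; first exact: cvg_cst.
  apply: cvgM; last exact: continuous_gauss_weight.
  by apply: cvgM; [exact: (hV i).1|exact: (hW j).1].
split.
  rewrite E; under eq_fun do rewrite !big_ord_recl !big_ord0 !addr0.
  have c4 i z : (F i ord0 z + (F i (lift ord0 ord0) z + (F i (lift ord0 (lift ord0 ord0)) z +
     F i (lift ord0 (lift ord0 (lift ord0 ord0))) z))) @[z --> z] -->
     F i ord0 z + (F i (lift ord0 ord0) z + (F i (lift ord0 (lift ord0 ord0)) z +
     F i (lift ord0 (lift ord0 (lift ord0 ord0))) z)).
    by do 3! (apply: cvgD; first exact: cF); exact: cF.
  by move=> z; do 3! (apply: cvgD; first exact: c4); exact: c4.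
have S j := Rintegral_sum (index_enum 'I_4) (iF j).
have [S1 _] := Rintegral_sum (index_enum 'I_4) (fun j => (S j).1).
by move: S1; rewrite -(funext (fun z => congr1 EFin (congr1 (@^~ z) E))).
Qed.

End Reproducing.

(** * The inner product on an arbitrary slice *)

Section ReproducingKernel.
Variable R : realType.
Local Notation C := R[i].
Local Notation H := (quat R).
Local Notation mu := (@lebesgue_measure R).
Local Notation mu2 := (mu \x mu)%E.
Implicit Types (L I J p q r : H) (V W : R * R -> H) (U : R * R -> C) (w : C).

Lemma cl2_conjM U U' : cl2 U -> cl2 U' ->
  let G1 z := Re ((U z)^* * U' z) * gauss_weight z in
  let G2 z := Im ((U z)^* * U' z) * gauss_weight z in
  [/\ continuous G1, continuous G2,
   mu2.-integrable setT (EFin \o G1) & mu2.-integrable setT (EFin \o G2)].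
Proof.
move=> [u0 u1] [v0 v1] G1 G2.
have E1 : G1 = (fun z => Re (U z) * Re (U' z) * gauss_weight z
                       + Im (U z) * Im (U' z) * gauss_weight z).
  by apply/funext => z; rewrite /G1; case: (U z) (U' z) => a b [c d] /=; ring.
have E2 : G2 = (fun z => Re (U z) * Im (U' z) * gauss_weight z
                       + (-1) * (Im (U z) * Re (U' z) * gauss_weight z)).
  by apply/funext => z; rewrite /G2; case: (U z) (U' z) => a b [c d] /=; ring.
have cM (u v : R * R -> R) : continuous u -> continuous v ->
    continuous (fun z => u z * v z * gauss_weight z).
  move=> cu cv z; apply: cvgM; last exact: continuous_gauss_weight.
  by apply: cvgM; [exact: cu|exact: cv].
split.
- rewrite E1 => z; apply: cvgD.
    exact: (cM _ _ u0.1 v0.1).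
  exact: (cM _ _ u1.1 v1.1).
- rewrite E2 => z; apply: cvgD; first exact: (cM _ _ u0.1 v1.1).
  by apply: cvgM; [exact: cvg_cst|exact: (cM _ _ u1.1 v0.1)].
- by rewrite E1; apply: integrableD_real; exact: weighted_l2M.
- rewrite E2; apply: integrableD_real; first exact: weighted_l2M.
  by apply: integrableZ_real; exact: weighted_l2M.
Qed.

Lemma gauss_weight_reflect (z : R * R) : gauss_weight (reflect z) = gauss_weight z.
Proof. by rewrite /gauss_weight /sqnorm2 /= sqrrN. Qed.

Lemma integral_add_reflect (G : R * R -> R) : continuous G ->
  mu2.-integrable setT (EFin \o G) ->
  mu2.-integrable setT (fun z => (G z + G (reflect z))%:E) /\
  (\int[mu2]_z (G z + G (reflect z)) = 2 * \int[mu2]_z G z)%R.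
Proof.
move=> cG iG.
have [iGr eGr] := preserves2_integrable (preserves2_reflect R) cG iG.
split; first exact: integrableD_real.
rewrite RintegralD//.
by rewrite [X in _ + X]eGr mulr2n mulrDl mul1r.
Qed.

Lemma complex_reproducing_reflect n (D : nat -> C -> C) w : tower D ->
  cl2 (fun z => fock_op n D (pt z)) ->
  let T z := (fock_kernel_complex n w (pt z))^* * fock_op n D (pt z) in
  [/\ mu2.-integrable setT (fun z => (Re (T z + T (reflect z)) * gauss_weight z)%:E),
      mu2.-integrable setT (fun z => (Im (T z + T (reflect z)) * gauss_weight z)%:E),
      (\int[mu2]_z (Re (T z + T (reflect z)) * gauss_weight z)
         = 2 * Re (fock_op n D w))%R &
      (\int[mu2]_z (Im (T z + T (reflect z)) * gauss_weight z)
         = 2 * Im (fock_op n D w))%R].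
Proof.
move=> hD cD T.
have [c1 c2 i1 i2] := cl2_conjM (weighted_l2_fock_kernel_complex n w) cD.
have [e1 e2] := complex_reproducing w hD cD.1 cD.2.
have [j1 f1] := integral_add_reflect c1 i1.
have [j2 f2] := integral_add_reflect c2 i2.
have E1 : (fun z => Re (T z + T (reflect z)) * gauss_weight z) =
    (fun z => Re (T z) * gauss_weight z + Re (T (reflect z)) * gauss_weight (reflect z)).
  by apply/funext => z; rewrite gauss_weight_reflect ReD mulrDl.
have E2 : (fun z => Im (T z + T (reflect z)) * gauss_weight z) =
    (fun z => Im (T z) * gauss_weight z + Im (T (reflect z)) * gauss_weight (reflect z)).
  by apply/funext => z; rewrite gauss_weight_reflect ImD mulrDl.
split.
- by move: j1; congr (_.-integrable _ _); apply/funext => z; rewrite -[RHS]/(((fun z => _) z)%:E) E1.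
- by move: j2; congr (_.-integrable _ _); apply/funext => z; rewrite -[RHS]/(((fun z => _) z)%:E) E2.
- by rewrite E1 f1 e1.
- by rewrite E2 f2 e2.
Qed.

(** For f the value at z of a function that commutes with conjugation, f^* is its value at z^*. The
    pairing of stems thus becomes the complex integrand at z plus the one at z^*. *)
Lemma conj_evenp_oddp (K : C -> C) (z f : C) :
  2 * ((evenp K z)^* * (Re f)%:C + (oddp K z)^* * (Im f)%:C) =
  (K z)^* * f + (K z^*)^* * f^*.
Proof.
have cM (a b : C) : (a * b)^* = a^* * b^* by exact: rmorphM.
have cD (a b : C) : (a + b)^* = a^* + b^* by exact: rmorphD.
have cN (a : C) : (- a)^* = - a^* by exact: rmorphN.
have c2 : (2^-1 : C)^* = 2^-1 by rewrite fmorphV; congr (_^-1); exact: (conjc_nat _ 2).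
have ci : (imu : C)^* = - imu by apply: complexP; rewrite /= ?oppr0.
have E : f = (Re f)%:C + imu * (Im f)%:C.
  by case: f => a b; apply: complexP; rewrite !cpartsE /=; ring.
have Ec : f^* = (Re f)%:C - imu * (Im f)%:C.
  by case: f {E} => a b; apply: complexP; rewrite !cpartsE /=; ring.
rewrite Ec {3}E /evenp /oddp !(cM, cN, cD) c2 ci.
by field.
Qed.

(* In the sum of the values at z and z^* the cross terms, which involve the unit
   [J] of the slice of integration, cancel. *)
Lemma slice_pair_sum J P Q A B : imagunit J ->
  (P + Q * - J) * (A + J * B) + (P - Q * - J) * (A - J * B) = 2 *: (P * A + Q * B).
Proof.
move=> hJ.
have JJ : Q * J * (J * B) = - (Q * B).
  by rewrite -mulrA [J * (J * B)]mulrA -expr2 hJ mulN1r mulrN.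
rewrite !mulrN opprK !mulrDl !mulrDr !mulNr !mulrN JJ opprK.
set a := P * A; set b := P * (J * B); set c := Q * J * A; set d := Q * B.
rewrite [a - b]addrC !addrA scaler_nat mulr2n !addrA.
by apply: quatP; split => /=; ring.
Qed.

(** Twice the integral is the integral of the integrand summed over z and its reflection. By
    [slice_pair_sum] this sum is free of [J] and splits into terms of C_L times a basis element, to
    which the complex reproducing property applies one component at a time. *)
Lemma fock_inner_kernel n r J (D : 'I_4 -> nat -> C -> C) : imagunit J ->
  (forall k, tower (D k)) -> (forall k, intrinsic (fock_op n (D k))) ->
  (forall k, cl2 (fun z => fock_op n (D k) (pt z))) ->
  fock_inner J (slice_ext (qbasis R) (imdir r) (fun k => fock_op n (D k)))
    (fun q => fock_kernel n q r) =
  slice_ext (qbasis R) (imdir r) (fun k => fock_op n (D k)) r.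
Proof.
move=> hJ hD iD cD; rewrite fock_kernelE.
set L := imdir r; set w := slice_point r.
have hL : imagunit L by exact: imdirP.
pose F k := fock_op n (D k).
set f := slice_ext _ _ _; set kap := fock_kernel_complex n w.
pose V z := kernel_ext L kap (slicept J z.1 z.2).
pose W z := f (slicept J z.1 z.2).
have hV : ql2 V.
  by apply: ql2_slice_ext => // k; exact: weighted_l2_fock_kernel_complex.
have hW : ql2 W by apply: ql2_slice_ext.
pose U z := gauss_weight z *: (qconj (V z) * W z).
pose T j z := (kap (pt z))^* * F j (pt z).
have sumU z : U z + U (reflect z) =
    gauss_weight z *: \sum_(j < 4) iota L (T j z + T j (reflect z)) * qbasis R j.
  rewrite /U gauss_weight_reflect -scalerDr; congr (_ *: _).
  have [_ _ VJ] := slice_stem_kernel_ext L kap.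
  have VE : V z = iota L (evenp kap (pt z)) + J * iota L (oddp kap (pt z)).
    by rewrite /V VJ.
  have Vr : V (reflect z) = iota L (evenp kap (pt z)) - J * iota L (oddp kap (pt z)).
    by rewrite /V VJ// -/(pt (reflect z)) pt_reflect evenp_conj oddp_conj iotaN mulrN.
  pose A : H := \sum_(k < 4) Re (F k (pt z)) *: qbasis R k.
  pose B : H := \sum_(k < 4) Im (F k (pt z)) *: qbasis R k.
  have WE : W z = A + J * B by exact: slice_ext_qbasis.
  have Wr : W (reflect z) = A - J * B.
    rewrite /W /f (slice_ext_qbasis _ (reflect z) hJ iD) -mulrN
      /A /B -sumrN; congr (_ + _ * _); apply: eq_bigr => j _.
    - by rewrite pt_reflect iD /F; case: (fock_op _ _ _).
    - by rewrite pt_reflect iD /F -scaleNr; case: (fock_op _ _ _).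
  have cV (a b : C) : qconj (iota L a + J * iota L b) = iota L a^* + iota L b^* * - J.
    by rewrite (qconjD (iota L a)) qconjM (qconj_imagunit hJ) !(qconj_iota _ hL).
  rewrite VE Vr WE Wr -(mulrN J (iota L _)) -iotaN !cV.
  rewrite (_ : (- oddp kap (pt z))^* = - (oddp kap (pt z))^*) ?iotaN ?mulNr; last exact: rmorphN.
  rewrite slice_pair_sum// /A /B !mulr_sumr -big_split scaler_sumr.
  apply: eq_bigr => j _.
  rewrite -[X in _ *: X]/(_ + _) -!scalerAr ![_ *: (iota _ _ * _)]scalerAl -!iotaZ -mulrDl -iotaD scalerAl -iotaZ.
  congr (iota L _ * _).
  rewrite /T /F pt_reflect iD -conj_evenp_oddp (rmorph_nat (real_complex R) 2).
  by rewrite -/kap [(Re _)%:C * _]mulrC [(Im _)%:C * _]mulrC.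
have key k : (\int[mu2]_z qcomp k (U z))%R = qcomp k (f r).
  have [cU iU] := ql2_product k hV hW.
  have [_ eU] := integral_add_reflect cU iU.
  have n2 : 2 != 0 :> R by [].
  apply: (mulfI n2); rewrite -eU.
  have i12 j := complex_reproducing_reflect w (hD j) (cD j).
  pose S j z := qcomp k (qbasis R j) * (Re (T j z + T j (reflect z)) * gauss_weight z)
     + qcomp k (L * qbasis R j) * (Im (T j z + T j (reflect z)) * gauss_weight z).
  have iS j : mu2.-integrable setT (fun z => (S j z)%:E).
    have [i1 i2 _ _] := i12 j.
    by apply: integrableD_real; exact: integrableZ_real.
  have eS j : (\int[mu2]_z S j z)%R = 2 * qcomp k (iota L (F j w) * qbasis R j).
    have [i1 i2 e1 e2] := i12 j.
    rewrite RintegralD//; try exact: integrableZ_real.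
    rewrite !RintegralZl// e1 e2 qcomp_iotaM; ring.
  transitivity (\int[mu2]_z (\sum_(j < 4) S j z))%R.
    apply: eq_Rintegral => z _.
    rewrite -qcompD sumU qcompZ qcomp_sum mulr_sumr; apply: eq_bigr => j _.
    by rewrite qcomp_iotaM /S; ring.
  have [_ ->] := Rintegral_sum (index_enum 'I_4) iS.
  under eq_bigr do rewrite eS.
  rewrite -mulr_sumr -qcomp_sum; congr (_ * qcomp k _).
  (* The point [r] lies on C_L itself, where the extension is the sum of its components. *)
  by rewrite -[in RHS](sliceptE r) /f slice_ext_self.
have -> : f r = \sum_(k < 4) (\int[mu2]_z qcomp k (U z))%R *: qbasis R k.
  by rewrite -[LHS]sum_qcomp; apply: eq_bigr => k _; rewrite key.
have UE : U = (fun z => fock_weight (slicept J z.1 z.2) *: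
   (qconj (kernel_ext L kap (slicept J z.1 z.2)) * f (slicept J z.1 z.2))).
  by apply/funext => z; rewrite fock_weight_slicept.
rewrite -[LHS]sum_qcomp; apply: eq_bigr => k _; congr (_ *: _).
rewrite /fock_inner /= -UE.
by rewrite /qcomp /=; case: k => -[|[|[|[|]]]].
Qed.

End ReproducingKernel.

Theorem proposition4p2 (R : realType) (n : nat) (I J : quat R)
    (hI : imagunit I) (hJ : imagunit J) (r : quat R) :
  true_fock I n (fun q => fock_kernel n q r) /\
  forall f : quat R -> quat R, true_fock I n f ->
    f r = fock_inner J f (fun q => fock_kernel n q r).
Proof.
split; first exact: fock_kernel_in_true_fock.
move=> f [fin [h hh fE]].
have hL : imagunit (imdir r) by exact: imdirP.
have [F [F' [hF iF hE]]] := slice_regular_holo hL hh.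
set b : R := _ * Num.sqrt _ in fE.
(* The components are only known to be holomorphic; Cauchy's integral supplies all their
   derivatives, and [D] then absorbs the real normalizing constant, which preserves the symmetry
   under conjugation. *)
pose E k m := iter m (@cauchy_deriv R) (F k).
pose D k m z := b%:C * E k m z.
have hEt k : tower (E k) by exact: holo_tower (hF k).
have hD k : tower (D k) by move=> m; apply: holoZ; exact: hEt.
have iD k : intrinsic (fock_op n (D k)).
  apply: intrinsic_fock_op => // z; rewrite /D /E /= iF.
  by case: (F k z) => x y; apply: complexP; rewrite /=; ring.
have {}fE : f = slice_ext (qbasis R) (imdir r) (fun k => fock_op n (D k)).
  apply/funext => q; rewrite fE hE (@slice_ext_fock _ _ _ _ _ b E)//.
  congr (slice_ext _ _ _ q); apply/funext => k; apply/funext => z.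
  by rewrite fock_op_scale.
rewrite {}fE in fin *.
by rewrite fock_inner_kernel//; apply: cl2_intrinsic_components fin => // k; exact: ccont_fock_op.
Qed.
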